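(* Given a matrix $A\in\mathbb{R}^{n\times d}$, for any integer $k\geq 1$ there exists an algorithm which takes $(nd)^{\widetilde{O}(k^2)}$ time and outputs two matrices $U\in\mathbb{R}^{n\times 2k}$, $V\in\mathbb{R}^{2k\times d}$ such that, with probability $9/10$, $$\|UV-A\|_1\lesssim \min_{\mathrm{rank}\text{-}k\ A_k}\|A_k-A\|_1.$$
   Context: $\|C\|_1=\sum_{i,j}|C_{i,j}|$ is the entrywise $\ell_1$ norm; $\widetilde{O}(f)=f\cdot\log^{O(1)}(f)$; $f\lesssim g$ means $f\leq Cg$ for an absolute constant $C$. The minimum is over all $n\times d$ matrices of rank at most $k$. *)

(* Defs.v *)
From HB Require Import structures.
From mathcomp Require Import all_boot all_order all_algebra.
From mathcomp Require Import all_classical all_reals all_analysis.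
Set Implicit Arguments.
Unset Strict Implicit.
Unset Printing Implicit Defensive.
Import Order.TTheory GRing.Theory Num.Theory.
Import numFieldNormedType.Exports.
Local Open Scope classical_set_scope.
Local Open Scope ring_scope.

Definition l1norm {R : realType} {n d : nat} (C : 'M[R]_(n, d)) : R :=
  \sum_(i < n) \sum_(j < d) `|C i j|.

(* The set is nonempty (B = 0), bounded below by 0, and its infimum is attained
   because the matrices of rank at most k form a closed set. *)
Definition opt_rank {R : realType} {n d : nat} (A : 'M[R]_(n, d)) (k : nat) : R :=
  inf [set l1norm (B - A) | B in [set B : 'M[R]_(n, d) | (\rank B <= k)%N]].

(* g = O~(f) on k >= 1.  The factor is (1 + ln f) rather than ln f because the
   latter vanishes at f = 1; for f >= 2 the two agree up to a constant factor. *)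
Definition is_softO {R : realType} (f g : nat -> R) : Prop :=
  exists C : nat, forall k : nat, (1 <= k)%N ->
    g k <= C%:R * f k * (1 + ln (f k)) ^+ C.

(* Randomized real RAM, as a structured language.  A program is a finite piece
   of syntax that does not mention R, so its only literals are natural numbers.
   Memory is made of two-dimensional arrays of naturals and of reals; the name
   of an array is fixed in the program, its two indices are computed. *)

(* There is no unit-cost multiplication of naturals.  ISub is truncated. *)
Inductive iexp : Type :=
| IConst of nat
| IGet (a : nat) (i j : iexp)
| IAdd of iexp & iexp
| ISub of iexp & iexp.

(* There is no rounding: reals never flow back into the naturals, except through
   the outcome of comparisons.  Division by 0 returns 0, as in MathComp. *)
Inductive rexp : Type :=
| ROfInt of iexp
| RGet (a : nat) (i j : iexp)
| RAdd of rexp & rexp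
| RSub of rexp & rexp
| RMul of rexp & rexp
| RDiv of rexp & rexp.

Inductive bexp : Type :=
| ILe of iexp & iexp
| RLe of rexp & rexp
| BNot of bexp
| BAnd of bexp & bexp.

Inductive cmd : Type :=
| Skip
| ISet (a : nat) (i j : iexp) (e : iexp)
| RSet (a : nat) (i j : iexp) (e : rexp)
| Sample (a : nat) (i j : iexp)
| Seq of cmd & cmd
| If of bexp & cmd & cmd
| While of bexp & cmd.

Record state (R : Type) := State {
  ints : nat -> nat -> nat -> nat;
  reals : nat -> nat -> nat -> R;
  draws : nat (* number of random samples drawn so far *)
}.

Definition update {T : Type} (m : nat -> nat -> nat -> T) (a i j : nat) (v : T)
    : nat -> nat -> nat -> T :=
  fun a' i' j' => if [&& a' == a, i' == i & j' == j] then v else m a' i' j'.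

Fixpoint ieval {R : realType} (s : state R) (e : iexp) : nat :=
  match e with
  | IConst c => c
  | IGet a i j => ints s a (ieval s i) (ieval s j)
  | IAdd e1 e2 => (ieval s e1 + ieval s e2)%N
  | ISub e1 e2 => (ieval s e1 - ieval s e2)%N
  end.

Fixpoint reval {R : realType} (s : state R) (e : rexp) : R :=
  match e with
  | ROfInt e1 => (ieval s e1)%:R
  | RGet a i j => reals s a (ieval s i) (ieval s j)
  | RAdd e1 e2 => reval s e1 + reval s e2
  | RSub e1 e2 => reval s e1 - reval s e2
  | RMul e1 e2 => reval s e1 * reval s e2
  | RDiv e1 e2 => reval s e1 / reval s e2
  end.

Fixpoint beval {R : realType} (s : state R) (b : bexp) : bool :=
  match b with
  | ILe e1 e2 => (ieval s e1 <= ieval s e2)%N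
  | RLe e1 e2 => reval s e1 <= reval s e2
  | BNot b1 => ~~ beval s b1
  | BAnd b1 b2 => beval s b1 && beval s b2
  end.

Definition iset {R : realType} (s : state R) (a i j v : nat) : state R :=
  State (update (ints s) a i j v) (reals s) (draws s).
Definition rset {R : realType} (s : state R) (a i j : nat) (v : R) : state R :=
  State (ints s) (update (reals s) a i j v) (draws s).

(* exec w c s t s': with w 0, w 1, ... as successive random samples, c started
   in s halts in s' after t steps.  A step is an assignment, a sample or a test.
   The size of each expression is fixed by the program, so counting the
   operations inside expressions would only change t by a constant factor. *)
Inductive exec {R : realType} (w : nat -> R) : cmd -> state R -> nat -> state R -> Prop :=
| exec_skip s : exec w Skip s 1 s
| exec_iset s a i j e :
    exec w (ISet a i j e) s 1 (iset s a (ieval s i) (ieval s j) (ieval s e))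
| exec_rset s a i j e :
    exec w (RSet a i j e) s 1 (rset s a (ieval s i) (ieval s j) (reval s e))
| exec_sample s a i j :
    exec w (Sample a i j) s 1
      (State (ints s)
             (update (reals s) a (ieval s i) (ieval s j) (w (draws s)))
             (draws s).+1)
| exec_seq c1 c2 s t1 s1 t2 s2 :
    exec w c1 s t1 s1 -> exec w c2 s1 t2 s2 ->
    exec w (Seq c1 c2) s (t1 + t2)%N s2
| exec_if b c1 c2 s t s1 :
    exec w (if beval s b then c1 else c2) s t s1 ->
    exec w (If b c1 c2) s t.+1 s1
| exec_while_stop b c s :
    ~~ beval s b -> exec w (While b c) s 1 s
| exec_while_step b c s t1 s1 t2 s2 :
    beval s b -> exec w c s t1 s1 -> exec w (While b c) s1 t2 s2 ->
    exec w (While b c) s (t1 + t2).+1 s2.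

Definition halts_within {R : realType} (c : cmd) (w : nat -> R)
    (s : state R) (T : R) : Prop :=
  exists t s', exec w c s t s' /\ t%:R <= T.

(* Entries (0, 0), (0, 1), (0, 2) of integer array 0 hold n, d and k, and real
   array 0 holds A; the rest of the memory is 0. *)
Definition input {R : realType} {n d : nat} (A : 'M[R]_(n, d)) (k : nat) : state R :=
  State
    (fun a i j => if (a == 0%N) && (i == 0%N) then nth 0%N [:: n; d; k] j else 0%N)
    (fun a i j =>
       match insub i : option 'I_n, insub j : option 'I_d with
       | Some i', Some j' => if a == 0%N then A i' j' else 0
       | _, _ => 0
       end)
    0.

(* The output matrix of size m x p found in real array a. *)
Definition output {R : realType} (m p a : nat) (s : state R) : 'M[R]_(m, p) :=
  \matrix_(i < m, j < p) reals s a i j.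

Definition unit_tape {R : realType} (w : nat -> R) : Prop :=
  forall i, 0 <= w i <= 1.

(* Independent uniform samples of [0, 1]: each u i has the uniform law, and the
   product rule holds for every finite subfamily. *)
Definition iid_uniform {R : realType} {dT : measure_display}
    {T : measurableType dT} (P : probability T R) (u : nat -> {RV P >-> R}) : Prop :=
  [/\ forall x, unit_tape (fun i => u i x),
      forall i (B : set R), measurable B ->
        P (u i @^-1` B) = uniform_prob (@ltr01 R) B
    & forall (r : seq nat) (B : nat -> set R), uniq r ->
        (forall i, measurable (B i)) ->
        P (\bigcap_(i in [set` r]) (u i @^-1` B i))
          = (\prod_(i <- r) P (u i @^-1` B i))%E].

(* The event S is not assumed measurable. *)
Definition holds_with_prob {R : realType} {dT : measure_display}
    {T : measurableType dT} (P : probability T R) (S : set T) (p : R) : Prop :=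
  exists E : set T, [/\ measurable E, E `<=` S & (p%:E <= P E)%E].

(* Main.v *)
(* The algorithm draws no random samples: it is an exhaustive search.

   Gauss-Jordan elimination on a k x k submatrix of A of maximal volume gives
   A = H A_p + M, where A_p consists of the k pivot rows, the entries of H are at
   most 1 and those of M at most (k+1)^2 OPT in absolute value.  Hence mu = |M|_1
   is between OPT and poly(n,d,k) OPT, and every remaining unknown may be rounded
   to mu times a grid with polynomially many points.

   Let B be nearly optimal and E = A - B.  Then B = B_J X for k columns J and
   |X| <= 1 (Cramer's rule on a submatrix of maximal volume), and
   M - E = H Z + F X with Z = (A_p)_J X - A_p and F = (M - E)_J, whose entries are
   O(k mu).  Some weighted set of O(k log k) columns preserves the l1 norms of all
   row vectors u X up to a factor 2, and the weighted norm of E up to a factor 2.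
   It is found by repeatedly halving the set of columns: once no column is heavy
   with respect to approximate Lewis weights, a random choice of signs is balanced
   on all of the row space, by the contraction principle.

   The search ranges over the pivots, the sampled columns, their weights, and the
   values of Z and X there: O(k^2 log k) numbers with polynomially many values.
   For each guess, every row of F is fitted on the sampled columns; then
   U = (H | F), every column of V is fitted to U, and the best U V is kept. *)
Require Import Defs.
From HB Require Import structures.
From mathcomp Require Import all_boot all_order all_algebra.
From mathcomp Require Import perm.
From mathcomp Require Import all_classical all_reals all_analysis.
From mathcomp Require Import zify ring lra.
Set Implicit Arguments.
Unset Strict Implicit.
Unset Printing Implicit Defensive.
Import Order.TTheory GRing.Theory Num.Theory.
Import numFieldNormedType.Exports.
Local Open Scope classical_set_scope.
Local Open Scope ring_scope.

(** * Program logic *)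

(** The entries of A are arbitrary reals, so no guess of finite precision makes sense before a scale
    is known. This is what the elimination provides: H A_p is kept exactly, and the rest has size
    mu, a number that the program can compute. An error of mu / poly(n, d, k) per entry then costs
    only a multiple of OPT. The price is that F is fitted beside H instead of absorbing it, and two
    blocks of k columns make the rank 2k.

    Every guessed number multiplies the running time by a polynomial in n, d and k. Hence the sample
    must have nearly linear size in k and weights polynomial in d; and since k may exceed n d, the
    polynomial in k contributes a logarithm of k to the exponent of the running time.

    A fitted row is compared with the true row of F only through the sampled columns. The lower
    bound on the sampled norms of u X turns this into a bound on all columns, whereas the sampled
    error is controlled only in total over the rows, which is enough after summation. *)

Section ProgramLogic.
Local Open Scope nat_scope.

Fixpoint written_ints (c : cmd) : seq nat :=
  match c with
  | ISet a _ _ _ => [:: a]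
  | Seq c1 c2 | If _ c1 c2 => written_ints c1 ++ written_ints c2
  | While _ c1 => written_ints c1
  | _ => [::]
  end.

Fixpoint written_reals (c : cmd) : seq nat :=
  match c with
  | RSet a _ _ _ | Sample a _ _ => [:: a]
  | Seq c1 c2 | If _ c1 c2 => written_reals c1 ++ written_reals c2
  | While _ c1 => written_reals c1
  | _ => [::]
  end.

(** The frame relation. Its granularity is whole arrays, so that it can be read off the syntax of a
    program. *)
Definition agree_off {R : realType} (li lr : seq nat) (s s' : state R) : Prop :=
  (forall a, a \notin li -> ints s' a = ints s a) /\
  (forall a, a \notin lr -> reals s' a = reals s a).

Lemma agree_off_trans (R : realType) li lr (s1 s2 s3 : state R) :
  agree_off li lr s1 s2 -> agree_off li lr s2 s3 -> agree_off li lr s1 s3.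
Proof.
by move=> [i12 r12] [i23 r23]; split=> a Ha; [rewrite i23 ?i12|rewrite r23 ?r12].
Qed.

Lemma agree_off_sub (R : realType) li lr li' lr' (s s' : state R) :
  {subset li <= li'} -> {subset lr <= lr'} ->
  agree_off li lr s s' -> agree_off li' lr' s s'.
Proof.
move=> subi subr [Hi Hr]; split=> a Ha; [apply: Hi|apply: Hr].
  by apply: contra Ha; apply: subi.
by apply: contra Ha; apply: subr.
Qed.

Lemma agree_off_ints (R : realType) li lr (s s' : state R) (a : nat) :
  agree_off li lr s s' -> a \notin li -> ints s' a = ints s a.
Proof. by case=> H _ /H. Qed.

Lemma agree_off_reals (R : realType) li lr (s s' : state R) (a : nat) :
  agree_off li lr s s' -> a \notin lr -> reals s' a = reals s a.
Proof. by case=> _ H /H. Qed.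

Lemma update_other (T : Type) (m : nat -> nat -> nat -> T) a i j v b :
  b != a -> update m a i j v b = m b.
Proof.
by move=> /negbTE ba; apply/funext => i'; apply/funext => j'; rewrite /update ba.
Qed.

Lemma update_same (T : Type) (m : nat -> nat -> nat -> T) a i j v :
  update m a i j v a i j = v.
Proof. by rewrite /update !eqxx. Qed.

Lemma agree_off_iset (R : realType) (s : state R) a i j v :
  agree_off [:: a] [::] s (iset s a i j v).
Proof. by split=> b //; rewrite inE => ba; rewrite /= update_other. Qed.

Lemma exec_agree_off (R : realType) (w : nat -> R) c s t s' :
  exec w c s t s' -> agree_off (written_ints c) (written_reals c) s s'.
Proof.
elim=> {c s t s'} //=.
- by move=> s a i j e; apply: agree_off_iset.
- move=> s a i j e; split=> b //=; rewrite inE => ba; exact: update_other.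
- move=> s a i j; split=> b //=; rewrite inE => ba; exact: update_other.
- move=> c1 c2 s t1 s1 t2 s2 _ H1 _ H2; apply: (@agree_off_trans _ _ _ _ s1).
    by apply: agree_off_sub H1 => x Hx; rewrite mem_cat Hx.
  by apply: agree_off_sub H2 => x Hx; rewrite mem_cat Hx orbT.
- move=> b c1 c2 s t s1 _ H; apply: agree_off_sub H => x; rewrite mem_cat;
    by case: ifP => _ ->; rewrite ?orbT.
- by move=> b c s t1 s1 t2 s2 _ _ H1 _ H2; apply: agree_off_trans H1 H2.
Qed.

Definition IVar (a : nat) : iexp := IGet a (IConst 0) (IConst 0).
Definition RVar (a : nat) : rexp := RGet a (IConst 0) (IConst 0).
Definition ISetV (a : nat) (e : iexp) : cmd := ISet a (IConst 0) (IConst 0) e.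
Definition RSetV (a : nat) (e : rexp) : cmd := RSet a (IConst 0) (IConst 0) e.

Definition For (v : nat) (e : iexp) (c : cmd) : cmd :=
  Seq (ISetV v (IConst 0))
      (While (BNot (ILe e (IVar v))) (Seq c (ISetV v (IAdd (IVar v) (IConst 1))))).

(* Step counts are tracked only through their logarithm in base B, so that
   sequencing and looping simply add small constants to the exponent. *)
Definition runs {R : realType} (w : nat -> R) (B : nat) (c : cmd) (s : state R) (x : nat)
    (Q : state R -> Prop) : Prop :=
  exists t s', [/\ exec w c s t s', t <= B ^ x & Q s'].

Section Rules.
Variables (R : realType) (w : nat -> R) (B : nat).
Hypothesis B2 : 2 <= B.
Implicit Types (s : state R) (Q : state R -> Prop).
Local Notation runs := (runs w B).

Lemma runs_weaken c s x y Q Q' :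
  x <= y -> (forall s', Q s' -> Q' s') -> runs c s x Q -> runs c s y Q'.
Proof.
move=> xy QQ [t [s' [ex le_t Hq]]]; exists t, s'; split=> //; last exact: QQ.
by apply: leq_trans le_t _; rewrite leq_exp2l.
Qed.

Lemma runs_le c s x y Q : x <= y -> runs c s x Q -> runs c s y Q.
Proof. by move=> xy; apply: runs_weaken. Qed.

(** Lets a specification be silent about the arrays that a program leaves alone. *)
Lemma runs_frame c s x Q :
  runs c s x (fun s' => agree_off (written_ints c) (written_reals c) s s' -> Q s') ->
  runs c s x Q.
Proof.
move=> [t [s' [ex le_t Hq]]]; exists t, s'; split=> //.
exact/Hq/(exec_agree_off ex).
Qed.

Lemma runs_iset a i j e s Q :
  Q (iset s a (ieval s i) (ieval s j) (ieval s e)) -> runs (ISet a i j e) s 0 Q.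
Proof. by move=> Hq; do 2 eexists; split; [exact: exec_iset| |]. Qed.

Lemma runs_rset a i j e s Q :
  Q (rset s a (ieval s i) (ieval s j) (reval s e)) -> runs (RSet a i j e) s 0 Q.
Proof. by move=> Hq; do 2 eexists; split; [exact: exec_rset| |]. Qed.

Lemma runs_skip s Q : Q s -> runs Skip s 0 Q.
Proof. by move=> Hq; do 2 eexists; split; [exact: exec_skip| |]. Qed.

Lemma runs_seq c1 c2 s x y Q :
  runs c1 s x (fun s1 => runs c2 s1 y Q) -> runs (Seq c1 c2) s (x + y).+1 Q.
Proof.
move=> [t1 [s1 [e1 l1 [t2 [s2 [e2 l2 Hq]]]]]].
exists (t1 + t2), s2; split=> //; first exact: exec_seq e1 e2.
have Bx : 0 < B ^ x by rewrite expn_gt0 (ltn_trans _ B2).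
have By : 0 < B ^ y by rewrite expn_gt0 (ltn_trans _ B2).
rewrite expnS expnD; apply: (@leq_trans (B ^ x + B ^ y)); first exact: leq_add.
move: (B ^ x) (B ^ y) Bx By => X Y X0 Y0.
by apply: (@leq_trans (2 * (X * Y))); [nia|rewrite leq_mul2r B2 orbT].
Qed.

Lemma runs_if b c1 c2 s x Q :
  (beval s b -> runs c1 s x Q) -> (~~ beval s b -> runs c2 s x Q) ->
  runs (If b c1 c2) s x.+1 Q.
Proof.
move=> H1 H2.
have [t [s' [e l Hq]]] : runs (if beval s b then c1 else c2) s x Q.
  by case: ifPn.
exists t.+1, s'; split=> //; first exact: exec_if.
have Bx : 0 < B ^ x by rewrite expn_gt0 (ltn_trans _ B2).
rewrite expnS; apply: (@leq_trans (2 * B ^ x)); last by rewrite leq_mul2r B2 orbT.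
by rewrite mul2n -addnn -add1n leq_add.
Qed.

Lemma runs_while b c (N L x : nat) (I : nat -> state R -> Prop) s :
  N <= B ^ L ->
  (forall m s', m < N -> I m s' -> beval s' b /\ runs c s' x (I m.+1)) ->
  (forall s', I N s' -> ~~ beval s' b) ->
  I 0 s -> runs (While b c) s (x + L + 2) (I N).
Proof.
move=> NB step stop I0.
suff H : forall r m s', m + r = N -> I m s' ->
   exists t s2, [/\ exec w (While b c) s' t s2, t <= (r * (B ^ x).+1).+1 & I N s2].
  have [t [s2 [e l IN]]] := H N 0 s erefl I0.
  exists t, s2; split=> //; apply: leq_trans l _.
  have Bx : 0 < B ^ x by rewrite expn_gt0 (ltn_trans _ B2).
  have BL : 0 < B ^ L by rewrite expn_gt0 (ltn_trans _ B2).
  rewrite !expnD; set X := B ^ x in Bx *; set Y := B ^ L in NB BL *.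
  (* [N] rounds cost at most [N * (B ^ x + 1) + 1 <= 4 * B ^ x * B ^ L], and [4 <= B ^ 2]. *)
  apply: (@leq_trans (X * Y * 4)).
    have : N * X.+1 <= Y * X.+1 by rewrite leq_mul2r NB orbT.
    have : Y <= X * Y by rewrite leq_pmull.
    by nia.
  by rewrite leq_mul2l; apply/orP; right; rewrite (leq_sqr 2 B).
elim=> [|r IH] m s'.
  rewrite addn0 => -> IN; exists 1, s'; split=> //.
  exact/exec_while_stop/stop.
move=> mN Im; have mltN : m < N by rewrite -mN addnS ltnS leq_addr.
have [bs [t1 [s1 [e1 l1 I1]]]] := step _ _ mltN Im.
have [|t2 [s2 [e2 l2 I2]]] := IH m.+1 s1 _ I1; first by rewrite addSnnS.
exists (t1 + t2).+1, s2; split=> //; first exact: exec_while_step e1 e2.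
by rewrite mulSn ltnS; lia.
Qed.

(** The body has to establish the invariant with the counter already advanced, because an invariant
    may mention [v]. The bound [e] is evaluated again at each test, hence the hypothesis that it
    keeps its value under every change the loop can make. *)
Lemma runs_for (N x : nat) (I : nat -> state R -> Prop) v e c s Q :
  N <= B ->
  v \notin written_ints c ->
  (forall s', agree_off (v :: written_ints c) (written_reals c) s s' -> ieval s' e = N) ->
  I 0 (iset s v 0 0 0) ->
  (forall i s', i < N -> agree_off (v :: written_ints c) (written_reals c) s s' ->
     ints s' v 0 0 = i -> I i s' ->
     runs c s' x (fun s2 => I i.+1 (iset s2 v 0 0 i.+1))) ->
  (forall s', agree_off (v :: written_ints c) (written_reals c) s s' -> I N s' -> Q s') ->
  runs (For v e c) s (x + 5) Q.
Proof.
move=> NB vc He I0 step Hq.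
pose F := agree_off (v :: written_ints c) (written_reals c) s.
pose J m s' := [/\ F s', ints s' v 0 0 = m & I m s'].
have sub1 : {subset [:: v] <= v :: written_ints c}.
  by move=> a; rewrite !inE => ->.
have sub2 : {subset written_ints c <= v :: written_ints c}.
  by move=> a; rewrite !inE => ->; rewrite orbT.
have J0 : J 0 (iset s v 0 0 0).
  split=> //; last by rewrite /= update_same.
  by apply: agree_off_sub (agree_off_iset _ _ _ _ _) => //.
have run_loop : runs (While (BNot (ILe e (IVar v)))
    (Seq c (ISetV v (IAdd (IVar v) (IConst 1))))) (iset s v 0 0 0) (x.+1 + 1 + 2) (J N).
  apply: runs_while J0; first by rewrite expn1.
    move=> m s' mN [Fs vm Im]; split; first by rewrite /= He // vm -ltnNge.
    apply: (@runs_le _ _ (x + 0).+1); first by rewrite addn0.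
    apply: runs_seq; apply: runs_frame.
    apply: runs_weaken (step m s' mN Fs vm Im) => // s2 H2 fr.
    apply: runs_iset => /=.
    have v2 : ints s2 v 0 0 = m by rewrite (agree_off_ints fr vc).
    rewrite v2 addn1; split=> //; last by rewrite /= update_same.
    apply: (agree_off_trans (agree_off_trans Fs _)); last first.
      exact: (agree_off_sub sub1 _ (agree_off_iset s2 v 0 0 m.+1)).
    exact: (agree_off_sub sub2 _ fr).
  by move=> s' [Fs vN _]; rewrite /= He // vN leqnn.
apply: (@runs_le _ _ (0 + (x.+1 + 1 + 2)).+1); first by lia.
apply: runs_seq; apply: runs_iset => /=.
by apply: runs_weaken run_loop => // s' [Fs _ /Hq]; apply.
Qed.

End Rules.
End ProgramLogic.

Ltac mem_sub :=
  by let a := fresh in move=> a; rewrite !inE; repeat (case: (a == _) => //=).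

Ltac frame_sub H := apply: agree_off_sub H; mem_sub.
Ltac frame_trans H1 H2 := apply: agree_off_trans H1 _; frame_sub H2.
Ltac frame_both H1 H2 :=
  apply: agree_off_trans (agree_off_sub _ _ H1) (agree_off_sub _ _ H2); mem_sub.

Notation ints_kept a H := (agree_off_ints (a := a) H isT) (only parsing).
Notation reals_kept a H := (agree_off_reals (a := a) H isT) (only parsing).

(** * Exhaustive search over arrays of digits *)

Section Odometer.
Local Open Scope nat_scope.

(** A guess is the base [N] numeral of the number [m] of rounds already made, laid out row by row,
    so that enumerating arrays amounts to counting. *)
Definition digit (N C m r c : nat) : nat := (m %/ N ^ (r * C + c)) %% N.

Lemma digitS N C m r c : 0 < N ->
  digit N C m.+1 r c = ((N ^ (r * C + c) %| m.+1) + m %/ N ^ (r * C + c)) %% N.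
Proof. by move=> N0; rewrite /digit divnS ?expn_gt0 ?N0. Qed.

(** When [m] is incremented, the carry entering place [p] is 1 exactly when [N ^ p] divides [m.+1].
    This closed form replaces a recursive description of the carries. *)
Lemma dvdn_carry N p m : 1 < N ->
  (N ^ p.+1 %| m.+1) = (N <= (m %/ N ^ p) %% N + (N ^ p %| m.+1)).
Proof.
move=> N1; have Np : 0 < N ^ p by rewrite expn_gt0 (ltn_trans _ N1).
have [dv|ndv] := boolP (N ^ p %| m.+1); last first.
  rewrite addn0 leqNgt ltn_pmod ?(ltn_trans _ N1)//=.
  by apply: contraNF ndv => /(dvdn_trans _); apply; rewrite expnS dvdn_mull.
have /dvdnP [y Hy] := dv.
have y0 : 0 < y by case: y Hy.
have -> : m %/ N ^ p = y.-1.
  have := divnS m Np; rewrite dv Hy mulnK // => ->; by rewrite add1n.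
rewrite Hy expnS dvdn_pmul2r //.
case: y y0 {Hy} => // y _ /=; rewrite addn1.
have [E|E] := leqP N (y %% N).+1.
  have /eqP E2 : (y %% N).+1 == N by rewrite eqn_leq E ltn_pmod // (ltn_trans _ N1).
  by rewrite /dvdn -addn1 -modnDml addn1 E2 modnn.
by rewrite /dvdn -addn1 -modnDml addn1 modn_small.
Qed.

Lemma digit_carry N C m r c : 1 < N ->
  let a := digit N C m r c + (N ^ (r * C + c) %| m.+1) in
  digit N C m.+1 r c = if N <= a then 0 else a.
Proof.
move=> N1 /=; have N0 : 0 < N by rewrite (ltn_trans _ N1).
rewrite digitS // /digit -modnDmr; set x := m %/ _ %% N; set b := _ %| _.
have xN : x < N by rewrite ltn_pmod.
rewrite addnC; case: leqP => H; last by rewrite modn_small.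
suff -> : x + b = N by rewrite modnn.
by apply/eqP; rewrite eqn_leq H andbT; case: b H => /=; lia.
Qed.

Lemma exists_digits (N R C : nat) (f : nat -> nat -> nat) : 0 < N ->
  (forall r c, f r c < N) ->
  exists2 m, m < N ^ (R * C) & forall r c, r < R -> c < C -> digit N C m r c = f r c.
Proof.
move=> N0 fN.
have E : forall L, exists2 m, m < N ^ L &
    forall p, p < L -> (m %/ N ^ p) %% N = f (p %/ C) (p %% C).
  elim=> [|L [m mL Hm]]; first by exists 0.
  exists (f (L %/ C) (L %% C) * N ^ L + m) => [|p].
    rewrite expnS; have := fN (L %/ C) (L %% C).
    set a := f _ _ => aN; apply: (@leq_trans (a.+1 * N ^ L)).
      by rewrite mulSn addnC ltn_add2r.
    by rewrite leq_mul2r aN orbT.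
  have NL : forall q, 0 < N ^ q by move=> q; rewrite expn_gt0 N0.
  rewrite ltnS leq_eqVlt => /orP [/eqP ->|pL].
    by rewrite divnMDl // (divn_small mL) addn0 modn_small.
  have -> : N ^ L = N ^ (L - p.+1) * N * N ^ p.
    by rewrite -mulnA -expnS -expnD subnK.
  by rewrite -(Hm p pL) mulnA divnMDl // mulnA modnMDl.
have [m mL Hm] := E (R * C); exists m => // r c rR cC.
have C0 : 0 < C by apply: leq_ltn_trans cC.
rewrite /digit Hm ?divnMDl ?(divn_small cC) ?addn0 ?modnMDl ?modn_small //.
apply: (@leq_trans (r.+1 * C)); first by rewrite mulSn addnC ltn_add2r.
by rewrite leq_mul2r rR orbT.
Qed.

Lemma pair_ltn C r c r' c' : c < C -> c' < C ->
  (r' * C + c' < (r * C + c).+1) =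
  ((r' == r) && (c' == c)) || (r' * C + c' < r * C + c).
Proof.
move=> cC c'C; rewrite ltnS leq_eqVlt; congr orb.
have C0 : 0 < C by apply: leq_ltn_trans cC.
apply/eqP/andP => [E|[/eqP -> /eqP -> //]].
have := congr1 (divn^~ C) E; rewrite /= !divnMDl // !divn_small // !addn0 => ->.
have := congr1 (modn^~ C) E; rewrite /= !modnMDl !modn_small // => ->.
by rewrite !eqxx.
Qed.

(* The array g is an odometer in base Ne, its digit (0, 0) being the least
   significant; a carry left in cr after the last digit ends the search. *)
Definition advance (g cr vr vc : nat) (Re Ce Ne : iexp) : cmd :=
  Seq (ISetV cr (IConst 1))
    (For vr Re (For vc Ce
       (Seq (ISet g (IVar vr) (IVar vc) (IAdd (IGet g (IVar vr) (IVar vc)) (IVar cr)))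
            (If (ILe Ne (IGet g (IVar vr) (IVar vc)))
                (ISet g (IVar vr) (IVar vc) (IConst 0))
                (ISetV cr (IConst 0)))))).

Definition Search (g cr vr vc : nat) (Re Ce Ne : iexp) (body : cmd) : cmd :=
  Seq (For vr Re (For vc Ce (ISet g (IVar vr) (IVar vc) (IConst 0))))
    (Seq (ISetV cr (IConst 0))
       (While (ILe (IVar cr) (IConst 0)) (Seq body (advance g cr vr vc Re Ce Ne)))).

Section Rules.
Variables (R : realType) (w : nat -> R) (B : nat).
Hypothesis B2 : 2 <= B.
Implicit Types (s : state R) (Q : state R -> Prop).
Local Notation runs := (runs w B).

Variables (g cr vr vc : nat) (Re Ce Ne : iexp) (N C RR : nat).
Hypotheses (N2 : 2 <= N) (CB : C <= B) (RB : RR <= B) (NB : N <= B).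
Hypothesis (uq : uniq [:: g; cr; vr; vc]).

Let neqs : [/\ g != cr, g != vr & g != vc] /\ [/\ cr != vr, cr != vc & vr != vc].
Proof.
by move: uq; rewrite /= !inE !negb_or => /andP[/and3P[-> -> ->] /andP[/andP[-> ->] /andP[-> _]]].
Qed.

Lemma runs_zero_digits s Q :
  (forall s', agree_off [:: g; cr; vr; vc] [::] s s' ->
     ieval s' Re = RR /\ ieval s' Ce = C) ->
  (forall s', agree_off [:: g; cr; vr; vc] [::] s s' ->
     (forall r c, r < RR -> c < C -> ints s' g r c = 0) -> Q s') ->
  runs (For vr Re (For vc Ce (ISet g (IVar vr) (IVar vc) (IConst 0)))) s 10 Q.
Proof.
have [[n1 n2 n3] [n4 n5 n6]] := neqs.
move=> He HQ.
apply: (runs_for B2 (N := RR) (x := 5)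
  (I := fun r s' => forall r' c, r' < r -> c < C -> ints s' g r' c = 0)) => //.
- by rewrite !inE; apply/norP; split=> //; apply/norP; rewrite eq_sym.
- by move=> s' fr; apply: (proj1 (He _ _)); frame_sub fr.
- move=> r s' rR fr vrr Ir.
  apply: (runs_for B2 (N := C) (x := 0)
   (I := fun c s' => [/\ ints s' vr 0 0 = r & forall r' c', (r' < r) && (c' < C) || (r' == r) && (c' < c) ->
      ints s' g r' c' = 0])) => //.
  + by rewrite !inE eq_sym.
  + move=> s2 fr2; apply: (proj2 (He _ _)); frame_both fr fr2.
  + split; first by rewrite /= update_other // eq_sym.
    move=> r' c'; rewrite andbF orbF => /andP[rr cc] /=.
    by rewrite update_other ?Ir.
  + move=> c s2 cC fr2 vcc [vr2 Ic]; apply: runs_iset => /=.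
    rewrite vr2 vcc; split; first by rewrite !update_other // eq_sym.
    move=> r' c' H; rewrite update_other // /update eqxx /=.
    case: ifP => // ne; apply: Ic.
    by move: H ne; lia.
  + move=> s2 fr2 [vr2 Ic] r' c' rr cc /=; rewrite update_other //; apply: Ic.
    by move: rr cc; lia.
- move=> s' fr; apply: HQ; frame_sub fr.
Qed.

Lemma runs_advance m s Q :
  (forall s', agree_off [:: g; cr; vr; vc] [::] s s' ->
     [/\ ieval s' Re = RR, ieval s' Ce = C & ieval s' Ne = N]) ->
  (forall r c, r < RR -> c < C -> ints s g r c = digit N C m r c) ->
  (forall s', agree_off [:: g; cr; vr; vc] [::] s s' ->
     (forall r c, r < RR -> c < C -> ints s' g r c = digit N C m.+1 r c) ->
     ints s' cr 0 0 = (N ^ (RR * C) %| m.+1) -> Q s') ->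
  runs (advance g cr vr vc Re Ce Ne) s 20 Q.
Proof.
have [[n1 n2 n3] [n4 n5 n6]] := neqs.
move=> He Hs HQ.
apply: (@runs_le _ _ _ B2 _ _ (0 + 14).+1) => //.
apply: (runs_seq B2); apply: runs_iset => /=.
set s0 := iset s cr 0 0 1.
have fr0 : agree_off [:: g; cr; vr; vc] [::] s s0.
  by apply: agree_off_sub (agree_off_iset _ _ _ _ _) => //; mem_sub.
(* State after the [p] lowest places have been treated; [cr] holds the carry into place [p]. *)
pose J p s' := ints s' cr 0 0 = (N ^ p %| m.+1) /\
  forall r c, r < RR -> c < C -> ints s' g r c =
    digit N C (if r * C + c < p then m.+1 else m) r c.
have Jstab p v s' x : v != g -> v != cr -> J p s' -> J p (iset s' v 0 0 x).
  move=> vg vcr [J1 J2]; split; first by rewrite /= update_other // eq_sym.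
  by move=> r c rR cC; rewrite /= update_other ?J2 // eq_sym.
apply: (@runs_le _ _ _ B2 _ _ (8 + 5)) => //.
apply: (runs_for B2 (N := RR) (I := fun r s' => J (r * C) s')) => //.
- by rewrite !inE; lia.
- move=> s' fr; have [] := He s' => //; apply: agree_off_trans fr0 (agree_off_sub _ _ fr); mem_sub.
- apply: (Jstab); rewrite 1?eq_sym //; split; first by rewrite /= update_same expn0 dvd1n.
  by move=> r c rR cC; rewrite /= update_other //= Hs.
- move=> r s' rR fr vrr Jr.
  apply: (@runs_le _ _ _ B2 _ _ (2 + 5)) => //.
  apply: (runs_for B2 (N := C)
     (I := fun c s' => ints s' vr 0 0 = r /\ J (r * C + c) s')) => //.
  + by rewrite !inE; lia.
  + move=> s2 fr2; have [] := He s2 => //.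
    apply: agree_off_trans fr0 (agree_off_trans (agree_off_sub _ _ fr) (agree_off_sub _ _ fr2)); mem_sub.
  + split; first by rewrite /= update_other // eq_sym.
    by rewrite addn0; apply: Jstab; rewrite // eq_sym.
  + move=> c s2 cC fr2 vcc [vr2 [J1 J2]].
    apply: (@runs_le _ _ _ B2 _ _ (0 + 1).+1) => //.
    apply: (runs_seq B2); apply: runs_iset; rewrite /= vr2 vcc J1 J2 // ltnn.
    set a := digit N C m r c + _; set s3 := iset _ _ _ _ _.
    have vr3 : ints s3 vr 0 0 = r by rewrite /= update_other // eq_sym.
    have vc3 : ints s3 vc 0 0 = c by rewrite /= update_other // eq_sym.
    have cr3 : ints s3 cr 0 0 = (N ^ (r * C + c) %| m.+1) by rewrite /= update_other // eq_sym.
    have g3 r' c' : ints s3 g r' c' = if (r' == r) && (c' == c) then a else ints s2 g r' c'.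
      by rewrite /= /update eqxx.
    have Ne3 : ieval s3 Ne = N.
      have [//|//] := He s3.
      apply: agree_off_trans fr0 (agree_off_trans (agree_off_sub _ _ fr)
        (agree_off_trans (agree_off_sub _ _ fr2)
          (agree_off_sub _ _ (agree_off_iset s2 g r c a)))); mem_sub.
    clearbody s3.
    have carry1 : N <= a -> (N ^ (r * C + c) %| m.+1).
      have xN : digit N C m r c < N by rewrite ltn_pmod // (ltn_trans _ N2).
      by rewrite /a; case: (_ %| _) => //; rewrite addn0 leqNgt xN.
    have dg := digit_carry C m r c N2.
    have dc := dvdn_carry (r * C + c) m N2.
    apply: (runs_if B2); rewrite /= Ne3 vr3 vc3 g3 !eqxx /= => Na; apply: runs_iset; rewrite /= ?vr3 ?vc3.
      split; first by rewrite /= !update_other // eq_sym.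
      apply: Jstab; rewrite 1?eq_sym //; split.
        by rewrite /= update_other 1?eq_sym // cr3 addnS dc Na carry1.
      move=> r' c' r'R c'C; rewrite addnS pair_ltn //= /update eqxx /=.
      case: (boolP ((r' == r) && (c' == c))) => [/andP[/eqP -> /eqP ->]|ne] /=.
        by rewrite dg -/a Na.
      by rewrite g3 (negbTE ne) J2.
    split; first by rewrite /= !update_other // eq_sym.
    apply: Jstab; rewrite 1?eq_sym //; split.
      by rewrite /= update_same addnS dc; move: Na; rewrite /a /digit; case: (N <= _).
    move=> r' c' r'R c'C; rewrite addnS pair_ltn //= update_other // g3.
    case: (boolP ((r' == r) && (c' == c))) => [/andP[/eqP -> /eqP ->]|ne] /=.
      by rewrite dg -/a (negbTE Na).
    by rewrite J2.
  + move=> s2 fr2 [vr2 Jc]; apply: Jstab; rewrite 1?eq_sym //.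
    by rewrite mulSn addnC.
- move=> s' fr [J1 J2]; apply: HQ => //.
    apply: agree_off_trans fr0 (agree_off_sub _ _ fr); mem_sub.
  move=> r c rR cC; rewrite J2 //.
  suff -> : r * C + c < RR * C by [].
  apply: (@leq_trans (r.+1 * C)); first by rewrite mulSn addnC ltn_add2r.
  by rewrite leq_mul2r rR orbT.
Qed.

(** [I m] describes the state after [m] rounds. It has to be stable under changes of the search
    arrays, which [advance] modifies between rounds. The summand [RR * C] is the logarithm of the
    number of rounds. *)
Lemma runs_search (x : nat) (I : nat -> state R -> Prop) body s Q :
  ~~ has [in written_ints body] [:: g; cr] ->
  (forall s', agree_off [:: g, cr, vr, vc & written_ints body] (written_reals body) s s' ->
     [/\ ieval s' Re = RR, ieval s' Ce = C & ieval s' Ne = N]) ->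
  (forall m s1 s2, agree_off [:: g; cr; vr; vc] [::] s1 s2 -> I m s1 -> I m s2) ->
  I 0 s ->
  (forall m s', m < N ^ (RR * C) ->
     agree_off [:: g, cr, vr, vc & written_ints body] (written_reals body) s s' ->
     (forall r c, r < RR -> c < C -> ints s' g r c = digit N C m r c) ->
     I m s' -> runs body s' x (I m.+1)) ->
  (forall s', agree_off [:: g, cr, vr, vc & written_ints body] (written_reals body) s s' ->
     I (N ^ (RR * C)) s' -> Q s') ->
  runs (Search g cr vr vc Re Ce Ne body) s (x + RR * C + 40) Q.
Proof.
have [[n1 n2 n3] [n4 n5 n6]] := neqs.
move=> /norP[/= gb /norP[crb _]] He stab I0 step HQ.
set F := agree_off _ _ s in He step HQ.
have subF li lr s1 s2 : {subset li <= [:: g, cr, vr, vc & written_ints body]} ->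
   {subset lr <= written_reals body} -> F s1 -> agree_off li lr s1 s2 -> F s2.
  by move=> si sr F1 fr; apply: agree_off_trans F1 (agree_off_sub si sr fr).
have sub4 : {subset [:: g; cr; vr; vc] <= [:: g, cr, vr, vc & written_ints body]}.
  by move=> a; rewrite !inE => /or4P[] ->; rewrite ?orbT.
have subB : {subset written_ints body <= [:: g, cr, vr, vc & written_ints body]}.
  by move=> a; rewrite !inE => ->; rewrite !orbT.
have sub0 : {subset [::] <= written_reals body} by [].
have F0 : F s by [].
apply: (@runs_le _ _ _ B2 _ _ (10 + (0 + ((x + 20).+1 + RR * C + 2)).+1).+1); first by lia.
apply: (runs_seq B2); apply: runs_zero_digits.
  by move=> s' /(subF _ _ _ _ sub4 sub0 F0) /He [].
move=> s1 fr1 z1; have F1 := subF _ _ _ _ sub4 sub0 F0 fr1.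
apply: (runs_seq B2); apply: runs_iset => /=.
set s2 := iset s1 cr 0 0 0.
have fr2 : agree_off [:: g; cr; vr; vc] [::] s1 s2.
  by apply: agree_off_sub (agree_off_iset _ _ _ _ _) => //; mem_sub.
have F2 := subF _ _ _ _ sub4 sub0 F1 fr2.
pose J m s' := [/\ F s', I m s', ints s' cr 0 0 = (N ^ (RR * C) <= m) &
  forall r c, r < RR -> c < C -> ints s' g r c = digit N C m r c].
have Npos p : 0 < N ^ p by rewrite expn_gt0 (ltn_trans _ N2).
have J0 : J 0 s2.
  split=> //.
  - exact: (stab _ _ _ fr2 (stab _ _ _ fr1 I0)).
  - by rewrite /= update_same leqNgt Npos.
  - by move=> r c rR cC; rewrite /= update_other // z1 // /digit div0n mod0n.
have NBL : N ^ (RR * C) <= B ^ (RR * C).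
  by have [->//|p0] := posnP (RR * C); rewrite leq_exp2r.
apply: (@runs_weaken _ _ _ B2 _ _ ((x + 20).+1 + RR * C + 2) _ (J (N ^ (RR * C)))) => //.
  by move=> s' [Fs Is _ _]; apply: HQ.
apply: (runs_while B2 (x := (x + 20).+1) (L := RR * C)) J0 => //; last by move=> s' [_ _ E _]; rewrite /= E leqnn.
move=> m s' mN [Fs Im cm dm]; split; first by move: mN; rewrite /= cm ltnNge => /negbTE ->.
apply: (runs_seq B2); apply: (runs_frame).
apply: (runs_weaken B2 _ _ (step m s' mN Fs dm Im)) => // s3 I3 fr3.
have F3 := subF _ _ _ _ subB (fun _ => id) Fs fr3.
apply: (runs_advance (m := m)).
- by move=> s4 /(subF _ _ _ _ sub4 sub0 F3) /He.
- by move=> r c rR cC; rewrite (agree_off_ints fr3 gb) dm.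
move=> s4 fr4 d4 c4; split=> //.
- exact: subF sub4 sub0 F3 fr4.
- exact: stab fr4 I3.
(* As [m.+1] is at most [N ^ (RR * C)], divisibility means equality: the carry out of the last place
   marks the end. *)
rewrite c4; congr nat_of_bool; apply/idP/idP => [/dvdn_leq|]; first exact.
by move=> H; have -> : m.+1 = N ^ (RR * C) by apply/eqP; rewrite eqn_leq mN.
Qed.

End Rules.
End Odometer.

(** * The algorithm *)

(* Scalars are stored at index (0, 0) of an array.
   Integer arrays: 3, the number t of sampled columns; 4, the number of values of
   a guessed number; 5, the guess, whose rows are the pivot rows, the pivot columns,
   the sampled columns, their weights, then Z (k rows) and X (k rows) on the sampled
   columns; 18, whether a candidate has been kept.
   Real arrays: 1 and 2, the best U and V; 3, the augmented matrix (M | H); 5 and 6,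
   the current U and V; 15, the scale mu; 16 and 21, the resolution and the shift
   of the grid; 18 and 19, the current and the best cost. *)
Section Programs.
Local Open Scope nat_scope.

Definition add_abs (dst src : nat) (wt : rexp) : cmd :=
  If (RLe (ROfInt (IConst 0)) (RVar src))
     (RSetV dst (RAdd (RVar dst) (RMul wt (RVar src))))
     (RSetV dst (RSub (RVar dst) (RMul wt (RVar src)))).

Definition grid_exp (g : iexp) : rexp := RSub (RDiv (ROfInt g) (RVar 16)) (RVar 21).

Definition n_exp : iexp := IGet 0 (IConst 0) (IConst 0).
Definition d_exp : iexp := IGet 0 (IConst 0) (IConst 1).
Definition k_exp : iexp := IGet 0 (IConst 0) (IConst 2).
Definition kk_exp : iexp := IAdd k_exp k_exp.

(* Least absolute deviations on a grid: minimises
   sum_(i < m) wt i * |sum_(l < q) P i l * z l - b i| over grid vectors z by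
   exhaustive search; P, b, wt are real arrays 7, 8, 9 and the minimiser is left
   in real array 11. *)
Definition lad_body : cmd :=
  Seq (For 15 (IVar 13)
         (RSet 10 (IConst 0) (IVar 15) (grid_exp (IGet 9 (IConst 0) (IVar 15)))))
  (Seq (RSetV 12 (ROfInt (IConst 0)))
  (Seq (For 16 (IVar 14)
     (Seq (RSetV 14 (RSub (ROfInt (IConst 0)) (RGet 8 (IConst 0) (IVar 16))))
     (Seq (For 15 (IVar 13)
             (RSetV 14 (RAdd (RVar 14) (RMul (RGet 7 (IVar 16) (IVar 15))
                                             (RGet 10 (IConst 0) (IVar 15))))))
          (add_abs 12 14 (RGet 9 (IConst 0) (IVar 16))))))
  (If (BAnd (ILe (IConst 1) (IVar 17)) (RLe (RVar 13) (RVar 12))) Skip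
     (Seq (ISetV 17 (IConst 1))
     (Seq (RSetV 13 (RVar 12))
          (For 15 (IVar 13)
             (RSet 11 (IConst 0) (IVar 15) (RGet 10 (IConst 0) (IVar 15))))))))).

Definition lad : cmd :=
  Seq (ISetV 17 (IConst 0)) (Search 9 10 11 12 (IConst 1) (IVar 13) (IVar 4) lad_body).

Definition lad_cost {R : realType} (P : nat -> nat -> R) (b wt : nat -> R) (q m : nat)
    (z : nat -> R) : R :=
  (\sum_(i < m) wt i * `| \sum_(l < q) P i l * z l - b i |)%R.

Definition grid {R : realType} (nu sh : R) (c : nat) : R := (c%:R / nu - sh)%R.

Section Specs.
Variables (R : realType) (w : nat -> R) (B : nat).
Hypothesis B2 : 2 <= B.
Implicit Types (s : state R) (Q : state R -> Prop).
Local Notation runs := (runs w B).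

(** The content of the array after [l] rounds is prescribed as [T l], which also covers loops that
    read the array they write. *)
Lemma runs_for_fill (N : nat) (T : nat -> nat -> nat -> R) v e a ie je ex s Q :
  N <= B ->
  (forall s', agree_off [:: v] [:: a] s s' -> ieval s' e = N) ->
  (forall i j, reals s a i j = T 0 i j) ->
  (forall l s', l < N -> agree_off [:: v] [:: a] s s' -> ints s' v 0 0 = l ->
     (forall i j, reals s' a i j = T l i j) ->
     forall i j, T l.+1 i j =
       if (i == ieval s' ie) && (j == ieval s' je) then reval s' ex else T l i j) ->
  (forall s', agree_off [:: v] [:: a] s s' ->
     (forall i j, reals s' a i j = T N i j) -> Q s') ->
  runs (For v e (RSet a ie je ex)) s 5 Q.
Proof.
move=> NB He T0 TS HQ.
apply: (runs_for B2 (N := N) (x := 0)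
  (I := fun l s' => forall i j, reals s' a i j = T l i j)) => //.
move=> l s' lN fr vl Tl; apply: runs_rset => i j /=.
by rewrite (TS _ s' lN fr vl Tl) /update eqxx /=; case: ifP => // _; rewrite Tl.
Qed.

Lemma runs_for_fill2 (n m : nat) (val : nat -> nat -> R) vi vj ei ej a ex s Q :
  n <= B -> m <= B -> vi != vj ->
  (forall s', agree_off [:: vi; vj] [:: a] s s' -> ieval s' ei = n /\ ieval s' ej = m) ->
  (forall i j s', i < n -> j < m -> agree_off [:: vi; vj] [:: a] s s' ->
     ints s' vi 0 0 = i -> ints s' vj 0 0 = j -> reals s' a i j = reals s a i j ->
     reval s' ex = val i j) ->
  (forall s', agree_off [:: vi; vj] [:: a] s s' ->
     (forall i j, reals s' a i j = if (i < n) && (j < m) then val i j else reals s a i j) ->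
     Q s') ->
  runs (For vi ei (For vj ej (RSet a (IVar vi) (IVar vj) ex))) s 10 Q.
Proof.
move=> nB mB vij He Hval HQ.
apply: (runs_for B2 (N := n) (x := 5)
  (I := fun r s' => forall i j, reals s' a i j =
     if (i < r) && (j < m) then val i j else reals s a i j)) => //.
- by rewrite !inE; lia.
- by move=> s' fr; apply: (proj1 (He _ _)); frame_sub fr.
- move=> r s' rn fr vr Ir.
  apply: (runs_for_fill (N := m)
   (T := fun c i j => if (i < r) && (j < m) || (i == r) && (j < c) then val i j
                      else reals s a i j)) => //.
  + move=> s2 fr2; apply: (proj2 (He _ _)).
    frame_both fr fr2.
  + by move=> i j; rewrite Ir andbF orbF.
  + move=> c s2 cm fr2 vc Tc i j.
    have fr3 : agree_off [:: vi; vj] [:: a] s s2.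
      frame_both fr fr2.
    have vr2 : ints s2 vi 0 0 = r by rewrite (agree_off_ints fr2) // inE.
    have own : reals s2 a r c = reals s a r c.
      by rewrite Tc; case: ifP => //; rewrite !ltnn andbF.
    rewrite /= vr2 vc (Hval r c s2) // ltnS (leq_eqVlt j c).
    have [->|ir] := eqVneq i r; have [->|jc] := eqVneq j c; rewrite ?ltnn ?eqxx ?orbT ?orbF //=.
  + move=> s2 fr2 Tm i j /=; rewrite Tm ltnS (leq_eqVlt i r).
    by case: eqP => _ //=; case: (i < r); case: (j < m).
- by move=> s' fr; apply: HQ; frame_sub fr.
Qed.

Lemma runs_for_sum (N : nat) (val : nat -> R) v e a ex s Q :
  N <= B ->
  (forall s', agree_off [:: v] [:: a] s s' -> ieval s' e = N) ->
  (forall l s', l < N -> agree_off [:: v] [:: a] s s' -> ints s' v 0 0 = l ->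
     reval s' ex = val l) ->
  (forall s', agree_off [:: v] [:: a] s s' ->
     reals s' a 0 0 = (reals s a 0 0 + \sum_(l < N) val l)%R -> Q s') ->
  runs (For v e (RSetV a (RAdd (RVar a) ex))) s 5 Q.
Proof.
move=> NB He Hval HQ.
apply: (runs_for B2 (N := N) (x := 0)
  (I := fun l s' => reals s' a 0 0 = (reals s a 0 0 + \sum_(i < l) val i)%R)) => //.
  by rewrite big_ord0 addr0.
move=> l s' lN fr vl Il; apply: runs_rset.
by rewrite /= update_same (Hval l) // Il big_ord_recr /= addrA.
Qed.

Lemma runs_add_abs dst src wt s Q :
  (forall s', agree_off [::] [:: dst] s s' ->
     reals s' dst 0 0 = (reals s dst 0 0 + reval s wt * `|reals s src 0 0|)%R -> Q s') ->
  runs (add_abs dst src wt) s 1 Q.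
Proof.
move=> HQ.
have fr v : agree_off [::] [:: dst] s (rset s dst 0 0 v).
  by split=> // b; rewrite inE => ba; rewrite /= update_other.
apply: (runs_if B2) => /= H; apply: runs_rset; apply: HQ => //=; rewrite update_same.
  by rewrite ger0_norm.
by rewrite ler0_norm ?mulrN // ltW // ltNge.
Qed.

Lemma lad_cost_ext (P P' : nat -> nat -> R) (b b' wt wt' : nat -> R) q m z z' :
  (forall i l, i < m -> l < q -> P i l = P' i l) ->
  (forall i, i < m -> b i = b' i) -> (forall i, i < m -> wt i = wt' i) ->
  (forall l, l < q -> z l = z' l) ->
  lad_cost P b wt q m z = lad_cost P' b' wt' q m z'.
Proof.
move=> HP Hb Hw Hz; apply: eq_bigr => i _; rewrite Hw // Hb //.
by congr (_ * `| _ - _ |)%R; apply: eq_bigr => l _; rewrite HP // Hz.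
Qed.

Lemma runs_lad_candidate (q m : nat) s Q :
  q <= B -> m <= B -> ints s 13 0 0 = q -> ints s 14 0 0 = m ->
  (forall s', agree_off [:: 15; 16] [:: 10; 12; 14] s s' ->
     (forall l, l < q -> reals s' 10 0 l =
         grid (reals s 16 0 0) (reals s 21 0 0) (ints s 9 0 l)) ->
     reals s' 12 0 0 = lad_cost (reals s 7) (reals s 8 0) (reals s 9 0) q m
        (fun l => grid (reals s 16 0 0) (reals s 21 0 0) (ints s 9 0 l)) ->
     runs (If (BAnd (ILe (IConst 1) (IVar 17)) (RLe (RVar 13) (RVar 12))) Skip
     (Seq (ISetV 17 (IConst 1))
     (Seq (RSetV 13 (RVar 12))
          (For 15 (IVar 13)
             (RSet 11 (IConst 0) (IVar 15) (RGet 10 (IConst 0) (IVar 15))))))) s' 10 Q) ->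
  runs lad_body s 40 Q.
Proof.
move=> qB mB Hq Hm HQ.
set gr := fun l => grid (reals s 16 0 0) (reals s 21 0 0) (ints s 9 0 l) in HQ *.
apply: (@runs_le _ _ _ B2 _ _ (5 + (0 + (14 + 10).+1).+1).+1) => //.
apply: (runs_seq B2).
apply: (runs_for_fill (N := q)
  (T := fun c i j => if (i == 0) && (j < c) then gr j else reals s 10 i j)) => //.
- by move=> s' fr; rewrite /= (ints_kept 13 fr).
- by move=> i j; rewrite andbF.
- move=> l s' lq fr vl _ i j.
  rewrite /= vl (reals_kept 16 fr) (reals_kept 21 fr).
  rewrite (ints_kept 9 fr) ltnS leq_eqVlt.
  by case: (i == 0); have [->|j0] := eqVneq j l; rewrite ?ltnn //=.
move=> s1 fr1 T1.
apply: (runs_seq B2); apply: runs_rset => /=.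
set s2 := rset s1 12 0 0 _.
have fr2 : agree_off [:: 15] [:: 10; 12] s s2.
  apply: (agree_off_trans (agree_off_sub _ _ fr1) (s2 := s1)); [mem_sub|mem_sub|].
  by split=> // a; rewrite !inE => /norP[_ a12]; rewrite /= update_other.
have T2 : forall l, l < q -> reals s2 10 0 l = gr l.
  by move=> l lq; rewrite /= update_other // T1 /= lq.
have c2 : reals s2 12 0 0 = 0%R by rewrite /= update_same.
clearbody s2.
apply: (runs_seq B2).
pose term i := (reals s 9 0 i * `| \sum_(l < q) reals s 7 i l * gr l - reals s 8 0 i |)%R.
apply: (runs_for B2 (N := m) (x := 9)
  (I := fun i s' => reals s' 12 0 0 = (\sum_(i' < i) term i')%R)) => //.
- move=> s' fr; rewrite /= (ints_kept 14 fr).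
  by rewrite (ints_kept 14 fr2).
- by rewrite big_ord0.
- move=> i s' im fr vi Ii.
  apply: (@runs_le _ _ _ B2 _ _ (0 + (5 + 1).+1).+1) => //.
  apply: (runs_seq B2); apply: runs_rset => /=.
  set s3 := rset s' 14 0 0 _.
  have fr3 : agree_off [::] [:: 14] s' s3.
    by split=> // a; rewrite !inE => a12; rewrite /= update_other.
  have a3 : reals s3 14 0 0 = (0 - reals s' 8 0 i)%R by rewrite /= update_same vi.
  clearbody s3.
  have frs : agree_off [:: 15; 16] [:: 10; 12; 14] s s3.
    apply: (agree_off_trans (s2 := s')); last by frame_sub fr3.
    apply: (agree_off_trans (s2 := s2)); last by frame_sub fr.
    by frame_sub fr2.
  apply: (runs_seq B2).
  apply: (runs_for_sum (N := q) (val := fun l => (reals s 7 i l * gr l)%R)) => //.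
  + move=> s4 fr4; rewrite /= (ints_kept 13 fr4).
    by rewrite (ints_kept 13 frs).
  + move=> l s4 lq fr4 vl; rewrite /= vl.
    rewrite (reals_kept 7 fr4) (reals_kept 7 frs).
    rewrite (reals_kept 10 fr4) (reals_kept 10 fr3).
    rewrite (reals_kept 10 fr) T2 //.
    by rewrite (ints_kept 16 fr4) (ints_kept 16 fr3) vi.
  + move=> s4 fr4 a4; apply: runs_add_abs => s5 fr5 c5 /=.
    rewrite c5 a4 a3 big_ord_recr /= -Ii /term.
    rewrite (reals_kept 12 fr4) (reals_kept 12 fr3).
    rewrite (reals_kept 9 fr4) (reals_kept 9 frs).
    rewrite (ints_kept 16 fr4) (ints_kept 16 fr3) vi.
    rewrite (reals_kept 8 fr) (reals_kept 8 fr2).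
    by rewrite sub0r [(- _ + _)%R]addrC.
- move=> s' fr Im; apply: HQ => //.
  + apply: (agree_off_trans (s2 := s2)); last by frame_sub fr.
    by frame_sub fr2.
  + by move=> l lq; rewrite (reals_kept 10 fr) T2.
Qed.

Lemma runs_lad (q m N : nat) s Q :
  q <= B -> m <= B -> N <= B -> 2 <= N ->
  ints s 13 0 0 = q -> ints s 14 0 0 = m -> ints s 4 0 0 = N ->
  let gr := grid (reals s 16 0 0) (reals s 21 0 0) in
  let cost := lad_cost (reals s 7) (reals s 8 0) (reals s 9 0) q m in
  (forall s', agree_off [:: 9; 10; 11; 12; 15; 16; 17] [:: 10; 11; 12; 13; 14] s s' ->
     (exists f : nat -> nat, [/\ forall l, f l < N,
        forall l, l < q -> reals s' 11 0 l = gr (f l) &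
        forall f', (forall l, f' l < N) -> (cost (gr \o f) <= cost (gr \o f'))%R]) -> Q s') ->
  runs lad s (q + 100) Q.
Proof.
move=> qB mB NB N2 Hq Hm HN gr cost HQ.
apply: (@runs_le _ _ _ B2 _ _ (0 + (40 + 1 * q + 40)).+1); first by lia.
apply: (runs_seq B2); apply: runs_iset => /=.
set s0 := iset s 17 0 0 0.
have fr0 : agree_off [:: 17] [::] s s0 by apply: agree_off_iset.
have fl0 : ints s0 17 0 0 = 0 by rewrite /= update_same.
clearbody s0.
(* There is no infinite initial cost to compare with, so flag 17 tells whether real arrays 11 and 13
   are meaningful. *)
pose I M s' := (M = 0 -> ints s' 17 0 0 = 0) /\ (0 < M -> ints s' 17 0 0 = 1 /\
  exists f : nat -> nat, [/\ forall l, f l < N,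
    forall l, l < q -> reals s' 11 0 l = gr (f l), reals s' 13 0 0 = cost (gr \o f) &
    forall M', M' < M -> (cost (gr \o f) <= cost (gr \o digit N q M' 0))%R]).
apply: (@runs_search _ w B B2 9 10 11 12 (IConst 1) (IVar 13) (IVar 4) N q 1 _ _ _ _ _ 40 I) => //.
- by apply: leq_trans B2.
- move=> s' fr /=; split=> //.
    by rewrite (ints_kept 13 fr) (ints_kept 13 fr0).
  by rewrite (ints_kept 4 fr) (ints_kept 4 fr0).
- move=> M s1 s2 fr; rewrite /I (ints_kept 17 fr).
  by rewrite (reals_kept 11 fr) (reals_kept 13 fr).
- move=> M s1 MN fr dg [I0 I1].
  have N0 : 0 < N by apply: leq_trans N2.
  have EC s' z z' : (forall l, l < q -> z l = z' l) -> reals s' 7 = reals s 7 ->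
     reals s' 8 = reals s 8 -> reals s' 9 = reals s 9 ->
     lad_cost (reals s' 7) (reals s' 8 0) (reals s' 9 0) q m z = cost z'.
    by move=> zz E7 E8 E9; rewrite /cost E7 E8 E9; apply: lad_cost_ext.
  have fr01 : agree_off [:: 9; 10; 11; 12; 15; 16; 17] [:: 10; 11; 12; 13; 14] s s1.
    by frame_both fr0 fr.
  have Egr l : l < q -> grid (reals s1 16 0 0) (reals s1 21 0 0) (ints s1 9 0 l) = gr (digit N q M 0 l).
    move=> lq; rewrite dg // /gr (reals_kept 16 fr01).
    by rewrite (reals_kept 21 fr01).
  apply: (@runs_lad_candidate q m) => //.
  + by rewrite (ints_kept 13 fr01).
  + by rewrite (ints_kept 14 fr01).
  move=> s2 fr2 cand2 cost2.
  have {}cost2 : reals s2 12 0 0 = cost (gr \o digit N q M 0).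
    rewrite cost2; apply: EC => //.
    * by rewrite (reals_kept 7 fr01).
    * by rewrite (reals_kept 8 fr01).
    * by rewrite (reals_kept 9 fr01).
  apply: (@runs_le _ _ _ B2 _ _ (0 + (0 + 5).+1).+1.+1) => //.
  apply: (runs_if B2) => /= Hb.
    apply: (@runs_le _ _ _ B2 _ _ 0) => //; apply: runs_skip.
    case/andP: Hb => fl le_c.
    have M0 : 0 < M.
      case: (posnP M) fl => // /I0 E; by rewrite (ints_kept 17 fr2) E.
    have [E17 [f [fN fbest fcost fmin]]] := I1 M0.
    split=> // _; rewrite (ints_kept 17 fr2); split=> //.
    exists f; split=> //.
    * by move=> l lq; rewrite (reals_kept 11 fr2) fbest.
    * by rewrite (reals_kept 13 fr2).
    * move=> M'; rewrite ltnS leq_eqVlt => /orP[/eqP ->|/fmin //].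
      by rewrite -cost2 -fcost -(reals_kept 13 fr2).
  apply: (runs_seq B2); apply: runs_iset => /=.
  apply: (runs_seq B2); apply: runs_rset => /=.
  set s3 := rset _ _ _ _ _.
  have fr3 : agree_off [:: 17] [:: 13] s2 s3.
    by split=> a; rewrite inE => ba; rewrite /= update_other.
  have e17 : ints s3 17 0 0 = 1 by rewrite /= update_same.
  have e13 : reals s3 13 0 0 = reals s2 12 0 0 by rewrite /= update_same.
  clearbody s3.
  apply: (runs_for_fill (N := q)
    (T := fun c i j => if (i == 0) && (j < c) then gr (digit N q M 0 j) else reals s3 11 i j)) => //.
  + move=> s' fr'; rewrite /= (ints_kept 13 fr').
    rewrite (ints_kept 13 fr3) (ints_kept 13 fr2).
    by rewrite (ints_kept 13 fr01).
  + by move=> i j; rewrite andbF.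
  + move=> l s' lq fr' vl _ i j.
    rewrite /= vl (reals_kept 10 fr') (reals_kept 10 fr3).
    rewrite cand2 // Egr // ltnS leq_eqVlt.
    by case: (i == 0); have [->|j0] := eqVneq j l; rewrite ?ltnn //=.
  move=> s4 fr4 T4; split=> // _; split.
    by rewrite (ints_kept 17 fr4).
  exists (digit N q M 0); split.
  + by move=> l; rewrite /digit ltn_pmod.
  + by move=> l lq; rewrite T4 /= lq.
  + by rewrite (reals_kept 13 fr4) e13 cost2.
  + move=> M'; rewrite ltnS leq_eqVlt => /orP[/eqP -> //|MM].
    have M0 : 0 < M by apply: leq_ltn_trans MM.
    have [E17 [f [fN fbest fcost fmin]]] := I1 M0.
    apply: le_trans (fmin M' MM); rewrite -cost2 -fcost.
    move: Hb; rewrite (ints_kept 17 fr2) E17 /= -ltNge => /ltW.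
    by rewrite (reals_kept 13 fr2).
move=> s' fr [_ I1]; apply: HQ.
  by frame_both fr0 fr.
have [|_ [f [fN fbest _ fmin]]] := I1.
  by rewrite expn_gt0 (leq_trans _ N2).
exists f; split=> // f' f'N.
have [|M MN dM] := @exists_digits N 1 q (fun _ c => f' c) _ (fun _ => f'N).
  exact: leq_trans N2.
apply: le_trans (fmin M MN) _; rewrite le_eqVlt; apply/orP; left; apply/eqP.
by apply: lad_cost_ext => // l lq /=; rewrite dM.
Qed.

End Specs.
End Programs.
Arguments runs_for_fill {R w B} B2 [N T v e a ie je ex s Q].
Arguments runs_for_fill2 {R w B} B2 [n m val vi vj ei ej a ex s Q].
Arguments runs_for_sum {R w B} B2 [N val v e a ex s Q].
Arguments runs_add_abs {R w B} B2 [dst src wt s Q].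
Arguments runs_lad {R w B} B2 [q m N s Q].

(** * The program for one guess and its specification *)

Section MainProgram.
Local Open Scope nat_scope.

Definition pivot_row : iexp := IGet 5 (IConst 0) (IVar 19).
Definition pivot_col : iexp := IGet 5 (IConst 1) (IVar 19).
Definition dk_exp : iexp := IAdd d_exp k_exp.

(** The pivot row is copied to array 4 because the loop over the rows clears it on reaching it; the
    multiplier is stored before its row changes. *)
Definition elim_step : cmd :=
  Seq (For 21 dk_exp (RSet 4 (IConst 0) (IVar 21) (RGet 3 pivot_row (IVar 21))))
  (For 20 n_exp
     (Seq (RSetV 17 (RDiv (RGet 3 (IVar 20) pivot_col) (RGet 4 (IConst 0) pivot_col)))
     (Seq (For 21 dk_exp (RSet 3 (IVar 20) (IVar 21)
             (RSub (RGet 3 (IVar 20) (IVar 21)) (RMul (RVar 17) (RGet 4 (IConst 0) (IVar 21))))))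
          (RSet 3 (IVar 20) (IAdd d_exp (IVar 19)) (RVar 17))))).

Definition elim : cmd :=
  Seq (For 20 n_exp (For 21 dk_exp (RSet 3 (IVar 20) (IVar 21) (RGet 0 (IVar 20) (IVar 21)))))
      (For 19 k_exp elim_step).

(** One Gauss-Jordan step on (M | H). A nonzero pivot gives its own row the multiplier 1, so that
    this row is cleared as well. The multipliers enter column [d + r], and later steps treat that
    column like the others. *)
Definition estep {R : realType} (d r p q : nat) (M : nat -> nat -> R) (i j : nat) : R :=
  if j == d + r then (M i q / M p q)%R else (M i j - M i q / M p q * M p j)%R.

Fixpoint elim_mx {R : realType} (d : nat) (p q : nat -> nat) (A : nat -> nat -> R) (r : nat)
    : nat -> nat -> R :=
  if r is r'.+1 then estep d r' (p r') (q r') (elim_mx d p q A r') else A.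

Definition residual_norm : cmd :=
  Seq (RSetV 15 (ROfInt (IConst 0)))
      (For 20 n_exp (For 21 d_exp
         (Seq (RSetV 20 (RGet 3 (IVar 20) (IVar 21))) (add_abs 15 20 (ROfInt (IConst 1)))))).

Definition guess_exp (off : iexp) : rexp :=
  RMul (RVar 15) (grid_exp (IGet 5 (IAdd off (IVar 22)) (IVar 21))).

(** A row of F is sought in units of [mu]. Both guessed blocks are therefore scaled by [mu]: Z
    because it is guessed in these units, X because it multiplies F / mu. *)
Definition row_phase : cmd :=
  For 20 n_exp
  (Seq (ISetV 13 k_exp) (Seq (ISetV 14 (IVar 3))
  (Seq (For 21 (IVar 3)
     (Seq (RSetV 14 (RGet 3 (IVar 20) (IGet 5 (IConst 2) (IVar 21))))
     (Seq (For 22 k_exp (RSet 7 (IVar 21) (IVar 22) (guess_exp (IAdd (IConst 4) k_exp))))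
     (Seq (For 22 k_exp (RSetV 14 (RAdd (RVar 14) (RSub (ROfInt (IConst 0))
             (RMul (RGet 3 (IVar 20) (IAdd d_exp (IVar 22))) (guess_exp (IConst 4)))))))
     (Seq (RSet 8 (IConst 0) (IVar 21) (RVar 14))
          (RSet 9 (IConst 0) (IVar 21) (ROfInt (IGet 5 (IConst 3) (IVar 21)))))))))
  (Seq lad
  (Seq (For 22 k_exp (RSet 5 (IVar 20) (IVar 22) (RGet 3 (IVar 20) (IAdd d_exp (IVar 22)))))
       (For 22 k_exp (RSet 5 (IVar 20) (IAdd k_exp (IVar 22)) (RGet 11 (IConst 0) (IVar 22))))))))).

(** The fit is against the residual M. Adding the pivot rows of A to the first [k] rows of V
    restores H A_p, so that U V - A is exactly the residual of the fit. *)
Definition col_phase : cmd :=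
  For 21 d_exp
  (Seq (ISetV 13 kk_exp) (Seq (ISetV 14 n_exp)
  (Seq (For 20 n_exp
     (Seq (For 22 kk_exp (RSet 7 (IVar 20) (IVar 22) (RMul (RGet 5 (IVar 20) (IVar 22)) (RVar 15))))
     (Seq (RSet 8 (IConst 0) (IVar 20) (RGet 3 (IVar 20) (IVar 21)))
          (RSet 9 (IConst 0) (IVar 20) (ROfInt (IConst 1))))))
  (Seq lad
  (Seq (For 22 kk_exp (RSet 6 (IVar 22) (IVar 21) (RMul (RVar 15) (RGet 11 (IConst 0) (IVar 22)))))
       (For 22 k_exp (RSet 6 (IVar 22) (IVar 21)
          (RAdd (RGet 6 (IVar 22) (IVar 21))
                (RGet 0 (IGet 5 (IConst 0) (IVar 22)) (IVar 21)))))))))).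

Definition evaluate : cmd :=
  Seq (RSetV 18 (ROfInt (IConst 0)))
      (For 20 n_exp (For 21 d_exp
         (Seq (Seq (RSetV 20 (RSub (ROfInt (IConst 0)) (RGet 0 (IVar 20) (IVar 21))))
                   (For 22 kk_exp (RSetV 20 (RAdd (RVar 20)
                      (RMul (RGet 5 (IVar 20) (IVar 22)) (RGet 6 (IVar 22) (IVar 21)))))))
              (add_abs 18 20 (ROfInt (IConst 1)))))).

Definition keep_best : cmd :=
  If (BAnd (ILe (IConst 1) (IVar 18)) (RLe (RVar 19) (RVar 18))) Skip
     (Seq (ISetV 18 (IConst 1)) (Seq (RSetV 19 (RVar 18))
     (Seq (For 20 n_exp (For 21 kk_exp (RSet 1 (IVar 20) (IVar 21) (RGet 5 (IVar 20) (IVar 21)))))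
          (For 20 kk_exp (For 21 d_exp (RSet 2 (IVar 20) (IVar 21) (RGet 6 (IVar 20) (IVar 21)))))))).

Definition candidate : cmd :=
  Seq elim (Seq residual_norm (Seq row_phase (Seq col_phase (Seq evaluate keep_best)))).

(** Naturals cannot be multiplied at unit cost, so a product is computed as a real and recovered as
    a natural by counting up to it. *)
Definition ceil_to (a r : nat) : cmd :=
  Seq (ISetV a (IConst 0))
      (While (BNot (RLe (RVar r) (ROfInt (IVar a)))) (ISetV a (IAdd (IVar a) (IConst 1)))).

Definition rn : rexp := ROfInt n_exp.
Definition rd : rexp := ROfInt d_exp.
Definition rk : rexp := ROfInt k_exp.

(** The loop counts the doublings of 1 up to [k + 1], which yields [bit_size k]; the sample size,
    the resolution, the shift [4 k] and the number of digit values are derived from it. *)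
Definition prelude (C0 : nat) : cmd :=
  Seq (ISetV 1 (IConst 1)) (Seq (ISetV 2 (IConst 0))
  (Seq (While (ILe (IVar 1) (IAdd k_exp (IConst 1)))
         (Seq (ISetV 1 (IAdd (IVar 1) (IVar 1))) (ISetV 2 (IAdd (IVar 2) (IConst 1)))))
  (Seq (RSetV 20 (RMul (ROfInt (IConst C0)) (RMul (ROfInt (IAdd k_exp (IConst 1))) (ROfInt (IVar 2)))))
  (Seq (ceil_to 3 20)
  (Seq (RSetV 20 (RMul rn (RMul rd rk)))
  (Seq (RSetV 16 (RMul (RMul (ROfInt (IConst 100))
          (RMul (RMul (RVar 20) (RVar 20)) (RMul (RVar 20) (RVar 20)))) (ROfInt (IVar 3))))
  (Seq (RSetV 21 (RMul (ROfInt (IConst 4)) rk))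
  (Seq (RSetV 20 (RAdd (ROfInt (IVar 3)) (RAdd (RMul (ROfInt (IConst 9)) (RMul rk (RVar 16))) (ROfInt (IConst 10)))))
       (ceil_to 4 20))))))))).

Definition algorithm (C0 : nat) : cmd :=
  Seq (prelude C0)
      (Seq (ISetV 18 (IConst 0))
           (Search 5 6 7 8 (IAdd kk_exp (IConst 4)) (IVar 3) (IVar 4) candidate)).

Section Specs.
Variables (R : realType) (w : nat -> R) (B : nat).
Hypothesis B2 : 2 <= B.
Implicit Types (s : state R) (Q : state R -> Prop).
Local Notation runs := (runs w B).

Definition has_dims (n d k : nat) s :=
  [/\ ints s 0 0 0 = n, ints s 0 0 1 = d & ints s 0 0 2 = k].

Lemma has_dims_agree n d k li lr s s' :
  0 \notin li -> agree_off li lr s s' -> has_dims n d k s -> has_dims n d k s'.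
Proof. by move=> h0 fr; rewrite /has_dims (agree_off_ints fr h0). Qed.

Lemma runs_abs_sum (n m x : nat) (val : nat -> nat -> R) vi vj ei ej dst src c s Q :
  let li := [:: vi, vj & written_ints c] in
  let lr := dst :: written_reals c in
  n <= B -> m <= B -> vi != vj -> vi \notin written_ints c -> vj \notin written_ints c ->
  dst \notin written_reals c ->
  (forall s', agree_off li lr s s' -> ieval s' ei = n /\ ieval s' ej = m) ->
  (forall i j s', i < n -> j < m -> agree_off li lr s s' ->
     ints s' vi 0 0 = i -> ints s' vj 0 0 = j ->
     runs c s' x (fun s2 => reals s2 src 0 0 = val i j)) ->
  reals s dst 0 0 = 0%R ->
  (forall s', agree_off li lr s s' ->
     reals s' dst 0 0 = (\sum_(i < n) \sum_(j < m) `|val i j|)%R -> Q s') ->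
  runs (For vi ei (For vj ej (Seq c (add_abs dst src (ROfInt (IConst 1)))))) s (x + 12) Q.
Proof.
move=> li lr nB mB vij vic vjc dc He Hc s0 HQ.
set li2 := vj :: written_ints (Seq c (add_abs dst src (ROfInt (IConst 1)))).
set lr2 := written_reals (Seq c (add_abs dst src (ROfInt (IConst 1)))).
have sub_r : {subset lr2 <= lr}.
  by move=> a; rewrite /lr2 /lr /= mem_cat !inE; case: (a == dst); rewrite ?orbT ?orbF.
have sub_i : {subset li2 <= li}.
  by move=> a; rewrite /li2 /li /= cats0 !inE => ->; rewrite orbT.
have sub_i' : {subset vi :: written_ints (For vj ej (Seq c (add_abs dst src (ROfInt (IConst 1))))) <= li}.
  move=> a; rewrite /li /= cats0 !(inE, mem_cat).
  by case: (a == vi) => //=; case: (a == vj) => //=; rewrite orbF.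
have sub_r' : {subset written_reals (For vj ej (Seq c (add_abs dst src (ROfInt (IConst 1))))) <= lr}.
  by move=> a; rewrite /= cats0; apply: sub_r.
apply: (@runs_le _ _ _ B2 _ _ ((x + 1).+1 + 5 + 5)); first by lia.
apply: (runs_for B2 (N := n)
  (I := fun i s' => reals s' dst 0 0 = (\sum_(i' < i) \sum_(j < m) `|val i' j|)%R)) => //.
- by rewrite /= cats0 !(inE, mem_cat) (negbTE vij) (negbTE vic).
- by move=> s' fr; apply: (proj1 (He _ _)); apply: agree_off_sub fr.
- by rewrite big_ord0.
- move=> i s' iN fr vii Ii.
  have fr' : agree_off li lr s s' by apply: agree_off_sub fr.
  apply: (runs_for B2 (N := m)
    (I := fun j s2 => reals s2 dst 0 0 = (\sum_(i' < i) \sum_(j < m) `|val i' j| +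
             \sum_(j' < j) `|val i j'|)%R)) => //.
  + by rewrite /= cats0.
  + move=> s2 fr2; apply: (proj2 (He _ _)).
    exact: agree_off_trans fr' (agree_off_sub sub_i sub_r fr2).
  + by rewrite big_ord0 addr0.
  + move=> j s2 jm fr2 vjj Ij.
    have fr3 := agree_off_trans fr' (agree_off_sub sub_i sub_r fr2).
    have vi2 : ints s2 vi 0 0 = i.
      by rewrite (agree_off_ints fr2) // /= cats0 inE negb_or vij.
    apply: (runs_seq B2); apply: (runs_frame).
    apply: (runs_weaken B2 _ _ (Hc i j s2 iN jm fr3 vi2 vjj)) => // s3 val3 frc.
    apply: (runs_add_abs B2) => s4 fr4 e4 /=.
    by rewrite e4 /= val3 (agree_off_reals frc dc) Ij mul1r big_ord_recr /= addrA.
  + by move=> s2 fr2 Im; rewrite big_ord_recr /= -Im.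
- by move=> s' fr; apply: HQ; apply: agree_off_sub fr.
Qed.

Section Fixed.
Variables (n d k t N : nat).
Hypotheses (nB : n <= B) (kB : 2 * k <= B) (dkB : d + k <= B) (tB : t <= B) (NB : N <= B).
Hypothesis (N2 : 2 <= N).

Let dB : d <= B. Proof. by apply: leq_trans dkB; rewrite leq_addr. Qed.
Let kB1 : k <= B. Proof. by apply: leq_trans dkB; rewrite leq_addl. Qed.
Let kkB : k + k <= B. Proof. by rewrite addnn -mul2n. Qed.

(** The program is run on every guess. With a pivot column out of range it only has to halt; the
    computed matrix is specified for admissible guesses. *)
Lemma runs_elim_step (r : nat) s Q :
  r < k -> has_dims n d k s -> ints s 19 0 0 = r ->
  (forall s', agree_off [:: 20; 21] [:: 3; 4; 17] s s' ->
     (ints s 5 1 r < d -> forall i j, i < n -> j < d + k ->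
        reals s' 3 i j = estep d r (ints s 5 0 r) (ints s 5 1 r) (reals s 3) i j) -> Q s') ->
  runs elim_step s 20 Q.
Proof.
move=> rk Hd v19 HQ; have [en ed ek] := Hd.
set p := ints s 5 0 r; set q := ints s 5 1 r in HQ *.
apply: (@runs_le _ _ _ B2 _ _ (5 + ((0 + (5 + 0).+1).+1 + 5)).+1) => //.
apply: (runs_seq B2).
apply: (runs_for_fill B2 (N := d + k)
  (T := fun c i j => if (i == 0) && (j < c) then reals s 3 p j else reals s 4 i j)) => //.
- by move=> s' fr; rewrite /= (ints_kept 0 fr) ed ek.
- by move=> i j; rewrite andbF.
- move=> l s' lq fr vl _ i j.
  rewrite /= vl (reals_kept 3 fr) (ints_kept 5 fr).
  rewrite (ints_kept 19 fr) v19 ltnS leq_eqVlt.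
  by case: (i == 0); have [->|j0] := eqVneq j l; rewrite ?ltnn //=.
move=> s1 fr1 T1.
apply: (runs_for B2 (N := n)
  (I := fun i s' => q < d -> forall i' j, j < d + k -> reals s' 3 i' j =
     if i' < i then estep d r p q (reals s 3) i' j else reals s 3 i' j)) => //.
- by move=> s' fr; rewrite /= (ints_kept 0 fr) (ints_kept 0 fr1).
- by move=> _ i' j _; rewrite /= (reals_kept 3 fr1).
- move=> i s' iN fr vi Ii.
  have fr0 : agree_off [:: 20; 21] [:: 3; 4; 17] s s'.
    by frame_both fr1 fr.
  apply: (runs_seq B2); apply: runs_rset => /=.
  set s2 := rset s' 17 0 0 _.
  have fr2 : agree_off [::] [:: 17] s' s2.
    by split=> // a; rewrite !inE => a12; rewrite /= update_other.
  have h2 : reals s2 17 0 0 = (reals s' 3 i q / reals s' 4 0 q)%R.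
    rewrite /= update_same vi (ints_kept 5 fr0).
    by rewrite (ints_kept 19 fr0) v19.
  clearbody s2.
  apply: (runs_seq B2).
  apply: (runs_for_fill B2 (N := d + k)
    (T := fun c i' j => if (i' == i) && (j < c) then (reals s' 3 i j - reals s2 17 0 0 * reals s' 4 0 j)%R
       else reals s' 3 i' j)) => //.
  + move=> s3 fr3; rewrite /= (ints_kept 0 fr3) (ints_kept 0 fr2).
    by rewrite (ints_kept 0 fr0) ed ek.
  + by move=> i' j; rewrite andbF (reals_kept 3 fr2).
  + move=> l s3 lq fr3 vl T3 i' j.
    rewrite /= vl (ints_kept 20 fr3) (ints_kept 20 fr2) vi.
    rewrite T3 ltnn andbF.
    rewrite (reals_kept 17 fr3) (reals_kept 4 fr3).
    rewrite (reals_kept 4 fr2) ltnS leq_eqVlt.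
    by case: (i' == i); have [->|j0] := eqVneq j l; rewrite ?ltnn //=.
  move=> s3 fr3 T3; apply: runs_rset => qd i' j jdk /=.
  have qdk : q < d + k by apply: leq_trans qd _; rewrite leq_addr.
  rewrite (ints_kept 20 fr3) (ints_kept 20 fr2) vi.
  rewrite (ints_kept 0 fr3) (ints_kept 0 fr2).
  rewrite (ints_kept 0 fr0) ed.
  rewrite (ints_kept 19 fr3) (ints_kept 19 fr2).
  rewrite (ints_kept 19 fr0) v19.
  rewrite (reals_kept 17 fr3) h2 /update eqxx /= T3 jdk andbT.
  have row4 l : l < d + k -> reals s' 4 0 l = reals s 3 p l.
    by move=> ldk; rewrite (reals_kept 4 fr) T1 /= ldk.
  rewrite ltnS leq_eqVlt.
  have [->|ii] := eqVneq i' i; last by rewrite /= Ii //; case: (i' < i).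
  rewrite /= /estep h2 !Ii // ltnn row4 //.
  by case: ifP => // _; rewrite row4.
- move=> s' fr Is; apply: HQ.
    by frame_both fr1 fr.
  by move=> qd i j iN jdk; rewrite Is // iN.
Qed.

Lemma runs_elim s Q :
  has_dims n d k s ->
  (forall s', agree_off [:: 19; 20; 21] [:: 3; 4; 17] s s' ->
     ((forall r, r < k -> ints s 5 0 r < n /\ ints s 5 1 r < d) -> forall i j, i < n -> j < d + k ->
        reals s' 3 i j = elim_mx d (ints s 5 0) (ints s 5 1) (reals s 0) k i j) -> Q s') ->
  runs elim s 40 Q.
Proof.
move=> Hd HQ; have [en ed ek] := Hd.
apply: (@runs_le _ _ _ B2 _ _ (10 + (20 + 5)).+1) => //.
apply: (runs_seq B2).
apply: (runs_for_fill2 B2 (n := n) (m := d + k) (val := reals s 0)) => //.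
- by move=> s' fr; rewrite /= (ints_kept 0 fr) en ed ek.
- move=> i j s' iN jN fr vi vj _.
  by rewrite /= vi vj (reals_kept 0 fr).
move=> s1 fr1 T1.
set good := forall r, r < k -> _ in HQ.
apply: (runs_for B2 (N := k)
  (I := fun r s' => good -> forall i j, i < n -> j < d + k ->
    reals s' 3 i j = elim_mx d (ints s 5 0) (ints s 5 1) (reals s 0) r i j)) => //.
- by move=> s' fr; rewrite /= (ints_kept 0 fr) (ints_kept 0 fr1).
- by move=> _ i j iN jN; rewrite /= T1 iN jN.
- move=> r s' rk fr vr Ir.
  have fr0 : agree_off [:: 19; 20; 21] [:: 3; 4; 17] s s'.
    by frame_both fr1 fr.
  apply: (runs_elim_step (r := r)) => //.
    exact: has_dims_agree fr0 Hd.
  move=> s2 fr2 H2 gd i j iN jN.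
  have [pn qd] := gd r rk; move: H2; rewrite (ints_kept 5 fr0) => H2.
  rewrite /= H2 // /estep !Ir //; by apply: leq_trans qd _; rewrite leq_addr.
- move=> s' fr Is; apply: HQ => //.
  by frame_both fr1 fr.
Qed.

Lemma runs_residual_norm s Q :
  has_dims n d k s ->
  (forall s', agree_off [:: 20; 21] [:: 15; 20] s s' ->
     reals s' 15 0 0 = (\sum_(i < n) \sum_(j < d) `|reals s 3 i j|)%R -> Q s') ->
  runs residual_norm s 20 Q.
Proof.
move=> Hd HQ; have [en ed ek] := Hd.
apply: (@runs_le _ _ _ B2 _ _ (0 + (0 + 12)).+1) => //.
apply: (runs_seq B2); apply: runs_rset => /=.
set s1 := rset s 15 0 0 _.
have fr1 : agree_off [::] [:: 15] s s1.
  by split=> // a; rewrite !inE => a12; rewrite /= update_other.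
have z1 : reals s1 15 0 0 = 0%R by rewrite /= update_same.
clearbody s1.
apply: (runs_abs_sum (n := n) (m := d) (val := reals s 3)) => //.
- move=> s' fr; rewrite /= (ints_kept 0 fr).
  by rewrite (ints_kept 0 fr1).
- move=> i j s' iN jN fr vi vj; apply: runs_rset.
  rewrite /= update_same vi vj (reals_kept 3 fr).
  by rewrite (reals_kept 3 fr1).
move=> s' fr E; apply: HQ => //.
by frame_both fr1 fr.
Qed.

Definition row_cost (M : nat -> nat -> R) (G : nat -> nat -> nat) (mu : R) (gr : nat -> R)
    (i : nat) : (nat -> R) -> R :=
  lad_cost (fun j l => mu * gr (G (4 + k + l)%N j))%R
    (fun j => M i (G 2 j) - \sum_(l < k) M i (d + l)%N * (mu * gr (G (4 + l)%N j)))%R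
    (fun j => (G 3 j)%:R%R) k t.

Definition row_ok (M : nat -> nat -> R) G mu gr (U : nat -> nat -> R) i :=
  exists f : nat -> nat, [/\ forall l, f l < N,
    forall l, l < k -> U i l = M i (d + l), forall l, l < k -> U i (k + l) = gr (f l) &
    forall f', (forall l, f' l < N) ->
      (row_cost M G mu gr i (gr \o f) <= row_cost M G mu gr i (gr \o f'))%R].

Lemma runs_row_phase s Q :
  has_dims n d k s -> ints s 3 0 0 = t -> ints s 4 0 0 = N ->
  (forall s', agree_off [:: 9; 10; 11; 12; 13; 14; 15; 16; 17; 20; 21; 22]
                        [:: 5; 7; 8; 9; 10; 11; 12; 13; 14] s s' ->
     (forall i, i < n -> row_ok (reals s 3) (ints s 5) (reals s 15 0 0)
        (grid (reals s 16 0 0) (reals s 21 0 0)) (reals s' 5) i) -> Q s') ->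
  runs row_phase s (k + 200) Q.
Proof.
move=> Hd Ht HN HQ; have [en ed ek] := Hd.
set gr := grid _ _ in HQ *; set mu := reals s 15 0 0 in HQ *.
set li := [:: 9; 10; 11; 12; 13; 14; 15; 16; 17; 20; 21; 22] in HQ *.
set lr := [:: 5; 7; 8; 9; 10; 11; 12; 13; 14] in HQ *.
apply: (@runs_le _ _ _ B2 _ _
  ((0 + (0 + ((0 + (5 + (5 + (0 + 0).+1).+1).+1).+1 + 5 + ((k + 100) + (5 + 5).+1).+1).+1).+1).+1 + 5)); first by lia.
apply: (runs_for B2 (N := n) (I := fun i s' => forall i', i' < i ->
  row_ok (reals s 3) (ints s 5) mu gr (reals s' 5) i')) => //.
- by move=> s' fr; rewrite /= (ints_kept 0 fr).
- move=> i s' iN fr vi Ii.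
  have {fr}fr0 : agree_off li lr s s' by frame_sub fr.
  apply: (runs_seq B2); apply: runs_iset => /=.
  apply: (runs_seq B2); apply: runs_iset => /=.
  set s1 := iset _ _ _ _ _.
  have fr1 : agree_off [:: 13; 14] [::] s' s1.
    by split=> // a; rewrite !inE => /norP[a12 a13]; rewrite /= !update_other.
  have v13 : ints s1 13 0 0 = k.
    by rewrite /= update_other // update_same (ints_kept 0 fr0).
  have v14 : ints s1 14 0 0 = t.
    by rewrite /= update_same update_other // (ints_kept 3 fr0).
  clearbody s1.
  have fr01 : agree_off li lr s s1.
    by frame_trans fr0 fr1.
  apply: (runs_seq B2).
  pose PP := fun j l => (mu * gr (ints s 5 (4 + k + l)%N j))%R.
  pose bb := fun j => (reals s 3 i (ints s 5 2 j) -
     \sum_(l < k) reals s 3 i (d + l)%N * (mu * gr (ints s 5 (4 + l)%N j)))%R.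
  apply: (runs_for B2 (N := t) (I := fun j s2 => forall j', j' < j ->
    [/\ forall l, l < k -> reals s2 7 j' l = PP j' l, reals s2 8 0 j' = bb j' &
        reals s2 9 0 j' = ((ints s 5 3 j')%:R)%R])) => //.
  + move=> s2 fr2; rewrite /= (ints_kept 3 fr2).
    by rewrite (ints_kept 3 fr01).
  + move=> j s2 jt fr2 vj Ij.
    have fr02 : agree_off li lr s s2.
      by frame_trans fr01 fr2.
    have vi2 : ints s2 20 0 0 = i.
      by rewrite (ints_kept 20 fr2) (ints_kept 20 fr1).
    apply: (runs_seq B2); apply: runs_rset => /=.
    set s3 := rset s2 14 0 0 _.
    have fr3 : agree_off [::] [:: 14] s2 s3.
      by split=> // a; rewrite !inE => a12; rewrite /= update_other.
    have a3 : reals s3 14 0 0 = reals s 3 i (ints s 5 2 j).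
      rewrite /= update_same vi2 vj (ints_kept 5 fr02).
      by rewrite (reals_kept 3 fr02).
    clearbody s3.
    have fr03 : agree_off li lr s s3.
      by frame_trans fr02 fr3.
    have guess sg off o l : agree_off li lr s sg -> ints sg 21 0 0 = j -> ints sg 22 0 0 = l ->
        ieval sg off = o ->
        reval sg (guess_exp off) = (mu * gr (ints s 5 (o + l)%N j))%R.
      move=> f v21 v22 vo; rewrite /= v21 v22 vo (ints_kept 5 f).
      rewrite (reals_kept 15 f) (reals_kept 16 f).
      by rewrite (reals_kept 21 f).
    apply: (runs_seq B2).
    apply: (runs_for_fill B2 (N := k)
      (T := fun c j' l => if (j' == j) && (l < c) then PP j l else reals s2 7 j' l)) => //.
    * move=> s4 fr4; rewrite /= (ints_kept 0 fr4).
      by rewrite (ints_kept 0 fr03).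
    * by move=> j' l; rewrite andbF (reals_kept 7 fr3).
    * move=> l s4 lk fr4 vl _ j' l'.
      have v21 : ints s4 21 0 0 = j.
        by rewrite (ints_kept 21 fr4) (ints_kept 21 fr3).
      have fr04 : agree_off li lr s s4.
        by frame_trans fr03 fr4.
      rewrite (@guess s4 _ (4 + k) l) //; last first.
        by rewrite /= (ints_kept 0 fr04) ek.
      rewrite /= vl v21 ltnS leq_eqVlt.
      by case: (j' == j); have [->|j0] := eqVneq l' l; rewrite ?ltnn //=.
    move=> s4 fr4 T4.
    have fr04 : agree_off li lr s s4.
      by frame_trans fr03 fr4.
    apply: (runs_seq B2).
    apply: (runs_for_sum B2 (N := k)
      (val := fun l => (0 - reals s 3 i (d + l)%N * (mu * gr (ints s 5 (4 + l)%N j)))%R)) => //.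
    * move=> s5 fr5; rewrite /= (ints_kept 0 fr5).
      by rewrite (ints_kept 0 fr04).
    * move=> l s5 lk fr5 vl.
      have fr05 : agree_off li lr s s5.
        by frame_trans fr04 fr5.
      have E : forall g, reval s5 (RSub (ROfInt (IConst 0))
          (RMul (RGet 3 (IVar 20) (IAdd d_exp (IVar 22))) g)) =
          (0 - reals s5 3 (ints s5 20 0 0) (ints s5 0 0 1 + ints s5 22 0 0)%N * reval s5 g)%R by [].
      rewrite E (@guess s5 _ 4 l) //; last first.
        rewrite (ints_kept 21 fr5) (ints_kept 21 fr4).
        by rewrite (ints_kept 21 fr3).
      rewrite vl (reals_kept 3 fr05) (ints_kept 0 fr05) ed.
      rewrite (ints_kept 20 fr5) (ints_kept 20 fr4).
      by rewrite (ints_kept 20 fr3) vi2.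
    move=> s5 fr5 a5.
    apply: (runs_seq B2); apply: runs_rset; apply: runs_rset => /=.
    have v21 : ints s5 21 0 0 = j.
      rewrite (ints_kept 21 fr5) (ints_kept 21 fr4).
      by rewrite (ints_kept 21 fr3).
    rewrite v21 (ints_kept 5 fr5) (ints_kept 5 fr04).
    have b5 : reals s5 14 0 0 = bb j.
      rewrite a5 (reals_kept 14 fr4) a3 /bb; congr (_ + _)%R.
      by rewrite -sumrN; apply: eq_bigr => l _; rewrite sub0r.
    move=> j' j'j; split.
    * move=> l lk; rewrite !update_other // (reals_kept 7 fr5) T4 lk andbT.
      move: j'j; rewrite ltnS leq_eqVlt; case: eqP => [->//|_ /= /Ij [-> //]].
    * rewrite update_other // /update /= b5; case: eqP => [-> //|jj].
      rewrite (reals_kept 8 fr5) (reals_kept 8 fr4).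
      rewrite (reals_kept 8 fr3).
      by move: j'j; rewrite ltnS leq_eqVlt; move/eqP/negbTE: jj => -> /= /Ij [].
    * rewrite /update /=; case: eqP => [-> //|jj].
      rewrite (reals_kept 9 fr5) (reals_kept 9 fr4).
      rewrite (reals_kept 9 fr3).
      by move: j'j; rewrite ltnS leq_eqVlt; move/eqP/negbTE: jj => -> /= /Ij [].
  move=> s2 fr2 I2.
  have fr02 : agree_off li lr s s2.
    by frame_trans fr01 fr2.
  apply: (runs_seq B2).
  apply: (runs_lad B2 (q := k) (m := t) (N := N)) => //.
  + by rewrite (ints_kept 13 fr2).
  + by rewrite (ints_kept 14 fr2).
  + by rewrite (ints_kept 4 fr02).
  move=> s3 fr3 [f [fN fbest fmin]].
  have fr03 : agree_off li lr s s3.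
    by frame_trans fr02 fr3.
  have Egr : grid (reals s2 16 0 0) (reals s2 21 0 0) = gr.
    by rewrite (reals_kept 16 fr02) (reals_kept 21 fr02).
  have vi3 : ints s3 20 0 0 = i.
    rewrite (ints_kept 20 fr3) (ints_kept 20 fr2).
    by rewrite (ints_kept 20 fr1).
  apply: (runs_seq B2).
  apply: (runs_for_fill B2 (N := k)
    (T := fun c i' l => if (i' == i) && (l < c) then reals s 3 i (d + l) else reals s3 5 i' l)) => //.
  + move=> s4 fr4; rewrite /= (ints_kept 0 fr4).
    by rewrite (ints_kept 0 fr03).
  + by move=> i' l; rewrite andbF.
  + move=> l s4 lk fr4 vl _ i' l'.
    rewrite /= vl (ints_kept 20 fr4) vi3.
    rewrite (ints_kept 0 fr4) (ints_kept 0 fr03) ed.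
    rewrite (reals_kept 3 fr4) (reals_kept 3 fr03).
    rewrite ltnS leq_eqVlt.
    by case: (i' == i); have [->|j0] := eqVneq l' l; rewrite ?ltnn //=.
  move=> s4 fr4 T4.
  apply: (runs_for_fill B2 (N := k)
    (T := fun c i' l => if (i' == i) && ((k <= l) && (l < k + c)) then gr (f (l - k))
       else reals s4 5 i' l)) => //.
  + move=> s5 fr5; rewrite /= (ints_kept 0 fr5).
    by rewrite (ints_kept 0 fr4) (ints_kept 0 fr03).
  + move=> i' l; rewrite addn0 ltnNge; by case: (k <= l); rewrite andbF.
  + move=> l s5 lk fr5 vl _ i' l'.
    rewrite /= vl (ints_kept 20 fr5) (ints_kept 20 fr4) vi3.
    rewrite (ints_kept 0 fr5) (ints_kept 0 fr4).
    rewrite (ints_kept 0 fr03) ek addnS.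
    rewrite (reals_kept 11 fr5) (reals_kept 11 fr4).
    rewrite fbest // Egr ltnS (leq_eqVlt l').
    have [->|j0] := eqVneq l' (k + l).
      by rewrite leq_addr addKn ltnn; case: (i' == i).
    by rewrite andbF.
  move=> s5 fr5 T5 i'; rewrite ltnS leq_eqVlt => /orP[/eqP ->|i'i]; last first.
    have [f' [f'N U1 U2 f'min]] := Ii i' i'i.
    have E l : reals s5 5 i' l = reals s' 5 i' l.
      rewrite T5 T4 (ltn_eqF i'i) /= (reals_kept 5 fr3).
      by rewrite (reals_kept 5 fr2) (reals_kept 5 fr1).
    by exists f'; split=> // l lk; rewrite E; [exact: U1|exact: U2].
  exists f; split=> //.
  + by move=> l lk; rewrite /= T5 (leqNgt k l) lk andbF T4 eqxx lk.
  + by move=> l lk; rewrite /= T5 eqxx leq_addr ltn_add2l lk addKn.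
  + move=> f' f'N; have := fmin f' f'N; rewrite Egr.
    suff E z : lad_cost (reals s2 7) (reals s2 8 0) (reals s2 9 0) k t z =
        row_cost (reals s 3) (ints s 5) mu gr i z by rewrite !E.
    apply: lad_cost_ext => //.
    * by move=> j l jt lk; have [-> ] := I2 j jt.
    * by move=> j jt; have [_ -> ] := I2 j jt.
    * by move=> j jt; have [_ _ -> ] := I2 j jt.
- by move=> s' fr; apply: HQ; frame_sub fr.
Qed.

End Fixed.
End Specs.
End MainProgram.

Section MainProgramSpec.
Local Open Scope nat_scope.
Variables (R : realType) (w : nat -> R) (B : nat).
Hypothesis B2 : 2 <= B.
Implicit Types (s : state R) (Q : state R -> Prop).
Local Notation runs := (runs w B).

Section Fixed.
Variables (n d k t N : nat).
Hypotheses (nB : n <= B) (kB : 2 * k <= B) (dkB : d + k <= B) (tB : t <= B) (NB : N <= B).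
Hypothesis (N2 : 2 <= N).

Let dB : d <= B. Proof. by apply: leq_trans dkB; rewrite leq_addr. Qed.
Let kB1 : k <= B. Proof. by apply: leq_trans dkB; rewrite leq_addl. Qed.
Let kkB : k + k <= B. Proof. by rewrite addnn -mul2n. Qed.

Definition col_cost (M U : nat -> nat -> R) (mu : R) (j : nat) : (nat -> R) -> R :=
  lad_cost (fun i l => U i l * mu)%R (fun i => M i j) (fun=> 1%R) (k + k) n.

Definition col_ok (A M U : nat -> nat -> R) (p : nat -> nat) (mu : R) (gr : nat -> R) (V : nat -> nat -> R) j :=
  exists f : nat -> nat, [/\ forall l, f l < N,
    forall l, l < k + k -> V l j = (mu * gr (f l) + if (l < k)%N then A (p l) j else 0)%R &
    forall f', (forall l, f' l < N) ->
      (col_cost M U mu j (gr \o f) <= col_cost M U mu j (gr \o f'))%R].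

Lemma runs_col_phase s Q :
  has_dims n d k s -> ints s 4 0 0 = N ->
  (forall s', agree_off [:: 9; 10; 11; 12; 13; 14; 15; 16; 17; 20; 21; 22]
                        [:: 6; 7; 8; 9; 10; 11; 12; 13; 14] s s' ->
     (forall j, j < d -> col_ok (reals s 0) (reals s 3) (reals s 5) (ints s 5 0) (reals s 15 0 0)
        (grid (reals s 16 0 0) (reals s 21 0 0)) (reals s' 6) j) -> Q s') ->
  runs col_phase s (k + k + 200) Q.
Proof.
move=> Hd HN HQ; have [en ed ek] := Hd.
set gr := grid _ _ in HQ *; set mu := reals s 15 0 0 in HQ *.
set li := [:: 9; 10; 11; 12; 13; 14; 15; 16; 17; 20; 21; 22] in HQ *.
set lr := [:: 6; 7; 8; 9; 10; 11; 12; 13; 14] in HQ *.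
apply: (@runs_le _ _ _ B2 _ _
  ((0 + (0 + ((5 + (0 + 0).+1).+1 + 5 + ((k + k + 100) + (5 + 5).+1).+1).+1).+1).+1 + 5)); first by lia.
apply: (runs_for B2 (N := d) (I := fun j s' => forall j', j' < j ->
  col_ok (reals s 0) (reals s 3) (reals s 5) (ints s 5 0) mu gr (reals s' 6) j')) => //.
- by move=> s' fr; rewrite /= (ints_kept 0 fr).
- move=> j s' jd fr vj Ij.
  have {fr}fr0 : agree_off li lr s s' by frame_sub fr.
  apply: (runs_seq B2); apply: runs_iset => /=.
  apply: (runs_seq B2); apply: runs_iset => /=.
  set s1 := iset _ _ _ _ _.
  have fr1 : agree_off [:: 13; 14] [::] s' s1.
    by split=> // a; rewrite !inE => /norP[a12 a13]; rewrite /= !update_other.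
  have v13 : ints s1 13 0 0 = k + k.
    by rewrite /= update_other // update_same (ints_kept 0 fr0) ek.
  have v14 : ints s1 14 0 0 = n.
    by rewrite /= update_same update_other // (ints_kept 0 fr0).
  clearbody s1.
  have fr01 : agree_off li lr s s1.
    by frame_trans fr0 fr1.
  apply: (runs_seq B2).
  apply: (runs_for B2 (N := n) (I := fun i s2 => forall i', i' < i ->
    [/\ forall l, l < k + k -> reals s2 7 i' l = (reals s 5 i' l * mu)%R,
        reals s2 8 0 i' = reals s 3 i' j & reals s2 9 0 i' = 1%R])) => //.
  + move=> s2 fr2; rewrite /= (ints_kept 0 fr2).
    by rewrite (ints_kept 0 fr01).
  + move=> i s2 iN fr2 vi Ii.
    have fr02 : agree_off li lr s s2.
      by frame_trans fr01 fr2.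
    have vj2 : ints s2 21 0 0 = j.
      by rewrite (ints_kept 21 fr2) (ints_kept 21 fr1).
    apply: (runs_seq B2).
    apply: (runs_for_fill B2 (N := k + k)
      (T := fun c i' l => if (i' == i) && (l < c) then (reals s 5 i l * mu)%R else reals s2 7 i' l)) => //.
    * move=> s4 fr4; rewrite /= (ints_kept 0 fr4).
      by rewrite (ints_kept 0 fr02) ek.
    * by move=> i' l; rewrite andbF.
    * move=> l s4 lk fr4 vl _ i' l'.
      have fr04 : agree_off li lr s s4.
        by frame_trans fr02 fr4.
      rewrite /= vl (ints_kept 20 fr4) vi.
      rewrite (reals_kept 5 fr04) (reals_kept 15 fr04).
      rewrite ltnS leq_eqVlt.
      by case: (i' == i); have [->|j0] := eqVneq l' l; rewrite ?ltnn //=.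
    move=> s4 fr4 T4.
    have fr04 : agree_off li lr s s4.
      by frame_trans fr02 fr4.
    apply: (runs_seq B2); apply: runs_rset; apply: runs_rset => /=.
    rewrite (ints_kept 20 fr4) vi (ints_kept 21 fr4) vj2.
    rewrite (reals_kept 3 fr04).
    move=> i' i'i; split.
    * move=> l lk; rewrite !update_other // T4 lk andbT.
      move: i'i; rewrite ltnS leq_eqVlt; case: eqP => [->//|_ /= /Ii [-> //]].
    * rewrite update_other // /update /=; case: eqP => [-> //|jj].
      rewrite (reals_kept 8 fr4).
      by move: i'i; rewrite ltnS leq_eqVlt; move/eqP/negbTE: jj => -> /= /Ii [].
    * rewrite /update /=; case: eqP => // jj.
      rewrite (reals_kept 9 fr4).
      by move: i'i; rewrite ltnS leq_eqVlt; move/eqP/negbTE: jj => -> /= /Ii [].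
  move=> s2 fr2 I2.
  have fr02 : agree_off li lr s s2.
    by frame_trans fr01 fr2.
  apply: (runs_seq B2).
  apply: (runs_lad B2 (q := k + k) (m := n) (N := N)) => //.
  + by rewrite (ints_kept 13 fr2).
  + by rewrite (ints_kept 14 fr2).
  + by rewrite (ints_kept 4 fr02).
  move=> s3 fr3 [f [fN fbest fmin]].
  have fr03 : agree_off li lr s s3.
    by frame_trans fr02 fr3.
  have Egr : grid (reals s2 16 0 0) (reals s2 21 0 0) = gr.
    by rewrite (reals_kept 16 fr02) (reals_kept 21 fr02).
  have vj3 : ints s3 21 0 0 = j.
    rewrite (ints_kept 21 fr3) (ints_kept 21 fr2).
    by rewrite (ints_kept 21 fr1).
  apply: (runs_seq B2).
  apply: (runs_for_fill B2 (N := k + k)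
    (T := fun c l j' => if (j' == j) && (l < c) then (mu * gr (f l))%R else reals s3 6 l j')) => //.
  + move=> s4 fr4; rewrite /= (ints_kept 0 fr4).
    by rewrite (ints_kept 0 fr03) ek.
  + by move=> i' l; rewrite andbF.
  + move=> l s4 lk fr4 vl _ l' j'.
    rewrite /= vl (ints_kept 21 fr4) vj3.
    rewrite (reals_kept 15 fr4) (reals_kept 15 fr03).
    rewrite (reals_kept 11 fr4) fbest // Egr ltnS leq_eqVlt.
    by case: (j' == j); have [->|j0] := eqVneq l' l; rewrite ?ltnn //=.
  move=> s4 fr4 T4.
  have fr04 : agree_off li lr s s4.
    by frame_trans fr03 fr4.
  apply: (runs_for_fill B2 (N := k)
    (T := fun c l j' => if (j' == j) && (l < c) then
        (mu * gr (f l) + reals s 0 (ints s 5 0 l) j)%R else reals s4 6 l j')) => //.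
  + move=> s5 fr5; rewrite /= (ints_kept 0 fr5).
    by rewrite (ints_kept 0 fr04).
  + by move=> l j'; rewrite andbF.
  + move=> l s5 lk fr5 vl T5 l' j'.
    rewrite /= vl (ints_kept 21 fr5) (ints_kept 21 fr4) vj3.
    rewrite T5 ltnn andbF (T4 l j) eqxx /= (leq_trans lk (leq_addr _ _)).
    rewrite (reals_kept 0 fr5) (reals_kept 0 fr04).
    rewrite (ints_kept 5 fr5) (ints_kept 5 fr04).
    rewrite ltnS leq_eqVlt.
    by case: (j' == j); have [->|j0] := eqVneq l' l; rewrite ?ltnn //=.
  move=> s5 fr5 T5 j'; rewrite ltnS leq_eqVlt => /orP[/eqP ->|j'j]; last first.
    have [f' [f'N U1 f'min]] := Ij j' j'j.
    have E l : reals s5 6 l j' = reals s' 6 l j'.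
      rewrite T5 T4 (ltn_eqF j'j) /= (reals_kept 6 fr3).
      by rewrite (reals_kept 6 fr2) (reals_kept 6 fr1).
    by exists f'; split=> // l lk; rewrite E U1.
  exists f; split=> //.
  + by move=> l lk; rewrite /= T5 T4 eqxx lk /=; case: (l < k); rewrite // addr0.
  + move=> f' f'N; have := fmin f' f'N; rewrite Egr.
    suff E z : lad_cost (reals s2 7) (reals s2 8 0) (reals s2 9 0) (k + k) n z =
        col_cost (reals s 3) (reals s 5) mu j z by rewrite !E.
    apply: lad_cost_ext => //.
    * by move=> i l iN lk; have [-> ] := I2 i iN.
    * by move=> i iN; have [_ -> ] := I2 i iN.
    * by move=> i iN; have [_ _ -> ] := I2 i iN.
- by move=> s' fr; apply: HQ; frame_sub fr.
Qed.

Definition fit_error (A U V : nat -> nat -> R) : R :=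
  (\sum_(i < n) \sum_(j < d) `|\sum_(l < k + k) U i l * V l j - A i j|)%R.

Lemma fit_error_ext A U V U' V' :
  (forall i l, i < n -> l < k + k -> U i l = U' i l) ->
  (forall l j, l < k + k -> j < d -> V l j = V' l j) ->
  fit_error A U V = fit_error A U' V'.
Proof.
move=> HU HV; apply: eq_bigr => i _; apply: eq_bigr => j _.
by congr (`| _ - _ |)%R; apply: eq_bigr => l _; rewrite HU // HV.
Qed.

Lemma runs_evaluate s Q :
  has_dims n d k s ->
  (forall s', agree_off [:: 20; 21; 22] [:: 18; 20] s s' ->
     reals s' 18 0 0 = fit_error (reals s 0) (reals s 5) (reals s 6) -> Q s') ->
  runs evaluate s 30 Q.
Proof.
move=> Hd HQ; have [en ed ek] := Hd.
apply: (@runs_le _ _ _ B2 _ _ (0 + ((0 + 5).+1 + 12)).+1) => //.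
apply: (runs_seq B2); apply: runs_rset => /=.
set s1 := rset s 18 0 0 _.
have fr1 : agree_off [::] [:: 18] s s1.
  by split=> // a; rewrite !inE => a12; rewrite /= update_other.
have z1 : reals s1 18 0 0 = 0%R by rewrite /= update_same.
clearbody s1.
apply: (runs_abs_sum B2 (n := n) (m := d)
  (val := fun i j => \sum_(l < k + k) reals s 5 i l * reals s 6 l j - reals s 0 i j)%R) => //.
- move=> s' fr; rewrite /= (ints_kept 0 fr).
  by rewrite (ints_kept 0 fr1).
- move=> i j s' iN jN fr vi vj.
  apply: (runs_seq B2); apply: runs_rset => /=.
  set s2 := rset s' 20 0 0 _.
  have fr2 : agree_off [::] [:: 20] s' s2.
    by split=> // a; rewrite !inE => a12; rewrite /= update_other.
  have z2 : reals s2 20 0 0 = (- reals s 0 i j)%R.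
    rewrite /= update_same vi vj sub0r (reals_kept 0 fr).
    by rewrite (reals_kept 0 fr1).
  clearbody s2.
  apply: (runs_for_sum B2 (N := k + k) (val := fun l => (reals s 5 i l * reals s 6 l j)%R)) => //.
  + move=> s3 fr3; rewrite /= (ints_kept 0 fr3) (ints_kept 0 fr2).
    by rewrite (ints_kept 0 fr) (ints_kept 0 fr1) ek.
  + move=> l s3 lk fr3 vl; rewrite /= vl.
    rewrite (ints_kept 20 fr3) (ints_kept 20 fr2) vi.
    rewrite (ints_kept 21 fr3) (ints_kept 21 fr2) vj.
    rewrite (reals_kept 5 fr3) (reals_kept 5 fr2).
    rewrite (reals_kept 5 fr) (reals_kept 5 fr1).
    rewrite (reals_kept 6 fr3) (reals_kept 6 fr2).
    by rewrite (reals_kept 6 fr) (reals_kept 6 fr1).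
  + by move=> s3 fr3 ->; rewrite z2 addrC.
move=> s' fr E; apply: HQ => //.
by frame_both fr1 fr.
Qed.

Lemma runs_keep_best s Q :
  has_dims n d k s ->
  (forall s', agree_off [:: 18; 20; 21] [:: 1; 2; 19] s s' ->
     ints s' 18 0 0 = 1 \/ ints s 18 0 0 > 1 ->
     ([/\ 0 < ints s 18 0 0, (reals s 19 0 0 <= reals s 18 0 0)%R, ints s' 18 0 0 = ints s 18 0 0,
          reals s' = reals s & True] \/
      [/\ ints s 18 0 0 = 0 \/ (reals s 18 0 0 <= reals s 19 0 0)%R,
          ints s' 18 0 0 = 1, reals s' 19 0 0 = reals s 18 0 0,
          forall i l, i < n -> l < k + k -> reals s' 1 i l = reals s 5 i l &
          forall l j, l < k + k -> j < d -> reals s' 2 l j = reals s 6 l j]) -> Q s') ->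
  runs keep_best s 40 Q.
Proof.
move=> Hd HQ; have [en ed ek] := Hd.
apply: (@runs_le _ _ _ B2 _ _ (0 + (0 + (10 + 10).+1).+1).+1.+1) => //.
apply: (runs_if B2) => /= Hb.
  apply: (@runs_le _ _ _ B2 _ _ 0) => //; apply: runs_skip; apply: HQ => //.
    by case/andP: Hb; rewrite leq_eqVlt => /orP[/eqP <-|H] _; [left|right].
  by left; case/andP: Hb.
apply: (runs_seq B2); apply: runs_iset => /=.
apply: (runs_seq B2); apply: runs_rset => /=.
set s1 := rset _ _ _ _ _.
have fr1 : agree_off [:: 18] [:: 19] s s1.
  by split=> a; rewrite inE => ba; rewrite /= update_other.
have e18 : ints s1 18 0 0 = 1 by rewrite /= update_same.
have e19 : reals s1 19 0 0 = reals s 18 0 0 by rewrite /= update_same.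
clearbody s1.
apply: (runs_seq B2).
apply: (runs_for_fill2 B2 (n := n) (m := k + k) (val := reals s 5)) => //.
- by move=> s' fr; rewrite /= (ints_kept 0 fr) (ints_kept 0 fr1) en ek.
- move=> i j s' iN jN fr vi vj _.
  by rewrite /= vi vj (reals_kept 5 fr) (reals_kept 5 fr1).
move=> s2 fr2 T2.
apply: (runs_for_fill2 B2 (n := k + k) (m := d) (val := reals s 6)) => //.
- move=> s' fr; rewrite /= (ints_kept 0 fr) (ints_kept 0 fr2).
  by rewrite (ints_kept 0 fr1) ek ed.
- move=> i j s' iN jN fr vi vj _.
  rewrite /= vi vj (reals_kept 6 fr) (reals_kept 6 fr2).
  by rewrite (reals_kept 6 fr1).
move=> s3 fr3 T3.
have e18' : ints s3 18 0 0 = 1.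
  by rewrite (ints_kept 18 fr3) (ints_kept 18 fr2).
apply: HQ => //; [|by left|right; split=> //].
- apply: (agree_off_trans (s2 := s1)); first by frame_sub fr1.
  by frame_both fr2 fr3.
- move: Hb; rewrite negb_and -ltnNge ltnS leqn0 -ltNge => /orP[/eqP|/ltW]; by [left|right].
- by rewrite (reals_kept 19 fr3) (reals_kept 19 fr2).
- by move=> i l iN lk; rewrite (reals_kept 1 fr3) T2 iN lk.
- by move=> l j lk jd; rewrite T3 lk jd.
Qed.

(** [M] is existential because the elimination is specified only for pivots in range; the two fits
    are optimal relative to the matrix actually computed. *)
Definition candidate_ok (A : nat -> nat -> R) (gr : nat -> R) (G : nat -> nat -> nat)
    (U V : nat -> nat -> R) : Prop :=
  exists (M : nat -> nat -> R) (mu : R), [/\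
    (forall r, r < k -> G 0 r < n /\ G 1 r < d) -> forall i j, i < n -> j < d + k ->
        M i j = elim_mx d (G 0) (G 1) A k i j,
    mu = (\sum_(i < n) \sum_(j < d) `|M i j|)%R,
    forall i, i < n -> row_ok d k t N M G mu gr U i &
    forall j, j < d -> col_ok A M U (G 0) mu gr V j].

Lemma runs_candidate s Q :
  has_dims n d k s -> ints s 3 0 0 = t -> ints s 4 0 0 = N ->
  let gr := grid (reals s 16 0 0) (reals s 21 0 0) in
  (forall s' U V, agree_off [:: 9; 10; 11; 12; 13; 14; 15; 16; 17; 18; 19; 20; 21; 22]
      [:: 1; 2; 3; 4; 5; 6; 7; 8; 9; 10; 11; 12; 13; 14; 15; 17; 18; 19; 20] s s' ->
     candidate_ok (reals s 0) gr (ints s 5) U V ->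
     ints s' 18 0 0 = 1 \/ ints s 18 0 0 > 1 ->
     ([/\ 0 < ints s 18 0 0, (reals s 19 0 0 <= fit_error (reals s 0) U V)%R,
          ints s' 18 0 0 = ints s 18 0 0, reals s' 19 0 0 = reals s 19 0 0 &
          reals s' 1 = reals s 1 /\ reals s' 2 = reals s 2] \/
      [/\ ints s 18 0 0 = 0 \/ (fit_error (reals s 0) U V <= reals s 19 0 0)%R,
          ints s' 18 0 0 = 1, reals s' 19 0 0 = fit_error (reals s 0) U V &
          fit_error (reals s 0) (reals s' 1) (reals s' 2) = fit_error (reals s 0) U V]) -> Q s') ->
  runs candidate s (k + (k + k) + 600) Q.
Proof.
move=> Hd Ht HN gr HQ.
set li := [:: 9; 10; 11; 12; 13; 14; 15; 16; 17; 18; 19; 20; 21; 22] in HQ *.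
set lr := [:: 1; 2; 3; 4; 5; 6; 7; 8; 9; 10; 11; 12; 13; 14; 15; 17; 18; 19; 20] in HQ *.
apply: (@runs_le _ _ _ B2 _ _ (40 + (20 + (k + 200 + (k + k + 200 + (30 + 40).+1).+1).+1).+1).+1); first by lia.
apply: (runs_seq B2); apply: (@runs_elim _ w B B2 n d k) => // s1 fr1 E1.
have Hd1 : has_dims n d k s1 by exact: has_dims_agree fr1 Hd.
apply: (runs_seq B2); apply: (@runs_residual_norm _ w B B2 n d k) => // s2 fr2 E2.
have Hd2 : has_dims n d k s2 by exact: has_dims_agree fr2 Hd1.
have fr12 : agree_off li lr s s2.
  by frame_both fr1 fr2.
apply: (runs_seq B2); apply: (@runs_row_phase _ w B B2 n d k t N) => //.
- by rewrite (ints_kept 3 fr12).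
- by rewrite (ints_kept 4 fr12).
move=> s3 fr3 E3.
have Hd3 : has_dims n d k s3 by exact: has_dims_agree fr3 Hd2.
have fr13 : agree_off li lr s s3.
  by frame_trans fr12 fr3.
apply: (runs_seq B2); apply: runs_col_phase => //.
- by rewrite (ints_kept 4 fr13).
move=> s4 fr4 E4.
have Hd4 : has_dims n d k s4 by exact: has_dims_agree fr4 Hd3.
have fr14 : agree_off li lr s s4.
  by frame_trans fr13 fr4.
apply: (runs_seq B2); apply: runs_evaluate => // s5 fr5 E5.
have Hd5 : has_dims n d k s5 by exact: has_dims_agree fr5 Hd4.
have fr15 : agree_off li lr s s5.
  by frame_trans fr14 fr5.
apply: runs_keep_best => // s6 fr6 fl6 E6.
have fr16 : agree_off li lr s s6.
  by frame_trans fr15 fr6.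
have ok : candidate_ok (reals s 0) gr (ints s 5) (reals s5 5) (reals s5 6).
  exists (reals s3 3), (reals s3 15 0 0); split.
  - move=> gd i j iN jN; rewrite (reals_kept 3 fr3).
    by rewrite (reals_kept 3 fr2) E1.
  - rewrite (reals_kept 15 fr3) E2 (reals_kept 3 fr3).
    by rewrite (reals_kept 3 fr2).
  - move=> i iN; have := E3 i iN.
    rewrite (reals_kept 5 fr5) (reals_kept 5 fr4).
    rewrite (reals_kept 3 fr3) (reals_kept 15 fr3).
    rewrite (ints_kept 5 fr12) (reals_kept 16 fr12).
    by rewrite (reals_kept 21 fr12).
  - move=> j jd; have := E4 j jd.
    rewrite (reals_kept 5 fr5) (reals_kept 5 fr4).
    rewrite (reals_kept 6 fr5) (reals_kept 0 fr13).
    rewrite (ints_kept 5 fr13) (reals_kept 16 fr13).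
    by rewrite (reals_kept 21 fr13).
have eA : reals s4 0 = reals s 0 by rewrite (reals_kept 0 fr14).
have eU : reals s4 5 = reals s5 5 by rewrite (reals_kept 5 fr5).
have eV : reals s4 6 = reals s5 6 by rewrite (reals_kept 6 fr5).
rewrite eA eU eV in E5.
have e18 : ints s5 18 = ints s 18.
  rewrite (ints_kept 18 fr5) (ints_kept 18 fr4).
  rewrite (ints_kept 18 fr3) (ints_kept 18 fr2).
  by rewrite (ints_kept 18 fr1).
have e19 : reals s5 19 = reals s 19.
  rewrite (reals_kept 19 fr5) (reals_kept 19 fr4).
  rewrite (reals_kept 19 fr3) (reals_kept 19 fr2).
  by rewrite (reals_kept 19 fr1).
have e1 : reals s5 1 = reals s 1.
  rewrite (reals_kept 1 fr5) (reals_kept 1 fr4).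
  rewrite (reals_kept 1 fr3) (reals_kept 1 fr2).
  by rewrite (reals_kept 1 fr1).
have e2 : reals s5 2 = reals s 2.
  rewrite (reals_kept 2 fr5) (reals_kept 2 fr4).
  rewrite (reals_kept 2 fr3) (reals_kept 2 fr2).
  by rewrite (reals_kept 2 fr1).
rewrite e18 e19 E5 in E6 fl6.
apply: (HQ s6 _ _ fr16 ok) => //.
case: E6 => [[h1 h2 h3 h4 _]|[h1 h2 h3 h4 h5]]; [left|right]; split=> //.
- by rewrite h4 e19.
- by rewrite h4.
- exact: fit_error_ext.
Qed.

(** [U] and [V] are existential because grid minimisers are not unique and the run picks some of
    them. [G] is the guess array of the run, known only on the cells that the search enumerates. *)
Lemma runs_search_candidates s Q :
  2 * k + 4 <= B -> has_dims n d k s -> ints s 3 0 0 = t -> ints s 4 0 0 = N ->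
  let gr := grid (reals s 16 0 0) (reals s 21 0 0) in
  (forall s', (forall f : nat -> nat -> nat, (forall r c, f r c < N) ->
     exists G U V, [/\ forall r c, r < k + k + 4 -> c < t -> G r c = f r c,
        candidate_ok (reals s 0) gr G U V &
        (fit_error (reals s 0) (reals s' 1) (reals s' 2) <= fit_error (reals s 0) U V)%R]) ->
     Q s') ->
  runs (Seq (ISetV 18 (IConst 0))
           (Search 5 6 7 8 (IAdd kk_exp (IConst 4)) (IVar 3) (IVar 4) candidate)) s
    (k + (k + k) + (k + k + 4) * t + 700) Q.
Proof.
move=> kk4B Hd Ht HN gr HQ; have [en ed ek] := Hd.
apply: (@runs_le _ _ _ B2 _ _ (0 + ((k + (k + k) + 600) + (k + k + 4) * t + 40)).+1); first by lia.
apply: (runs_seq B2); apply: runs_iset => /=.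
set s0 := iset s 18 0 0 0.
have fr0 : agree_off [:: 18] [::] s s0 by apply: agree_off_iset.
have fl0 : ints s0 18 0 0 = 0 by rewrite /= update_same.
clearbody s0.
have N0 : 0 < N by apply: leq_trans N2.
pose I m s' := (m = 0 -> ints s' 18 0 0 = 0) /\ (0 < m -> [/\ ints s' 18 0 0 = 1,
  reals s' 19 0 0 = fit_error (reals s 0) (reals s' 1) (reals s' 2) &
  forall m', m' < m -> exists G U V, [/\
     forall r c, r < k + k + 4 -> c < t -> G r c = digit N t m' r c,
     candidate_ok (reals s 0) gr G U V &
        (fit_error (reals s 0) (reals s' 1) (reals s' 2) <= fit_error (reals s 0) U V)%R]]).
apply: (@runs_search _ w B B2 5 6 7 8 (IAdd kk_exp (IConst 4)) (IVar 3) (IVar 4) N t (k + k + 4) _ _ _ _ _ _ I) => //.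
- by rewrite addnn -mul2n.
- move=> s' fr /=.
  rewrite (ints_kept 0 fr) (ints_kept 0 fr0) ek.
  rewrite (ints_kept 3 fr) (ints_kept 3 fr0) Ht.
  by rewrite (ints_kept 4 fr) (ints_kept 4 fr0) HN.
- move=> m s1 s2 fr; rewrite /I (ints_kept 18 fr).
  rewrite (reals_kept 19 fr) (reals_kept 1 fr).
  by rewrite (reals_kept 2 fr).
- move=> m s1 mN fr dg [I0 I1].
  have Hd1 : has_dims n d k s1 by apply: (has_dims_agree _ fr) (has_dims_agree _ fr0 Hd).
  apply: runs_candidate => //.
  + by rewrite (ints_kept 3 fr) (ints_kept 3 fr0).
  + by rewrite (ints_kept 4 fr) (ints_kept 4 fr0).
  move=> s2 U V fr2.
  rewrite (reals_kept 0 fr) (reals_kept 0 fr0).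
  rewrite (reals_kept 16 fr) (reals_kept 16 fr0).
  rewrite (reals_kept 21 fr) (reals_kept 21 fr0).
  rewrite -/gr => ok fl E; split=> // _.
  case: E => [[h1 h2 h3 h4 [h5 h6]]|[h1 h2 h3 h4]].
    have m0 : 0 < m by rewrite lt0n; apply/eqP => /I0 E0; move: h1; rewrite E0.
    have [J1 J2 J3] := I1 m0; rewrite h3 h4 h5 h6; split=> //.
    move=> m'; rewrite ltnS leq_eqVlt => /orP[/eqP ->|/J3 //].
    by exists (ints s1 5), U, V; split=> //; rewrite -J2.
  split=> //; first by rewrite h3 h4.
  move=> m'; rewrite ltnS leq_eqVlt => /orP[/eqP ->|m'm].
    by exists (ints s1 5), U, V; split=> //; rewrite h4.
  have [J1 J2 J3] := I1 (leq_ltn_trans (leq0n _) m'm).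
  have [G [U' [V' [g1 g2 g3]]]] := J3 m' m'm.
  exists G, U', V'; split=> //; rewrite h4; apply: le_trans g3; rewrite -J2.
  by case: h1 => //; rewrite J1.
move=> s' fr [_ I1]; apply: HQ => f fN.
have [|_ _ J] := I1; first by rewrite expn_gt0 N0.
have [m mN dm] := @exists_digits N (k + k + 4) t f N0 fN.
have [G [U [V [g1 g2 g3]]]] := J m mN.
by exists G, U, V; split=> // r c rR cC; rewrite g1 ?dm.
Qed.

End Fixed.

Lemma runs_ceil (a r m : nat) s Q :
  m <= B -> reals s r 0 0 = (m%:R)%R ->
  (forall s', agree_off [:: a] [::] s s' -> ints s' a 0 0 = m -> Q s') ->
  runs (ceil_to a r) s 5 Q.
Proof.
move=> mB rm HQ.
apply: (@runs_le _ _ _ B2 _ _ (0 + (0 + 1 + 2)).+1) => //.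
apply: (runs_seq B2); apply: runs_iset => /=.
set s0 := iset s a 0 0 0.
have fr0 : agree_off [:: a] [::] s s0 by apply: agree_off_iset.
have v0 : ints s0 a 0 0 = 0 by rewrite /= update_same.
clearbody s0.
pose I i s' := agree_off [:: a] [::] s s' /\ ints s' a 0 0 = i.
apply: (@runs_weaken _ _ _ B2 _ _ (0 + 1 + 2) _ (I m)) => //.
  by move=> s' [fr v]; apply: HQ.
apply: (runs_while B2) => //.
- move=> i s' im [fr vi]; split.
    by rewrite /= (reals_kept r fr) rm vi ler_nat -ltnNge.
  apply: runs_iset => /=; split; last by rewrite /= update_same vi addn1.
  exact: agree_off_trans fr (agree_off_iset _ _ _ _ _).
- by move=> s' [fr vi]; rewrite /= (reals_kept r fr) rm vi lexx.
Qed.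

End MainProgramSpec.

Arguments runs_ceil {R w B} B2 [a r m s Q].

(** * Parameters and specification of the whole program *)

Section AlgorithmSpec.
Local Open Scope nat_scope.
Variables (R : realType) (w : nat -> R).
Implicit Types (s : state R) (Q : state R -> Prop).

Definition bit_size (k : nat) : nat := (trunc_log 2 (k + 1)).+1.
Definition num_samples (C0 k : nat) : nat := C0 * ((k + 1) * bit_size k).
(** The rounding error of the fits is at most [51 n d^3 k^2 mu / resolution], and [mu] is at most
    [4 n d k^2] times the optimum: the fourth power makes the product a multiple of the optimum. The
    factor [num_samples] ensures that the extra [num_samples] grid points extend the grid by at most
    1 / 100. *)
Definition resolution (C0 n d k : nat) : nat := 100 * (n * (d * k)) ^ 4 * num_samples C0 k.
(** One bound for every kind of digit: indices of rows and columns, weights up to [d ^ 2], and grid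
    points covering the interval from [- 4 k] to [5 k]. The summand [num_samples] also makes it a
    bound for the loops over the sample. *)
Definition num_values (C0 n d k : nat) : nat :=
  num_samples C0 k + (9 * (k * resolution C0 n d k) + 10).

Lemma runs_prelude (C0 n d k B : nat) s Q :
  2 <= B -> bit_size k <= B -> num_values C0 n d k <= B -> has_dims n d k s ->
  (forall s', agree_off [:: 1; 2; 3; 4] [:: 16; 20; 21] s s' ->
     ints s' 3 0 0 = num_samples C0 k -> ints s' 4 0 0 = num_values C0 n d k ->
     reals s' 16 0 0 = ((resolution C0 n d k)%:R)%R -> reals s' 21 0 0 = (4 * k%:R)%R -> Q s') ->
  runs w B (prelude C0) s 100 Q.
Proof.
move=> B2 ellB NB Hd HQ; have [en ed ek] := Hd.
apply: (@runs_le _ _ _ B2 _ _ (0 + (0 + ((0 + 0).+1 + 1 + 2 + (0 + (5 + (0 + (0 + (0 + (0 + 5).+1).+1).+1).+1).+1).+1).+1).+1).+1) => //.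
apply: (runs_seq B2); apply: runs_iset; apply: (runs_seq B2); apply: runs_iset => /=.
set s1 := iset _ _ _ _ _.
have fr1 : agree_off [:: 1; 2] [::] s s1.
  by split=> // a; rewrite !inE => /norP[a12 a13]; rewrite /= !update_other.
have x1 : ints s1 1 0 0 = 1 by rewrite /= update_other // update_same.
have l1 : ints s1 2 0 0 = 0 by rewrite /= update_same.
clearbody s1.
apply: (runs_seq B2).
pose I i s' := [/\ agree_off [:: 1; 2] [::] s s', ints s' 1 0 0 = 2 ^ i & ints s' 2 0 0 = i].
apply: (@runs_weaken _ _ _ B2 _ _ ((0 + 0).+1 + 1 + 2) _ (I (bit_size k))) => //; last first.
  apply: (runs_while B2) => //.
  - move=> i s' ik [fr xi li]; split.
      rewrite /= xi (ints_kept 0 fr) ek.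
      have k0 : 0 < k + 1 by rewrite addn1.
      by apply: leq_trans (trunc_logP (isT : 1 < 2) k0); rewrite leq_exp2l.
    apply: (runs_seq B2); apply: runs_iset; apply: runs_iset => /=; split.
    + apply: agree_off_trans fr _.
      by split=> // a; rewrite !inE => /norP[a12 a13]; rewrite /= !update_other.
    + by rewrite /= update_other // update_same xi expnS mul2n addnn.
    + by rewrite /= update_same update_other // li addn1.
  - move=> s' [fr xi li]; rewrite /= xi (ints_kept 0 fr) ek -ltnNge.
    exact: trunc_log_ltn.
move=> s2 [fr2 _ ell2].
apply: (runs_seq B2); apply: runs_rset => /=.
rewrite !(ints_kept 0 fr2) ek ell2.
set s3 := rset _ _ _ _ _.
have fr3 : agree_off [::] [:: 20] s2 s3.
  by split=> // a; rewrite !inE => a1; rewrite /= !update_other.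
have e20 : reals s3 20 0 0 = ((num_samples C0 k)%:R)%R.
  by rewrite /= update_same /num_samples !natrM.
clearbody s3.
have tN : num_samples C0 k <= B by apply: leq_trans NB; rewrite leq_addr.
apply: (runs_seq B2); apply: (runs_ceil B2 tN e20) => s4 fr4 e3.
apply: (runs_seq B2); apply: runs_rset; apply: (runs_seq B2); apply: runs_rset.
apply: (runs_seq B2); apply: runs_rset; apply: (runs_seq B2); apply: runs_rset => /=.
rewrite !(ints_kept 0 fr4) !(ints_kept 0 fr3).
rewrite !(ints_kept 0 fr2) en ed ek e3.
set s5 := rset _ _ _ _ _.
have fr5 : agree_off [::] [:: 16; 20; 21] s4 s5.
  by split=> // a; rewrite !inE !negb_or => /and3P[a1 a2 a3]; rewrite /= !update_other.
have e16 : reals s5 16 0 0 = ((resolution C0 n d k)%:R)%R.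
  rewrite /= /update /= /resolution; move: (num_samples C0 k) => u.
  rewrite (natrM _ _ u) (natrM _ 100) natrX !natrM.
  by ring.
have e21 : reals s5 21 0 0 = (4 * k%:R)%R.
  by rewrite /= /update.
have e20' : reals s5 20 0 0 = ((num_values C0 n d k)%:R)%R.
  transitivity ((num_samples C0 k)%:R + (9 * (k%:R * reals s5 16 0 0) + 10))%R.
    by rewrite /= /update.
  rewrite e16 /num_values; move: (num_samples C0 k) (resolution C0 n d k) => a b.
  by rewrite (natrD _ a) (natrD _ (9 * _)) (natrM _ 9) natrM.
clearbody s5.
apply: (runs_ceil B2 NB e20') => s6 fr6 e4.
apply: HQ => //.
- apply: (agree_off_trans (s2 := s2)); first by frame_sub fr2.
  apply: (agree_off_trans (s2 := s3)); first by frame_sub fr3.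
  apply: (agree_off_trans (s2 := s4)); first by frame_sub fr4.
  by frame_both fr5 fr6.
- by rewrite (ints_kept 3 fr6) (ints_kept 3 fr5).
- by rewrite (reals_kept 16 fr6).
- by rewrite (reals_kept 21 fr6).
Qed.

Lemma num_samples_gt0 C0 k : 0 < C0 -> 0 < num_samples C0 k.
Proof. by move=> C0p; rewrite /num_samples !muln_gt0 C0p addn1. Qed.

(** The base of the step count is [N] itself, which dominates the length of every elementary
    loop. *)
Lemma runs_algorithm (C0 n d k : nat) s Q :
  0 < C0 -> 0 < n -> 0 < d -> 0 < k -> has_dims n d k s ->
  let N := num_values C0 n d k in
  let t := num_samples C0 k in
  let gr := grid ((resolution C0 n d k)%:R)%R (4 * k%:R)%R in
  (forall s', (forall f : nat -> nat -> nat, (forall r c, f r c < N) ->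
     exists G U V, [/\ forall r c, r < k + k + 4 -> c < t -> G r c = f r c,
        candidate_ok n d k t N (reals s 0) gr G U V &
        (fit_error n d k (reals s 0) (reals s' 1) (reals s' 2)
           <= fit_error n d k (reals s 0) U V)%R]) -> Q s') ->
  runs w N (algorithm C0) s (3 * k + (2 * k + 4) * t + 900) Q.
Proof.
move=> C0p np dp kp Hd N t gr HQ.
have xp : 0 < n * (d * k) by rewrite !muln_gt0 np dp.
have nx : n <= n * (d * k) by rewrite leq_pmulr // muln_gt0 dp.
have dx : d <= n * (d * k) by rewrite mulnCA leq_pmulr // muln_gt0 np.
have kx : k <= n * (d * k) by rewrite mulnA leq_pmull // muln_gt0 np.
have res : 100 * (n * (d * k)) <= resolution C0 n d k.
  rewrite /resolution -mulnA leq_mul2l /= expnS -mulnA leq_pmulr //.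
  by rewrite muln_gt0 expn_gt0 xp num_samples_gt0.
have bigN : n + d + k + k + 10 <= N.
  rewrite /N /num_values; have : resolution C0 n d k <= k * resolution C0 n d k by rewrite leq_pmull.
  move: res nx dx kx; move: (n * (d * k)) (resolution C0 n d k) (num_samples C0 k) (k * _) => x y z u.
  by lia.
clear res nx dx kx xp.
have N2 : 2 <= N by lia.
have ellN : bit_size k <= N.
  have := trunc_logP (isT : 1 < 2) (_ : 0 < k + 1); rewrite addn1 => /(_ isT).
  have := ltn_expl (trunc_log 2 k.+1) (isT : 1 < 2); rewrite /bit_size addn1.
  by move: bigN; lia.
apply: (@runs_le _ w N N2 _ _ (100 + (k + (k + k) + (k + k + 4) * t + 700)).+1); first by lia.
apply: (runs_seq N2); apply: (runs_prelude N2 ellN (leqnn N) Hd) => s1 fr1 e3 e4 e16 e21.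
apply: (@runs_search_candidates _ w N N2 n d k t N) => //.
- by lia.
- by lia.
- by lia.
- by rewrite /t /N /num_values leq_addr.
- by lia.
- exact: has_dims_agree fr1 Hd.
move=> s' H; apply: HQ => f fN.
by have := H f fN; rewrite e16 e21 (reals_kept 0 fr1).
Qed.

End AlgorithmSpec.

(** * Sparsification in the l1 norm *)

Section LewisWeights.
Variable R : realType.
Implicit Types (D m : nat).

(** The orthogonal projection onto the row space, written with a row base so that the Gram matrix is
    invertible even when [X] is rank deficient. *)
Definition row_proj D m (X : 'M[R]_(D, m)) : 'M[R]_m :=
  let B := row_base X in B^T *m invmx (B *m B^T) *m B.

Lemma sqr_sum_eq0 m (v : 'rV[R]_m) : v *m v^T = 0 -> v = 0.
Proof.
move=> /matrixP /(_ ord0 ord0); rewrite !mxE => /eqP.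
rewrite psumr_eq0 => [/allP H|j _]; last by rewrite mxE -expr2 sqr_ge0.
apply/rowP => j; rewrite mxE; apply/eqP; have := H j (mem_index_enum j).
by rewrite mxE mulf_eq0 orbb.
Qed.

Lemma gram_unit D m (X : 'M[R]_(D, m)) :
  row_base X *m (row_base X)^T \in unitmx.
Proof.
set B := row_base X; rewrite -row_free_unit -kermx_eq0; apply/rowV0P => u /sub_kermxP uG.
have uB : u *m B = 0.
  by apply: sqr_sum_eq0; rewrite trmx_mul mulmxA -(mulmxA u) uG mul0mx.
by apply: (row_free_inj (row_base_free X)); rewrite uB mul0mx.
Qed.

Lemma row_proj_sym D m (X : 'M[R]_(D, m)) : (row_proj X)^T = row_proj X.
Proof.
by rewrite /row_proj; move: (row_base X) => B; rewrite !trmx_mul trmx_inv trmx_mul !trmxK mulmxA.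
Qed.

Lemma base_row_proj D m (X : 'M[R]_(D, m)) : row_base X *m row_proj X = row_base X.
Proof. by rewrite /row_proj !mulmxA mulmxV ?gram_unit // mul1mx. Qed.

Lemma mul_row_proj D m (X : 'M[R]_(D, m)) : X *m row_proj X = X.
Proof. by rewrite -{1}(mulmx_base X) -mulmxA base_row_proj mulmx_base. Qed.

Lemma row_proj_idem D m (X : 'M[R]_(D, m)) : row_proj X *m row_proj X = row_proj X.
Proof.
rewrite [X in X *m _]/row_proj -[LHS]mulmxA; congr (_ *m _); exact: base_row_proj.
Qed.

Lemma row_proj_factor D m (X : 'M[R]_(D, m)) : exists Z, row_proj X = Z *m X.
Proof.
have /submxP[Y HY] : (row_base X <= X)%MS by rewrite eq_row_base.
set B := row_base X in HY; exists (B^T *m invmx (B *m B^T) *m Y).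
by rewrite -[RHS]mulmxA -HY.
Qed.

Lemma row_proj_trace D m (X : 'M[R]_(D, m)) : \tr (row_proj X) <= D%:R.
Proof.
rewrite /row_proj -mulmxA mxtrace_mulC -mulmxA mulVmx ?gram_unit // mxtrace1.
by rewrite ler_nat rank_leq_row.
Qed.

Lemma row_proj_diag D m (X : 'M[R]_(D, m)) j :
  row_proj X j j = \sum_i (row_proj X i j) ^+ 2.
Proof.
rewrite -{1}row_proj_idem mxE; apply: eq_bigr => i _.
by rewrite expr2 -{1}row_proj_sym mxE.
Qed.

Definition scaled D m (V : 'M[R]_(D, m)) (w : 'I_m -> R) : 'M[R]_(D, m) :=
  \matrix_(r, j) (V r j / Num.sqrt (w j)).

(** The leverage score of column [j] after scaling by [w ^ (-1/2)]. Exact l1 Lewis weights are the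
    solutions of [leverage V w j = w j]. *)
Definition leverage D m (V : 'M[R]_(D, m)) (w : 'I_m -> R) (j : 'I_m) : R :=
  row_proj (scaled V w) j j.

Lemma leverage_ge0 D m (V : 'M[R]_(D, m)) w j : 0 <= leverage V w j.
Proof. by rewrite /leverage row_proj_diag sumr_ge0 // => i _; rewrite sqr_ge0. Qed.

(** The projection fixes the scaled matrix; undoing the scaling gives coefficients that express V
    through its own columns. *)
Definition lewis_coef D m (V : 'M[R]_(D, m)) w (i j : 'I_m) : R :=
  row_proj (scaled V w) i j * Num.sqrt (w j) / Num.sqrt (w i).

Lemma lewis_coef_repr D m (V : 'M[R]_(D, m)) w r j : (forall j, 0 < w j) ->
  V r j = \sum_i V r i * lewis_coef V w i j.
Proof.
move=> w0; have s0 i : Num.sqrt (w i) != 0 by rewrite gt_eqF // sqrtr_gt0.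
have /matrixP /(_ r j) := mul_row_proj (scaled V w); rewrite !mxE => E.
rewrite -[LHS](divfK (s0 j)) -E mulr_suml; apply: eq_bigr => i _.
by rewrite mxE /lewis_coef; field.
Qed.

Lemma lewis_coef_sum D m (V : 'M[R]_(D, m)) w j : (forall j, 0 < w j) ->
  \sum_i w i * lewis_coef V w i j ^+ 2 = w j * leverage V w j.
Proof.
move=> w0; rewrite /leverage row_proj_diag mulr_sumr; apply: eq_bigr => i _.
have s0 : Num.sqrt (w i) != 0 by rewrite gt_eqF // sqrtr_gt0.
rewrite -[w i in LHS](sqr_sqrtr (ltW (w0 i))) -[w j in RHS](sqr_sqrtr (ltW (w0 j))).
by rewrite /lewis_coef; field.
Qed.

(* w j * leverage is the least w-weighted energy of a representation of column j
   as a combination of all columns, hence it is monotone in w. *)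
Lemma leverage_min D m (V : 'M[R]_(D, m)) w j (a : 'I_m -> R) : (forall j, 0 < w j) ->
  (forall r, V r j = \sum_i V r i * a i) ->
  w j * leverage V w j <= \sum_i w i * a i ^+ 2.
Proof.
move=> w0 Ha; have s0 i : Num.sqrt (w i) != 0 by rewrite gt_eqF // sqrtr_gt0.
set X := scaled V w; set P := row_proj X.
pose b : 'cV[R]_m := \col_i (Num.sqrt (w i) * a i).
have Xb : X *m b = Num.sqrt (w j) *: col j X.
  apply/colP => r; rewrite !mxE [RHS]mulrC divfK // Ha.
  by apply: eq_bigr => i _; rewrite !mxE; field.
have Pb : P *m b = Num.sqrt (w j) *: col j P.
  have [Z EZ] := row_proj_factor X.
  by rewrite /P EZ -mulmxA Xb -scalemxAr !colE mulmxA.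
have -> : \sum_i w i * a i ^+ 2 = \sum_i b i ord0 ^+ 2.
  by apply: eq_bigr => i _; rewrite mxE exprMn sqr_sqrtr // ltW.
have -> : w j * leverage V w j = \sum_i (P *m b) i ord0 ^+ 2.
  rewrite Pb /leverage row_proj_diag mulr_sumr; apply: eq_bigr => i _.
  by rewrite !mxE exprMn sqr_sqrtr // ltW.
have sq (x : 'cV[R]_m) : \sum_i x i ord0 ^+ 2 = (x^T *m x) ord0 ord0.
  by rewrite mxE; apply: eq_bigr => i _; rewrite mxE expr2.
have : 0 <= \sum_i (b - P *m b) i ord0 ^+ 2 by apply: sumr_ge0 => i _; apply: sqr_ge0.
suff -> : \sum_i (b - P *m b) i ord0 ^+ 2 =
    \sum_i b i ord0 ^+ 2 - \sum_i (P *m b) i ord0 ^+ 2 by rewrite subr_ge0.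
rewrite !sq; have PT : P^T = P by apply: row_proj_sym.
have PP : P *m P = P by apply: row_proj_idem.
have E1 : (P *m b)^T *m (P *m b) = b^T *m (P *m b).
  by rewrite trmx_mul PT -mulmxA (mulmxA P) PP.
have E2 : (P *m b)^T *m b = b^T *m (P *m b) by rewrite trmx_mul PT mulmxA.
have -> : (b - P *m b)^T = b^T - (P *m b)^T by apply/matrixP => ? ?; rewrite !mxE.
by rewrite mulmxBl !mulmxBr E1 E2 subrr subr0 mxE [X in _ + X]mxE.
Qed.

Lemma leverage_mono D m (V : 'M[R]_(D, m)) w w' c j :
  (forall j, 0 < w j) -> (forall j, 0 < w' j) -> (forall j, w j <= c * w' j) ->
  w j * leverage V w j <= c * (w' j * leverage V w' j).
Proof.
move=> w0 w'0 ww'; rewrite -(lewis_coef_sum V j w'0) mulr_sumr.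
apply: (le_trans (leverage_min w0 (fun r => lewis_coef_repr V r j w'0))).
by apply: ler_sum => i _; rewrite mulrA ler_wpM2r // sqr_ge0.
Qed.

(** A fixed point of the square root of this map is a Lewis weight, up to the term 1 / m. That term
    keeps the weights of zero columns positive and adds only 1 to the total leverage. *)
Definition lewis_map D m (V : 'M[R]_(D, m)) w (j : 'I_m) : R :=
  w j * (leverage V w j + m%:R^-1).

Lemma lewis_map_gt0 D m (V : 'M[R]_(D, m)) w j : 0 < w j -> 0 < lewis_map V w j.
Proof.
move=> w0; rewrite mulr_gt0 // ltr_wpDl ?leverage_ge0 // invr_gt0 ltr0n.
exact: leq_ltn_trans (ltn_ord j).
Qed.

Lemma lewis_map_mono D m (V : 'M[R]_(D, m)) w w' c j :
  (forall j, 0 < w j) -> (forall j, 0 < w' j) -> (forall j, w j <= c * w' j) ->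
  lewis_map V w j <= c * lewis_map V w' j.
Proof.
move=> w0 w'0 ww'; rewrite /lewis_map !mulrDr; apply: lerD; first exact: leverage_mono.
by rewrite mulrA ler_wpM2r // invr_ge0.
Qed.

(* One step w -> sqrt (lewis_map w) takes the square root of the distortion,
   because lewis_map is monotone and homogeneous of degree 1. *)
Lemma approx_lewis_step D m (V : 'M[R]_(D, m)) w c : 0 <= c ->
  (forall j, 0 < w j) ->
  (forall j, w j ^+ 2 <= c * lewis_map V w j /\ lewis_map V w j <= c * w j ^+ 2) ->
  exists w', (forall j, 0 < w' j) /\
  (forall j, w' j ^+ 2 <= Num.sqrt c * lewis_map V w' j /\
             lewis_map V w' j <= Num.sqrt c * w' j ^+ 2).
Proof.
move=> c0 w0 H; pose w' j := Num.sqrt (lewis_map V w j).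
have w'0 j : 0 < w' j by rewrite sqrtr_gt0 lewis_map_gt0.
have sq j : w' j ^+ 2 = lewis_map V w j by rewrite sqr_sqrtr // ltW // lewis_map_gt0.
have up j : w' j <= Num.sqrt c * w j.
  rewrite /w'.
  have -> : Num.sqrt c * w j = Num.sqrt (c * w j ^+ 2).
    by rewrite sqrtrM // sqrtr_sqr gtr0_norm.
  by rewrite ler_wsqrtr //; have [] := H j.
have dn j : w j <= Num.sqrt c * w' j.
  have -> : w j = Num.sqrt (w j ^+ 2) by rewrite sqrtr_sqr gtr0_norm.
  by rewrite /w' -sqrtrM // ler_wsqrtr //; have [] := H j.
exists w'; split=> // j; rewrite sq; split; exact: lewis_map_mono.
Qed.

(** The weights 1 have some finite distortion [c], and [i] square roots bring any [c <= 2 ^ (2 ^ i)]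
    down to 2. *)
Lemma approx_lewis D m (V : 'M[R]_(D, m)) :
  exists w, (forall j, 0 < w j) /\
  (forall j, w j ^+ 2 <= 2 * lewis_map V w j /\ lewis_map V w j <= 2 * w j ^+ 2).
Proof.
have step i : forall c w, 0 <= c -> c <= 2 ^+ (2 ^ i) -> (forall j, 0 < w j) ->
  (forall j, w j ^+ 2 <= c * lewis_map V w j /\ lewis_map V w j <= c * w j ^+ 2) ->
  exists w, (forall j, 0 < w j) /\
  (forall j, w j ^+ 2 <= 2 * lewis_map V w j /\ lewis_map V w j <= 2 * w j ^+ 2).
  elim: i => [|i IH] c w c0 c2 w0 H.
    rewrite expn0 expr1 in c2.
    exists w; split=> // j; have [H1 H2] := H j; split.
      by apply: le_trans H1 _; rewrite ler_wpM2r // ltW // lewis_map_gt0.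
    by apply: le_trans H2 _; rewrite ler_wpM2r // sqr_ge0.
  have [w' [w'0 H']] := approx_lewis_step c0 w0 H.
  apply: (IH (Num.sqrt c) w') => //.
  have -> : 2 ^+ (2 ^ i) = Num.sqrt (2 ^+ (2 ^ i.+1)) :> R.
    by rewrite expnS mulnC exprM sqrtr_sqr ger0_norm // exprn_ge0.
  exact: ler_wsqrtr.
pose w1 := fun _ : 'I_m => 1 : R.
have w10 j : 0 < w1 j by [].
pose c := \sum_j (lewis_map V w1 j + (lewis_map V w1 j)^-1).
have psi0 j : 0 < lewis_map V w1 j by apply: lewis_map_gt0.
have t0 j : 0 <= lewis_map V w1 j + (lewis_map V w1 j)^-1.
  by rewrite addr_ge0 // ?invr_ge0 ltW.
have cj j : lewis_map V w1 j + (lewis_map V w1 j)^-1 <= c.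
  by rewrite /c (bigD1 j) //= lerDl sumr_ge0.
have c0 : 0 <= c by rewrite /c sumr_ge0.
pose i := Num.bound c.
have ci : c <= 2 ^+ (2 ^ i).
  have := archi_boundP c0; rewrite -/i => /ltW/le_trans; apply.
  rewrite -natrX ler_nat; apply: leq_trans (ltnW (ltn_expl i (isT : (1 < 2)%N))) _.
  exact: ltnW (ltn_expl _ _).
apply: (step i c w1) => // j; rewrite expr1n mulr1; split.
  rewrite -ler_pdivrMr // div1r; apply: le_trans (cj j).
  by rewrite lerDr ltW.
by apply: le_trans (cj j); rewrite lerDl invr_ge0 ltW.
Qed.

(** The weights sum to at most [4 D], because leverages sum to the rank; hence at most [m / 4] of
    them exceed [16 D / m]. For a light column [j] the square of the coefficient is at most
    [(16 D / m) / w i] times the squared projection entry, and these entries sum to the leverage of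
    [i], at most [2 * w i]. *)
Lemma light_columns D m (V : 'M[R]_(D, m)) : (0 < D)%N -> (0 < m)%N ->
  exists (L : {set 'I_m}) (c : 'I_m -> 'I_m -> R), [/\ (4 * #|~: L| <= m)%N,
    forall r j, V r j = \sum_i V r i * c i j &
    forall i, \sum_(j in L) c i j ^+ 2 <= 32 * D%:R / m%:R].
Proof.
move=> D0 m0; have [w [w0 Hw]] := approx_lewis V.
have m0' : 0 < m%:R :> R by rewrite ltr0n.
have w_le j : w j <= 2 * (leverage V w j + m%:R^-1).
  have [H _] := Hw j; rewrite -(ler_pM2l (w0 j)) -expr2; apply: le_trans H _.
  by rewrite /lewis_map mulrCA.
have lev_le j : leverage V w j <= 2 * w j.
  have [_ H] := Hw j; rewrite -(ler_pM2l (w0 j)) mulrCA -expr2; apply: le_trans H.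
  by rewrite /lewis_map ler_pM2l // lerDl invr_ge0 ltW.
have sum_w : \sum_j w j <= 4 * D%:R.
  apply: (@le_trans _ _ (\sum_j 2 * (leverage V w j + m%:R^-1))); first exact: ler_sum.
  rewrite -mulr_sumr big_split /= sumr_const card_ord -[_ *+ m]mulr_natr mulVf ?gt_eqF //.
  have : \sum_j leverage V w j <= D%:R := row_proj_trace _.
  have : 1 <= D%:R :> R by rewrite ler1n.
  by lra.
pose th : R := 16 * D%:R / m%:R.
have th0 : 0 < th by rewrite !mulr_gt0 // ?invr_gt0 // ltr0n.
exists [set j | w j <= th]%SET, (lewis_coef V w); split.
- have : th * (#|~: [set j | w j <= th]%SET|)%:R <= 4 * D%:R.
    apply: le_trans sum_w; rewrite (bigID (fun j => w j <= th)) /=.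
    apply: (@le_trans _ _ (\sum_(j | ~~ (w j <= th)) w j)); last first.
      by rewrite lerDr sumr_ge0 // => j _; rewrite ltW.
    rewrite mulr_natr -sumr_const; set S := ~: _.
    rewrite [X in X <= _](eq_bigl (fun j => ~~ (w j <= th))); last by move=> j; rewrite !inE.
    by apply: ler_sum => j; rewrite -ltNge => /ltW.
  rewrite /th mulrAC ler_pdivrMr // -mulrA -[4 * _ * _]mulrA -(@ler_nat R) natrM => H.
  have D0' : 0 < D%:R :> R by rewrite ltr0n.
  rewrite -(ler_pM2l D0').
  by lra.
- by move=> r j; apply: lewis_coef_repr.
- move=> i; have wi := w0 i.
  apply: (@le_trans _ _ (\sum_j th / w i * row_proj (scaled V w) i j ^+ 2)).
    rewrite big_mkcond /=; apply: ler_sum => j _; rewrite inE; case: ifP => [wj|_]; last first.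
      by rewrite mulr_ge0 ?sqr_ge0 // divr_ge0 ?(ltW th0) ?(ltW wi).
    rewrite /lewis_coef !exprMn exprVn !(sqr_sqrtr (ltW (w0 _))).
    rewrite [X in X <= _](_ : _ = w j / w i * row_proj (scaled V w) i j ^+ 2); last by ring.
    by rewrite ler_wpM2r ?sqr_ge0 // ler_wpM2r // invr_ge0 (ltW wi).
  rewrite -mulr_sumr.
  have -> : \sum_j row_proj (scaled V w) i j ^+ 2 = leverage V w i.
    rewrite /leverage row_proj_diag; apply: eq_bigr => j _.
    by rewrite -{1}row_proj_sym mxE.
  have H : (w i)^-1 * leverage V w i <= 2 by rewrite ler_pdivrMl // mulrC.
  rewrite -mulrA; apply: (@le_trans _ _ (th * 2)); first by rewrite ler_pM2l.
  by rewrite /th; lra.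
Qed.

End LewisWeights.

(** * Averages over random signs, as finite sums *)

Section SignAverages.
Variable R : realType.
Implicit Types (m : nat).

Local Notation signs m := {ffun 'I_m -> bool}.
Definition sgn m (e : signs m) (j : 'I_m) : R := (-1) ^+ e j.

(** The subgaussian bound cosh x <= exp (x^2 / 2) with a weaker constant. Up to 1/2 it follows from
    e^x <= 1 / (1 - x) and e^(-x) <= 1 / (1 + x); beyond 1/2 one has x <= 2 x^2. *)
Lemma exp_pair_le (x : R) : expR x + expR (- x) <= 2 * expR (2 * x ^+ 2).
Proof.
wlog x0 : x / 0 <= x.
  move=> H; have [/H //|/ltW x0] := lerP 0 x.
  by have := H (- x); rewrite oppr_ge0 opprK sqrrN addrC; apply.
have [x2|x2] := lerP x (1 / 2).
  have e1 : expR (- x) <= 1 - x + 2 * x ^+ 2.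
    have e0 : 0 < expR x := expR_gt0 x.
    have := expR_ge1Dx x => H1.
    rewrite expRN -[_^-1]mul1r ler_pdivrMr //.
    apply: (@le_trans _ _ ((1 - x + 2 * x ^+ 2) * (1 + x))); first by nra.
    by rewrite ler_wpM2l //; nra.
  have e2 : expR x <= 1 + x + 2 * x ^+ 2.
    have e0 : 0 < expR (- x) := expR_gt0 (- x).
    have := expR_ge1Dx (- x) => H1.
    rewrite -[x in expR x]opprK expRN -[_^-1]mul1r ler_pdivrMr //.
    apply: (@le_trans _ _ ((1 + x + 2 * x ^+ 2) * (1 - x))); first by nra.
    by rewrite ler_wpM2l //; nra.
  have := expR_ge1Dx (2 * x ^+ 2); lra.
have e1 : expR (- x) <= expR (2 * x ^+ 2) by rewrite ler_expR; nra.
have e2 : expR x <= expR (2 * x ^+ 2) by rewrite ler_expR; nra.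
lra.
Qed.

(** Independence of the signs: the sum over all sign vectors factors into two-term sums. *)
Lemma sum_exp_signs m (a : 'I_m -> R) :
  \sum_(e : signs m) expR (\sum_j sgn e j * a j) <=
  2 ^+ m * expR (2 * \sum_j a j ^+ 2).
Proof.
have -> : \sum_(e : signs m) expR (\sum_j sgn e j * a j) =
    \prod_(j < m) \sum_(b : bool) expR ((-1) ^+ b * a j).
  rewrite bigA_distr_bigA /=; apply: eq_bigr => e _.
  by rewrite expR_sum; apply: eq_bigr.
rewrite mulr_sumr expR_sum -[m in 2 ^+ m]card_ord -prodr_const -big_split /=.
apply: ler_prod => j _; apply/andP; split.
  by apply: sumr_ge0 => b _; apply: expR_ge0.
by rewrite big_bool /= expr1 expr0 mulN1r mul1r addrC exp_pair_le.
Qed.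

Definition flip m (j : 'I_m) (e : signs m) : signs m :=
  [ffun i => if i == j then ~~ e i else e i].

Lemma flipK m (j : 'I_m) : involutive (flip j).
Proof. by move=> e; apply/ffunP => i; rewrite !ffunE; case: eqP => // _; rewrite negbK. Qed.

Lemma sum_flip m (j : 'I_m) (F : signs m -> R) :
  \sum_e F e = 2^-1 * \sum_e (F e + F (flip j e)).
Proof.
rewrite big_split /= [X in _ + X](_ : _ = \sum_e F e); first by field.
by rewrite [RHS](reindex_inj (inv_inj (flipK j))).
Qed.

(* Contraction principle without suprema: removing one absolute value costs
   nothing if the family may be permuted, since for a pair y, y' attached to
   signs +, - one has |y j| - |y' j| <= max (y j - y' j) (y' j - y j). *)
Lemma contraction_step m (T : Type) (h : 'I_m -> T -> R) (g : T -> R) (j : 'I_m)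
    (Y : signs m -> T) :
  exists Z : signs m -> T, (forall e, exists e', Z e = Y e') /\
    \sum_e (\sum_(i | i != j) sgn e i * h i (Y e) + sgn e j * `|g (Y e)|) <=
    \sum_e (\sum_(i | i != j) sgn e i * h i (Z e) + sgn e j * g (Z e)).
Proof.
pose pos (e : signs m) := if e j then flip j e else e.
pose neg (e : signs m) := if e j then e else flip j e.
have fj e : flip j e j = ~~ e j by rewrite ffunE eqxx.
have posf e : pos (flip j e) = pos e by rewrite /pos fj; case: (e j); rewrite ?flipK.
have negf e : neg (flip j e) = neg e by rewrite /neg fj; case: (e j); rewrite ?flipK.
pose c e := g (Y (pos e)) < g (Y (neg e)).
pose Z e := if c e then Y (flip j e) else Y e.
exists Z; split; first by move=> e; rewrite /Z; case: ifP => _; eexists.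
rewrite (sum_flip j) [leRHS](sum_flip j) ler_pM2l ?invr_gt0 //.
apply: ler_sum => e _.
have off y : \sum_(i | i != j) sgn (flip j e) i * h i y = \sum_(i | i != j) sgn e i * h i y.
  by apply: eq_bigr => i ij; rewrite /sgn ffunE (negbTE ij).
have cf : c (flip j e) = c e by rewrite /c posf negf.
rewrite !off /Z cf flipK /c /pos /neg /sgn fj.
have abs_lt (x y : R) : x < y -> `|x| - `|y| <= y - x.
  by move=> xy; apply: le_trans (lerB_dist _ _) _; rewrite distrC ger0_norm ?lexx // subr_ge0 ltW.
have abs_ge (x y : R) : y <= x -> `|x| - `|y| <= x - y.
  by move=> xy; apply: le_trans (lerB_dist _ _) _; rewrite ger0_norm ?lexx // subr_ge0.
case: (e j) => /=; rewrite expr1 expr0 !mulN1r !mul1r.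
  by case: ltrP => [/abs_lt|/abs_ge] H; lra.
by case: ltrP => [/abs_lt|/abs_ge] H; lra.
Qed.

(** The absolute values are removed one coordinate at a time. Each new family only selects among the
    values of the old one, so a bound common to all [Y e] passes to all [Z e]. *)
Lemma contraction m (T : Type) (f : T -> 'I_m -> R) (Y : signs m -> T) :
  exists Z : signs m -> T, (forall e, exists e', Z e = Y e') /\
    \sum_e \sum_j sgn e j * `|f (Y e) j| <= \sum_e \sum_j sgn e j * f (Z e) j.
Proof.
suff H (s : seq 'I_m) : exists Z : signs m -> T, (forall e, exists e', Z e = Y e') /\
    \sum_e \sum_j sgn e j * `|f (Y e) j| <=
    \sum_e \sum_j sgn e j * (if j \in s then f (Z e) j else `|f (Z e) j|).
  have [Z [HZ le_sum]] := H (enum 'I_m); exists Z; split=> //; apply: le_trans le_sum _.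
  by rewrite le_eqVlt; apply/orP; left; apply/eqP; apply: eq_bigr => e _;
     apply: eq_bigr => j _; rewrite mem_enum.
elim: s => [|j s [Z [HZ le_sum]]].
  exists Y; split; first by move=> e; exists e.
  by rewrite le_eqVlt; apply/orP; left; apply/eqP; apply: eq_bigr.
have [js|js] := boolP (j \in s).
  exists Z; split=> //; apply: le_trans le_sum _; apply: ler_sum => e _; apply: ler_sum => i _.
  by rewrite inE; case: eqP => [->|_] //=; rewrite js.
pose h i y := if i \in s then f y i else `|f y i|.
have [Z' [HZ' le_sum']] := contraction_step h (fun y => f y j) j Z.
exists Z'; split.
  by move=> e; have [e' ->] := HZ' e; have [e'' ->] := HZ e'; exists e''.
apply: le_trans le_sum _.
rewrite [leLHS](_ : _ = \sum_e (\sum_(i | i != j) sgn e i * h i (Z e) + sgn e j * `|f (Z e) j|)); last first.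
  by apply: eq_bigr => e _; rewrite (bigD1 j) //= (negbTE js) addrC.
apply: le_trans le_sum' _; rewrite le_eqVlt; apply/orP; left; apply/eqP.
apply: eq_bigr => e _; rewrite [RHS](bigD1 j) //= mem_head addrC; congr (_ + _).
by apply: eq_bigr => i ij; rewrite inE (negbTE ij).
Qed.

(** A smooth majorant of the absolute value, suited to maxima over many [g]. It is [1 + y <= e^y] at
    [y = lam * |g| - kap]. *)
Lemma exp_bound (lam kap g : R) : 0 < lam ->
  `|g| <= lam^-1 * (kap - 1 + (expR (lam * g - kap) + expR (- (lam * g) - kap))).
Proof.
move=> l0; rewrite ler_pdivlMl //.
have e1 := expR_ge1Dx (lam * g - kap); have e2 := expR_ge1Dx (- (lam * g) - kap).
have p1 := expR_gt0 (lam * g - kap); have p2 := expR_gt0 (- (lam * g) - kap).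
have [g0|g0] := ger0P g; lra.
Qed.

(** Adding the exponentials of all [i] gives one majorant of the maximum. The value of [kap] makes
    their sum at most 1 on average over the signs, which the [- 1] of [exp_bound] compensates. *)
Lemma sum_max_le m n (c : 'I_n -> 'I_m -> R) (s lam : R) : 0 < lam -> (0 < n)%N ->
  (forall i, \sum_j c i j ^+ 2 <= s) ->
  exists G : signs m -> R,
    (forall e i, `|\sum_j sgn e j * c i j| <= G e) /\
    \sum_e G e <= 2 ^+ m * (ln (2 * n%:R) + 2 * lam ^+ 2 * s) / lam.
Proof.
move=> l0 n0 Hc; set kap := ln (2 * n%:R) + 2 * lam ^+ 2 * s.
pose g e i := \sum_j sgn e j * c i j.
pose t e i := expR (lam * g e i - kap) + expR (- (lam * g e i) - kap).
have t0 e i : 0 <= t e i by rewrite addr_ge0 // expR_ge0.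
exists (fun e => lam^-1 * (kap - 1 + \sum_i t e i)); split.
  move=> e i; apply: le_trans (exp_bound kap _ l0) _.
  rewrite ler_pM2l ?invr_gt0 // lerD2l -/(t e i).
  by rewrite (bigD1 i) //= lerDl sumr_ge0.
rewrite -mulr_sumr mulrC ler_pM2r ?invr_gt0 // big_split /= sumr_const.
have -> : #|{: signs m}| = (2 ^ m)%N by rewrite card_ffun card_bool card_ord.
rewrite -[_ *+ _]mulr_natr natrX.
suff : \sum_e \sum_i t e i <= 2 ^+ m by rewrite mulrBl mul1r; lra.
rewrite exchange_big /=.
have bound (sg : R) i : sg ^+ 2 = 1 ->
   \sum_e expR (sg * (lam * g e i) - kap) <= 2 ^+ m / (2 * n%:R).
  move=> sg2.
  have -> : \sum_e expR (sg * (lam * g e i) - kap) =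
     expR (- kap) * \sum_(e : signs m) expR (\sum_j sgn e j * (sg * lam * c i j)).
    rewrite mulr_sumr; apply: eq_bigr => e _; rewrite expRD mulrC; congr (_ * expR _).
    rewrite /g !mulr_sumr; apply: eq_bigr => j _; by ring.
  apply: (@le_trans _ _ (expR (- kap) * (2 ^+ m * expR (2 * lam ^+ 2 * s)))).
    rewrite ler_pM2l ?expR_gt0 //; apply: le_trans (sum_exp_signs _) _.
    rewrite ler_pM2l ?exprn_gt0 // ler_expR.
    have -> : \sum_j (sg * lam * c i j) ^+ 2 = lam ^+ 2 * \sum_j c i j ^+ 2.
      by rewrite mulr_sumr; apply: eq_bigr => j _; rewrite !exprMn sg2; ring.
    by rewrite mulrA ler_pM2l // mulr_gt0 // exprn_gt0.
  have n0' : 0 < 2 * n%:R :> R by rewrite mulr_gt0 // ltr0n.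
  have -> : expR (- kap) = (2 * n%:R)^-1 * (expR (2 * lam ^+ 2 * s))^-1.
    by rewrite /kap opprD expRD !expRN lnK.
  have E0 := expR_gt0 (2 * lam ^+ 2 * s).
  rewrite le_eqVlt; apply/orP; left; apply/eqP; field.
  by rewrite (gt_eqF E0) pnatr_eq0 -lt0n n0.
apply: (@le_trans _ _ (\sum_(i < n) (2 ^+ m / (2 * n%:R) + 2 ^+ m / (2 * n%:R)))).
  apply: ler_sum => i _; rewrite /t big_split /=; apply: lerD.
    apply: le_trans (bound 1 i (expr1n _ _)); apply: ler_sum => e _.
    by rewrite mul1r.
  have s1 : (-1 : R) ^+ 2 = 1 by rewrite sqrrN expr1n.
  by apply: le_trans (bound (-1) i s1); apply: ler_sum => e _; rewrite mulN1r.
rewrite sumr_const card_ord -[_ *+ n]mulr_natr.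
have n0' : n%:R != 0 :> R by rewrite pnatr_eq0 -lt0n.
by rewrite le_eqVlt; apply/orP; left; apply/eqP; field.
Qed.

End SignAverages.

(** * Discarding a fixed proportion of the columns *)

Section Halving.
Variable R : realType.
Implicit Types (D m : nat).

Definition col_mass D m (V : 'M[R]_(D, m)) (u : 'rV[R]_D) (j : 'I_m) : R :=
  `|(u *m V) ord0 j|.

(** If every sign vector had a violating [u], choose one for each, of norm 1. Contraction removes
    the absolute values, and V = V c bounds the remaining linear form by the largest signed sum of a
    row of [c], which is at most [kap] on average. The factor 2 in the hypothesis is there because
    violations of the two signs are averaged separately. *)
Lemma sign_discrepancy D m (V : 'M[R]_(D, m)) (L : {set 'I_m}) (c : 'I_m -> 'I_m -> R)
    (s lam del : R) :
  0 < lam -> (0 < m)%N ->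
  (forall r j, V r j = \sum_i V r i * c i j) ->
  (forall i, \sum_(j in L) c i j ^+ 2 <= s) ->
  2 * ((ln (2 * m%:R) + 2 * lam ^+ 2 * s) / lam) <= del ->
  exists e : {ffun 'I_m -> bool}, forall u : 'rV[R]_D,
    `|\sum_(j in L) sgn R e j * col_mass V u j| <= del * \sum_j col_mass V u j.
Proof.
move=> l0 m0 Hc Hs Hdel; set kap := _ / lam in Hdel.
pose y (u : 'rV[R]_D) j := (u *m V) ord0 j.
pose nrm u := \sum_j col_mass V u j.
pose cL i j := if j \in L then c i j else 0.
have HcL i : \sum_j cL i j ^+ 2 <= s.
  rewrite (le_trans _ (Hs i)) // [leRHS]big_mkcond /=; apply: ler_sum => j _.
  by rewrite /cL; case: ifP => // _; rewrite expr0n.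
have [G [G1 G2]] := sum_max_le l0 m0 HcL.
pose f u j := if j \in L then y u j else 0.
have yc u j : y u j = \sum_i y u i * c i j.
  rewrite /y mxE.
  under eq_bigr => r _ do rewrite Hc mulr_sumr.
  rewrite exchange_big /=; apply: eq_bigr => i _; rewrite mxE mulr_suml.
  by apply: eq_bigr => r _; rewrite mulrA.
have lin u e : \sum_j sgn R e j * f u j <= G e * nrm u.
  have -> : \sum_j sgn R e j * f u j = \sum_i y u i * \sum_j sgn R e j * cL i j.
    under [RHS]eq_bigr do rewrite mulr_sumr.
    rewrite exchange_big /=; apply: eq_bigr => j _; rewrite /f /cL.
    case: ifP => _; last by rewrite mulr0 big1 // => i _; rewrite !mulr0.
    rewrite yc mulr_sumr; apply: eq_bigr => i _; by rewrite mulrCA.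
  rewrite mulrC mulr_suml; apply: ler_sum => i _; apply: le_trans (ler_norm _) _.
  by rewrite normrM ler_wpM2l.
apply/not_existsP => Hno.
have /choice [u Hu] : forall e, exists u, nrm u = 1 /\
    del < `|\sum_(j in L) sgn R e j * col_mass V u j|.
  move=> e; have /existsNP [u /negP] := Hno e; rewrite -ltNge -/(nrm u) => Hu.
  have n0 : 0 <= nrm u by apply: sumr_ge0 => j _; exact: normr_ge0.
  have abs_le : `|\sum_(j in L) sgn R e j * col_mass V u j| <= nrm u.
    apply: le_trans (ler_norm_sum _ _ _) _; rewrite big_mkcond /=; apply: ler_sum => j _.
    case: ifP => _; last exact: normr_ge0.
    by rewrite normrM /sgn normrX normrN1 expr1n mul1r normr_id.
  have n1 : 0 < nrm u.
    rewrite lt_neqAle n0 andbT; apply/eqP => E.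
    by move: Hu; rewrite -E mulr0 ltNge; rewrite -E in abs_le; rewrite abs_le.
  have sc j : col_mass V ((nrm u)^-1 *: u) j = (nrm u)^-1 * col_mass V u j.
    by rewrite /col_mass -scalemxAl mxE normrM ger0_norm // invr_ge0.
  exists ((nrm u)^-1 *: u); split.
    rewrite /nrm; under eq_bigr do rewrite sc.
    by rewrite -mulr_sumr mulVf // gt_eqF.
  under eq_bigr do rewrite sc mulrCA.
  by rewrite -mulr_sumr normrM ger0_norm ?invr_ge0 // ltr_pdivlMl // mulrC.
pose a e := \sum_(j in L) sgn R e j * col_mass V (u e) j.
pose opp (e : {ffun 'I_m -> bool}) : {ffun 'I_m -> bool} := [ffun j => ~~ e j].
have oppK : involutive opp by move=> e; apply/ffunP => j; rewrite !ffunE negbK.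
have sgn_opp e j : sgn R (opp e) j = - sgn R e j.
  by rewrite /sgn ffunE; case: (e j); rewrite ?expr0 ?expr1 ?opprK.
have nrm0 : nrm 0 = 0.
  by rewrite /nrm big1 // => j _; rewrite /col_mass mul0mx mxE normr0.
have val e v : \sum_j sgn R e j * `|f v j| = \sum_(j in L) sgn R e j * col_mass V v j.
  rewrite [RHS]big_mkcond /=; apply: eq_bigr => j _; rewrite /f.
  by case: ifP => // _; rewrite normr0 mulr0.
have val0 e : \sum_(j in L) sgn R e j * col_mass V 0 j = 0.
  by rewrite big1 // => j _; rewrite /col_mass mul0mx mxE normr0 mulr0.
have total (Y : {ffun 'I_m -> bool} -> 'rV[R]_D) : (forall e, nrm (Y e) <= 1) ->
    \sum_e \sum_j sgn R e j * `|f (Y e) j| <= 2 ^+ m * kap.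
  move=> HY; have [Z [HZ le1]] := contraction f Y; apply: le_trans le1 _.
  apply: (@le_trans _ _ (\sum_e G e)); last by rewrite /kap mulrA.
  apply: ler_sum => e _; apply: le_trans (lin _ _) _.
  have G0 : 0 <= G e by apply: le_trans (G1 e (Ordinal m0)).
  by have [e' ->] := HZ e; rewrite ler_piMr.
(* Negative violations are reindexed by the opposite sign vector, where they become positive. *)
have t1 := total (fun e => if 0 < a e then u e else 0).
have t2 := total (fun e => if a (opp e) < 0 then u (opp e) else 0).
have {t1} := t1 _; have {t2} := t2 _.
move=> /(_ (fun e => ltac:(case: ifP => _; [by have [-> _] := Hu (opp e)|by rewrite nrm0]))).
under eq_bigr => e _ do rewrite val.
rewrite (reindex_inj (inv_inj oppK)) /= => t2.
move=> /(_ (fun e => ltac:(case: ifP => _; [by have [-> _] := Hu e|by rewrite nrm0]))).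
under eq_bigr => e _ do rewrite val.
move=> t1.
have : 2 ^+ m * del < 2 ^+ m * kap + 2 ^+ m * kap.
  apply: lt_le_trans (lerD t1 t2); rewrite -big_split /=.
  have -> : 2 ^+ m * del = \sum_(e : {ffun 'I_m -> bool}) del.
    by rewrite sumr_const card_ffun card_bool card_ord -[RHS]mulr_natl natrX.
  apply: ltr_sum.
    by apply/hasP; exists [ffun => true]; rewrite ?mem_index_enum.
  move=> e _; rewrite oppK; have [_] := Hu e; rewrite -/(a e).
  have ao : \sum_(j in L) sgn R (opp e) j * col_mass V (u e) j = - a e.
    by rewrite /a -sumrN; apply: eq_bigr => j _; rewrite sgn_opp mulNr.
  case: (ltrgt0P (a e)) => ae.
  - by rewrite val0 addr0.
  - by rewrite val0 ao add0r.
  - by rewrite !val0 addr0.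
by rewrite -mulrDr ltr_pM2l ?exprn_gt0 //; lra.
Qed.

(** Light columns receive weight 0 or 2 according to their sign, heavy ones keep weight 1. A sign
    vector or its opposite discards at least half of the light columns, so the number left is at
    most half of [m] plus half of the heavy ones, that is [5 m / 8]. *)
Lemma halve_columns D m (V : 'M[R]_(D, m)) : (0 < D)%N -> (0 < m)%N ->
  let del := 32 * Num.sqrt (D%:R * ln (2 * m%:R) / m%:R) in
  exists sig : 'I_m -> nat, [/\ forall j, (sig j <= 2)%N,
    (8 * #|[set j | sig j != 0%N]%SET| <= 5 * m)%N &
    forall u, `|\sum_j (sig j)%:R * col_mass V u j - \sum_j col_mass V u j|
                <= del * \sum_j col_mass V u j].
Proof.
move=> D0 m0 del.
have [L [c [HL Hc Hs]]] := light_columns V D0 m0.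
have m0' : 0 < m%:R :> R by rewrite ltr0n.
have D0' : 0 < D%:R :> R by rewrite ltr0n.
have ln0 : 0 < ln (2 * m%:R) :> R.
  apply: ln_gt0; have : 1 <= m%:R :> R by rewrite ler1n.
  by lra.
(* Chosen so that the two terms in the numerator of [sum_max_le] are equal:
   [2 * lam ^ 2 * (32 * D / m) = ln (2 * m)]. *)
pose lam : R := Num.sqrt (ln (2 * m%:R) * m%:R / (64 * D%:R)).
have l0 : 0 < lam by rewrite sqrtr_gt0 !(mulr_gt0, invr_gt0).
have lam2 : lam ^+ 2 = ln (2 * m%:R) * m%:R / (64 * D%:R).
  by rewrite sqr_sqrtr // ltW // !(mulr_gt0, invr_gt0).
have Hdel : 2 * ((ln (2 * m%:R) + 2 * lam ^+ 2 * (32 * D%:R / m%:R)) / lam) <= del.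
  have -> : 2 * lam ^+ 2 * (32 * D%:R / m%:R) = ln (2 * m%:R).
    by rewrite lam2; field; rewrite !gt_eqF.
  have -> : del = 4 * (ln (2 * m%:R) / lam).
    apply/eqP; rewrite -(@eqrXn2 _ 2%N) //; last first.
    - by rewrite mulr_ge0 // divr_ge0 // ltW.
    - by rewrite mulr_ge0.
    rewrite /del !exprMn exprVn lam2 sqr_sqrtr; last first.
      by rewrite divr_ge0 ?mulr_ge0 // ltW.
    by apply/eqP; field; rewrite !gt_eqF.
  by rewrite mulrDl; lra.
have [e0 He0] := sign_discrepancy l0 m0 Hc Hs Hdel.
pose pl (e : {ffun 'I_m -> bool}) := [set j in L | ~~ e j]%SET.
have [e [He cnt]] : exists e, (forall u,
    `|\sum_(j in L) sgn R e j * col_mass V u j| <= del * \sum_j col_mass V u j) /\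
    (2 * #|pl e| <= #|L|)%N.
  have [le|lt] := leqP (2 * #|pl e0|)%N #|L|; first by exists e0.
  exists [ffun j => ~~ e0 j]; split.
    move=> u; rewrite -normrN -sumrN; apply: le_trans (He0 u).
    rewrite le_eqVlt; apply/orP; left; apply/eqP; congr `|_|; apply: eq_bigr => j _.
    by rewrite /sgn ffunE; case: (e0 j); rewrite ?expr0 ?expr1 ?mulN1r ?mul1r ?opprK.
  have -> : pl [ffun j => ~~ e0 j] = (L :\: pl e0)%SET.
    by apply/setP => j; rewrite !inE ffunE negbK; case: (j \in L); rewrite ?andbF ?andbT //= negbK.
  have sub : pl e0 \subset L by apply/fintype.subsetP => j; rewrite inE => /andP[].
  by rewrite cardsD (finset.setIidPr sub); move: lt; lia.
exists (fun j => if j \in L then (if e j then 0 else 2)%N else 1%N); split.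
- by move=> j; case: ifP => // _; case: ifP.
- have -> : [set j | (if j \in L then if e j then 0%N else 2%N else 1%N) != 0%N]%SET = (~: L :|: pl e)%SET.
    by apply/setP => j; rewrite !inE; case: (j \in L) => //=; case: (e j).
  have cU : (#|~: L :|: pl e| <= #|~: L| + #|pl e|)%N by rewrite cardsU leq_subr.
  have cC : (#|L| + #|~: L| = m)%N by rewrite cardsC card_ord.
  apply: leq_trans (leq_mul (leqnn 8) cU) _.
  move: #|~: L| #|pl e| #|L| HL cnt cC => a b c1 h1 h2 h3. lia.
- move=> u; rewrite -sumrB; apply: le_trans (He u).
  rewrite le_eqVlt; apply/orP; left; apply/eqP; congr `|_|; rewrite [RHS]big_mkcond /=.
  apply: eq_bigr => j _; case: ifP => _; last by rewrite mul1r subrr.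
  by rewrite /sgn; case: (e j); rewrite ?expr0 ?expr1; ring.
Qed.

End Halving.

(** * Iterated halving *)

Section Sparsification.
Variable R : realType.
Implicit Types (D m : nat).

(** The weights are absorbed into the columns, so that the next halving starts from an unweighted
    matrix. *)
Lemma restrict_columns D m (V : 'M[R]_(D, m)) (sig : 'I_m -> nat) :
  let S := [set j | sig j != 0%N]%SET in
  exists V' : 'M[R]_(D, #|S|),
    (forall u, \sum_j col_mass V' u j = \sum_j (sig j)%:R * col_mass V u j) /\
    forall tau' : 'I_#|S| -> nat, exists tau : 'I_m -> nat, [/\
      (#|[set j | tau j != 0%N]%SET| <= #|[set j | tau' j != 0%N]%SET|)%N,
      forall b, (forall j, tau' j <= b)%N -> forall j, (tau j <= sig j * b)%N &
      forall u, \sum_j (tau j)%:R * col_mass V u j =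
                \sum_j (tau' j)%:R * col_mass V' u j].
Proof.
move=> S.
pose ev (j : 'I_#|S|) : 'I_m := enum_val j.
have evS j : ev j \in S by apply: enum_valP.
have massE u j : col_mass (\matrix_(r, j) (V r (ev j) * (sig (ev j))%:R)) u j =
    (sig (ev j))%:R * col_mass V u (ev j).
  rewrite /col_mass !mxE -[X in X * _](ger0_norm (ler0n R _)) -normrM mulr_sumr.
  by congr `|_|; apply: eq_bigr => r _; rewrite mxE mulrA mulrC.
have sumS (F : 'I_m -> R) : (forall j, sig j = 0%N -> F j = 0) ->
    \sum_j F j = \sum_(j < #|S|) F (ev j).
  move=> F0; rewrite -(big_enum_val (op := +%R) (A := mem S) F) [RHS]big_mkcond /=.
  by apply: eq_bigr => j _; rewrite inE; case: eqP => // /F0 ->.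
exists (\matrix_(r, j) (V r (ev j) * (sig (ev j))%:R)); split.
  move=> u; rewrite sumS; last by move=> j ->; rewrite mul0r.
  by apply: eq_bigr => j _; rewrite massE.
move=> tau'.
pose tau j := if [pick j' | ev j' == j] is Some j' then (sig j * tau' j')%N else 0%N.
have tauE j' : tau (ev j') = (sig (ev j') * tau' j')%N.
  rewrite /tau; case: pickP => [j'' /eqP /enum_val_inj -> //|/(_ j')].
  by rewrite eqxx.
have tau0 j : sig j = 0%N -> tau j = 0%N.
  by move=> s0; rewrite /tau; case: pickP => // j' _; rewrite s0.
exists tau; split.
- apply: leq_trans (leq_imset_card ev [set j | tau' j != 0%N]%SET).
  apply/subset_leq_card/fintype.subsetP => j; rewrite inE => tj.
  have jS : j \in S by rewrite inE; apply: contra tj => /eqP /tau0 ->.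
  have E : ev (enum_rank_in jS j) = j by apply: enum_rankK_in.
  rewrite -E; apply: imset_f; rewrite inE; apply: contra tj => /eqP t0.
  by rewrite -E tauE t0 muln0.
- move=> b Hb j; rewrite /tau; case: pickP => // j' _.
  by rewrite leq_mul2l Hb orbT.
- move=> u; rewrite sumS; last by move=> j /tau0 ->; rewrite mul0r.
  apply: eq_bigr => j _; rewrite massE tauE natrM; by ring.
Qed.

(* The invariant 1/2 + x/4 <= distortion <= 2 - x/2 with x ^ 4 = M0 / m absorbs the
   geometric series of the errors made at sizes m, 5m/8, ... *)
Lemma sparsify_aux D (M0 : nat) : (0 < D)%N -> (0 < M0)%N ->
  (forall m (x : R), (M0 < m)%N -> 0 < x -> x ^+ 4 * m%:R = M0%:R ->
     32 * Num.sqrt (D%:R * ln (2 * m%:R) / m%:R) <= x / 50) ->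
  forall m (V : 'M[R]_(D, m)), exists tau : 'I_m -> nat, [/\
    (#|[set j | tau j != 0%N]%SET| <= M0)%N,
    forall j, (tau j <= m ^ 2)%N,
    forall u, (m <= M0)%N -> \sum_j (tau j)%:R * col_mass V u j = \sum_j col_mass V u j &
    forall u x, (M0 < m)%N -> 0 < x -> x ^+ 4 * m%:R = M0%:R ->
      (1 / 2 + x / 4) * \sum_j col_mass V u j <= \sum_j (tau j)%:R * col_mass V u j
        <= (2 - x / 2) * \sum_j col_mass V u j].
Proof.
move=> D0 M00 Hdel m; elim/ltn_ind: m => m IH V.
have [mM|Mm] := leqP m M0.
  exists (fun=> 1%N); split=> //.
  - by apply: leq_trans (max_card _) _; rewrite card_ord.
  - by move=> j; rewrite expn_gt0 (leq_ltn_trans _ (ltn_ord j)).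
  - by move=> u _; apply: eq_bigr => j _; rewrite mul1r.
have m0 : (0 < m)%N by apply: leq_ltn_trans Mm.
have [sig [sig2 card_sig Hsig]] := halve_columns V D0 m0.
have [V' [sumV' Hlift]] := restrict_columns V sig.
set m' := #|_| in card_sig V' sumV' Hlift.
have m'm : (m' < m)%N by lia.
have [tau' [card' bd' eq' bnd']] := IH m' m'm V'.
have [tau [cardt bdt sumt]] := Hlift tau'.
exists tau; split.
- exact: leq_trans cardt card'.
(* A halving at most doubles a weight and shrinks the size by 5/8, and [2 * (5/8)^2 <= 1]; hence the
   bound [m ^ 2]. *)
- move=> j; apply: leq_trans (bdt _ bd' j) _.
  apply: (@leq_trans (2 * m' ^ 2)); first by rewrite leq_mul2r sig2 orbT.
  by rewrite -(@leq_pmul2l 64) //; nia.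
- by [].
move=> u x _ x0 xm; rewrite sumt.
have del := Hdel m x Mm x0 xm.
have m0r : 0 < m%:R :> R by rewrite ltr0n.
have x1 : x < 1.
  rewrite ltNge; apply/negP => x1.
  have : m%:R <= M0%:R :> R.
    by rewrite -xm ler_peMl // exprn_ege1.
  by rewrite ler_nat leqNgt Mm.
set S := \sum_j col_mass V u j.
have S0 : 0 <= S by apply: sumr_ge0 => j _; exact: normr_ge0.
set S' := \sum_j col_mass V' u j.
have /ler_normlP [lo hi] : `|S' - S| <= x / 50 * S.
  by rewrite /S' sumV'; apply: le_trans (Hsig u) _; rewrite ler_wpM2r.
have S'lo : (1 - x / 50) * S <= S' by move: lo hi; clear; lra.
have S'hi : S' <= (1 + x / 50) * S by move: lo hi; clear; lra.
have S'0 : 0 <= S' by apply: sumr_ge0 => j _; exact: normr_ge0.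
have [m'M|Mm'] := leqP m' M0.
  rewrite eq' // -/S'; apply/andP; split.
    by apply: le_trans S'lo; rewrite ler_wpM2r //; move: x0 x1; clear; lra.
  by apply: (le_trans S'hi); rewrite ler_wpM2r //; move: x0 x1; clear; lra.
have m'0 : 0 < m'%:R :> R by rewrite ltr0n (leq_ltn_trans _ Mm').
pose x' : R := Num.sqrt (Num.sqrt (M0%:R / m'%:R)).
have M0r : 0 < M0%:R :> R by rewrite ltr0n.
have x'0 : 0 < x' by rewrite !sqrtr_gt0 divr_gt0.
have x'4 : x' ^+ 4 = M0%:R / m'%:R.
  by rewrite (exprM x' 2 2) !sqr_sqrtr ?sqrtr_ge0 // divr_ge0 // ltW.
have x'm : x' ^+ 4 * m'%:R = M0%:R by rewrite x'4 divfK // gt_eqF.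
have x'1 : x' < 1.
  rewrite ltNge; apply/negP => x'1.
  have : m'%:R <= M0%:R :> R.
    by rewrite -x'm ler_peMl // exprn_ege1.
  by rewrite ler_nat leqNgt Mm'.
(* The fourth power of [x] is inversely proportional to the size, which falls to at most 5/8, and
   [(11/10)^4 <= 3/2 < 8/5]. *)
have xx' : 11 / 10 * x <= x'.
  rewrite leNgt; apply/negP => xx'.
  have : x' ^+ 4 < (11 / 10 * x) ^+ 4.
    by rewrite ltrXn2r // ?ltW // mulr_ge0 ?ltW // divr_ge0.
  have m58 : 8 * m'%:R <= 5 * m%:R :> R by rewrite -!natrM ler_nat.
  have x40 : 0 < x ^+ 4 by rewrite exprn_gt0.
  rewrite exprMn => H.
  have : x' ^+ 4 * m'%:R < (11 / 10) ^+ 4 * x ^+ 4 * m'%:R by rewrite ltr_pM2r.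
  rewrite x'm -xm.
  have : x ^+ 4 * (8 * m'%:R) <= x ^+ 4 * (5 * m%:R) by rewrite ler_pM2l.
  have : 0 < x ^+ 4 * m'%:R by rewrite mulr_gt0.
  rewrite mulrCA [x ^+ 4 * (5 * _)]mulrCA -mulrA.
  have y4 : (11 / 10 : R) ^+ 4 <= 3 / 2 by rewrite (exprM _ 2 2) !expr2; clear; lra.
  move: (x ^+ 4 * m'%:R) (x ^+ 4 * m%:R) y4 => a b y4 a0 h1 h2.
  have : (11 / 10 : R) ^+ 4 * a <= 3 / 2 * a by rewrite ler_pM2r.
  by move: a0 h1 h2; clear; lra.
have /andP [lo' hi'] := bnd' u x' Mm' x'0 x'm.
apply/andP; split.
  apply: le_trans lo'; apply: (@le_trans _ _ ((1 / 2 + x' / 4) * ((1 - x / 50) * S))).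
    by rewrite mulrA ler_wpM2r //; move: x0 x1 x'0 x'1 xx'; clear; nra.
  by rewrite ler_wpM2l //; move: x'0; clear; lra.
apply: (le_trans hi'); apply: (@le_trans _ _ ((2 - x' / 2) * ((1 + x / 50) * S))).
  by rewrite ler_wpM2l //; move: x'1; clear; lra.
by rewrite mulrA ler_wpM2r //; move: x0 x1 x'0 x'1 xx'; clear; nra.
Qed.

Lemma exp2_30_ge : 1000 * (1000 * 1000) <= 2 ^+ 30 :> R.
Proof.
have -> : 2 ^+ 30 = (2 ^+ 10) ^+ 3 :> R by rewrite -exprM.
have h : 1000 <= 2 ^+ 10 :> R by rewrite (exprM _ 2 5) !exprS expr0; lra.
have c0 : 0 <= 1000 :> R by exact: ler0n.
move: (2 ^+ 10) (1000 : R) h c0 => a c ca c0.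
by rewrite !exprS expr0 mulr1 !ler_pM // mulr_ge0.
Qed.

(** For [M0 = 2 ^ 30 * D * l] one has [ln (2 * M0) <= 33 * l], and going up from [M0] to [m]
    multiplies the bound by at most [x ^ -2], since [ln y <= y]. The condition of [sparsify_aux]
    then reduces to [1600 ^ 2 * (33 * l + 2) <= 2 ^ 30 * l]. *)
Lemma sparsify (C0 : nat) : C0 = (2 ^ 30)%N -> forall D m (V : 'M[R]_(D, m)), (0 < D)%N ->
  exists tau : 'I_m -> nat, [/\
    (#|[set j | tau j != 0%N]%SET| <= C0 * (D * (trunc_log 2 D).+1))%N,
    forall j, (tau j <= m ^ 2)%N &
    forall u, 1 / 2 * \sum_j col_mass V u j <= \sum_j (tau j)%:R * col_mass V u j
        <= 2 * \sum_j col_mass V u j].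
Proof.
move=> HC0 D m V D0; set l := (trunc_log 2 D).+1.
have C0r : C0%:R = 2 ^+ 30 :> R by rewrite HC0 natrX.
have C0p : (0 < C0)%N by rewrite HC0 expn_gt0.
clear HC0.
have M00 : (0 < C0 * (D * l))%N by rewrite !muln_gt0 C0p D0.
have D0r : 0 < D%:R :> R by rewrite ltr0n.
have l0r : 0 < l%:R :> R by rewrite ltr0n.
have l1r : 1 <= l%:R :> R by rewrite ler1n.
have C0r0 : 0 < C0%:R :> R by rewrite ltr0n.
have ln2 : ln 2 <= 1 :> R.
  by have := le_ln1Dx (_ : -1 < 1 :> R); rewrite [1 + 1](_ : _ = 2) ?ltrN10 //; apply; lra.
have lnle (y : R) : 0 < y -> ln y <= y.
  move=> y0; have H := @le_ln1Dx R (y - 1).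
  rewrite (_ : 1 + (y - 1) = y) in H; last by ring.
  by apply: le_trans (H _) _; lra.
have lnM0 : ln (2 * (C0 * (D * l))%:R) <= 33 * l%:R :> R.
  have lnD : ln D%:R <= l%:R :> R.
    apply: (@le_trans _ _ (ln (2 ^+ l))).
      rewrite ler_ln ?posrE ?exprn_gt0 // -natrX ler_nat ltnW //.
      exact: trunc_log_ltn.
    by rewrite lnXn // -[ln 2 *+ l]mulr_natl ler_piMr // ltW.
  have lnl := lnle _ l0r.
  rewrite !natrM !lnM ?posrE ?mulr_gt0 // C0r lnXn // -[ln 2 *+ 30]mulr_natl.
  by lra.
have key m' (x : R) : (C0 * (D * l) < m')%N -> 0 < x -> x ^+ 4 * m'%:R = (C0 * (D * l))%:R ->
     32 * Num.sqrt (D%:R * ln (2 * m'%:R) / m'%:R) <= x / 50.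
  move=> Mm' x0 xm.
  have m'0 : 0 < m'%:R :> R by rewrite ltr0n (leq_ltn_trans _ Mm').
  have x20 : 0 < x ^+ 2 by rewrite exprn_gt0.
  have x40 : 0 < x ^+ 4 by rewrite exprn_gt0.
  have x1 : x < 1.
    rewrite ltNge; apply/negP => x1.
    have : m'%:R <= (C0 * (D * l))%:R :> R.
      by rewrite -xm ler_peMl // exprn_ege1.
    by rewrite ler_nat leqNgt Mm'.
  have x21 : x ^+ 2 <= 1 by rewrite exprn_ile1 // ltW.
  have lnm : ln (2 * m'%:R) <= (33 * l%:R + 2) / x ^+ 2.
    have E : 2 * m'%:R = 2 * (C0 * (D * l))%:R * (x ^- 2) ^+ 2.
      rewrite -xm -exprVn -exprM.
      by rewrite exprVn; field; rewrite gt_eqF.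
    rewrite E lnM ?posrE ?exprn_gt0 ?invr_gt0 ?mulr_gt0 //; last by rewrite ltr0n.
    rewrite lnXn ?invr_gt0 // [ln (x ^- 2) *+ 2]mulr2n.
    have i1 : 1 <= (x ^+ 2)^-1 by rewrite invf_ge1.
    have li : l%:R <= l%:R * x ^- 2 by rewrite ler_peMr // ltW.
    have := lnle (x ^+ 2)^-1; rewrite invr_gt0 => /(_ x20).
    by move: (x ^- 2) li i1 => i li i1 h; lra.
  rewrite -ler_pdivlMl //.
  have -> : 32^-1 * (x / 50) = Num.sqrt (x ^+ 2 / (1600 * 1600)).
    have -> : x ^+ 2 / (1600 * 1600) = (32^-1 * (x / 50)) ^+ 2 by field.
    by rewrite sqrtr_sqr ger0_norm // !mulr_ge0 ?ltW.
  rewrite ler_wsqrtr // ler_pdivrMr //.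
  apply: (@le_trans _ _ (D%:R * ((33 * l%:R + 2) / x ^+ 2))); first by rewrite ler_pM2l.
  rewrite mulrA ler_pdivrMr //.
  have -> : x ^+ 2 / (1600 * 1600) * m'%:R * x ^+ 2 = (x ^+ 4 * m'%:R) / (1600 * 1600) by field.
  rewrite xm !natrM C0r.
  have Dl : 0 < D%:R * l%:R :> R by rewrite mulr_gt0.
  have DDl : D%:R <= D%:R * l%:R :> R by rewrite ler_peMr // ltW.
  have := exp2_30_ge; set c := 2 ^+ 30 => c9.
  have : 1000 * (1000 * 1000) * (D%:R * l%:R) <= c * (D%:R * l%:R) by rewrite ler_pM2r.
  by move: Dl DDl; clear; rewrite mulrDr => Dl DDl H; lra.
have [tau [c1 c2 c3 c4]] := sparsify_aux D0 M00 key V.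
exists tau; split=> // u.
have S0 : 0 <= \sum_j col_mass V u j by apply: sumr_ge0 => j _; exact: normr_ge0.
have [mM|Mm] := leqP m (C0 * (D * l)).
  by rewrite c3 //; apply/andP; split; lra.
have m0 : 0 < m%:R :> R by rewrite ltr0n (leq_ltn_trans _ Mm).
have M0r : 0 < (C0 * (D * l))%:R :> R by rewrite ltr0n.
pose x : R := Num.sqrt (Num.sqrt ((C0 * (D * l))%:R / m%:R)).
have x0 : 0 < x by rewrite !sqrtr_gt0 divr_gt0.
have xm : x ^+ 4 * m%:R = (C0 * (D * l))%:R.
  rewrite (exprM x 2 2) !sqr_sqrtr ?sqrtr_ge0 ?divr_ge0 ?ltW //.
  by rewrite divfK // gt_eqF.
have /andP[h1 h2] := c4 u x Mm x0 xm.
apply/andP; split; first by apply: le_trans h1; rewrite ler_wpM2r //; lra.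
by apply: (le_trans h2); rewrite ler_wpM2r //; lra.
Qed.

End Sparsification.

(** * Pivots of maximal volume *)

Section Elimination.
Variable R : realType.
Variables (d : nat) (A : nat -> nat -> R).
Hypothesis A0 : forall i j, (d <= j)%N -> A i j = 0.
Implicit Types (p q : nat -> nat).

Lemma elim_mx_ext p q p' q' r :
  (forall l, (l < r)%N -> p l = p' l /\ q l = q' l) ->
  elim_mx d p q A r = elim_mx d p' q' A r.
Proof.
elim: r => // r IH H /=; have [-> ->] := H r (ltnSn r).
by rewrite IH // => l lr; apply: H; rewrite ltnS ltnW.
Qed.

Lemma elim_mx_new p q r i l : (r <= l)%N -> elim_mx d p q A r i (d + l) = 0.
Proof.
elim: r i => [|r IH] i rl /=; first by rewrite A0 // leq_addr.
rewrite /estep eqn_add2l gtn_eqF // !IH ?(ltnW rl) //.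
by rewrite mulr0 subr0.
Qed.

(** A step subtracts [h] times row [p r] of the residual, which by induction is row [p r] of A minus
    a combination of the earlier pivot rows. The coefficients of that combination change by the same
    row operation. *)
Lemma elim_mx_decomp p q r i j : (j < d)%N ->
  elim_mx d p q A r i j = A i j - \sum_(l < r) elim_mx d p q A r i (d + l) * A (p l) j.
Proof.
move=> jd; elim: r i => [|r IH] i /=; first by rewrite big_ord0 subr0.
set h := elim_mx d p q A r i (q r) / elim_mx d p q A r (p r) (q r).
have E l : estep d r (p r) (q r) (elim_mx d p q A r) i (d + l) =
   if l == r then h else elim_mx d p q A r i (d + l) - h * elim_mx d p q A r (p r) (d + l).
  by rewrite /estep eqn_add2l.
rewrite {1}/estep ltn_eqF ?ltn_addr // -/h !IH big_ord_recr /= E eqxx.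
under [X in _ - (X + _)]eq_bigr => l _ do rewrite E ltn_eqF ?ltn_ord // mulrBl -mulrA.
rewrite sumrB -mulr_sumr; by ring.
Qed.

(** Later steps leave the earlier pivot rows alone, because their entry in the new pivot column, and
    so their multiplier, is 0. *)
Lemma elim_mx_pivots p q r :
  (forall l, (l < r)%N -> (q l < d)%N /\ elim_mx d p q A l (p l) (q l) != 0) ->
  forall l, (l < r)%N -> [/\ forall j, (j < d)%N -> elim_mx d p q A r (p l) j = 0,
    forall i, elim_mx d p q A r i (q l) = 0 &
    forall l', (l' < r)%N -> elim_mx d p q A r (p l) (d + l') = (l' == l)%:R].
Proof.
elim: r => // r IH Hpiv l.
have Hr l' : (l' < r)%N -> (l' < r.+1)%N by move=> lr; rewrite ltnS ltnW.
have {}IH := IH (fun l' lr => Hpiv l' (Hr l' lr)).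
have [qr piv] := Hpiv r (ltnSn r).
rewrite ltnS leq_eqVlt => /orP[/eqP ->|lr] /=.
  split.
  - move=> j jd; rewrite /estep ltn_eqF ?ltn_addr // divff // mul1r subrr //.
  - by move=> i; rewrite /estep ltn_eqF ?ltn_addr // divfK // subrr.
  - move=> l'; rewrite ltnS leq_eqVlt /estep eqn_add2l divff //.
    case: eqP => //= _ l'r; by rewrite mul1r subrr.
have [Ha Hb Hc] := IH l lr.
have [ql _] := Hpiv l (Hr l lr).
split.
- by move=> j jd; rewrite /estep ltn_eqF ?ltn_addr // (Ha (q r)) // mul0r mul0r subr0 Ha.
- by move=> i; rewrite /estep ltn_eqF ?ltn_addr // !Hb mulr0 subr0.
- move=> l'; rewrite ltnS leq_eqVlt /estep eqn_add2l (Ha (q r)) // mul0r mul0r subr0.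
  by case: eqP => [->|_] /= => [_|/Hc //]; rewrite gtn_eqF.
Qed.

(** Once the residual is zero every further multiplier has numerator 0. *)
Lemma elim_mx_stop n p q r k :
  (forall l, (p l < n)%N /\ (q l < d)%N) ->
  (forall i j, (i < n)%N -> (j < d)%N -> elim_mx d p q A r i j = 0) -> (r <= k)%N ->
  forall i, (i < n)%N ->
    (forall j, (j < d)%N -> elim_mx d p q A k i j = 0) /\
    (forall l, elim_mx d p q A k i (d + l) = elim_mx d p q A r i (d + l)).
Proof.
move=> Hpq H0; elim: k => [|k IH].
  by rewrite leqn0 => /eqP E; subst r => i iN; split=> // j jd; apply: H0.
rewrite leq_eqVlt => /orP[/eqP E|rk].
  by subst r => i iN; split=> // j jd; apply: H0.
move=> i iN; have {}IH := IH rk; have [Ha Hb] := IH i iN.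
have [pk qk] := Hpq k; have [Hpa Hpb] := IH _ pk.
split=> [j jd|l] /=; rewrite /estep (Ha (q k)) // !mul0r subr0.
  by rewrite ltn_eqF ?ltn_addr // Ha.
rewrite eqn_add2l; case: eqP => // ->.
by rewrite -Hb elim_mx_new.
Qed.

End Elimination.

(** * Consequences of maximal volume *)

Section MaxVolume.
Variable R : realType.
Implicit Types (n d r : nat).

Lemma exists_unit_minor n d r (A : 'M[R]_(n, d)) : (r <= \rank A)%N ->
  exists (f : 'I_r -> 'I_n) (g : 'I_r -> 'I_d), mxsub f g A \in unitmx.
Proof.
move=> rA; pose f x := maxrankfun A (widen_ord rA x).
have rk : \rank (rowsub f A) = r.
  have -> : rowsub f A = pid_mx r *m rowsub (maxrankfun A) A.
    apply/matrixP => x j; rewrite !mxE (bigD1 (widen_ord rA x)) //= big1 => [|y yx].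
      by rewrite !mxE /= eqxx ltn_ord mul1r addr0.
    rewrite !mxE /=; case: eqP => [E|]; last by rewrite mul0r.
    by move: yx; rewrite -val_eqE /= E eqxx.
  by rewrite mxrankMfree ?maxrowsub_free // rank_pid_mx.
have full : row_full (rowsub f A)^T by rewrite /row_full mxrank_tr rk.
exists f, (fullrankfun full).
have -> : mxsub f (fullrankfun full) A = (rowsub (fullrankfun full) (rowsub f A)^T)^T.
  by apply/matrixP => x y; rewrite !mxE.
by rewrite unitmx_tr fullrowsub_unit.
Qed.

Lemma exists_max_volume n d r (A : 'M[R]_(n, d)) : (r <= \rank A)%N ->
  exists (f : 'I_r -> 'I_n) (g : 'I_r -> 'I_d), mxsub f g A \in unitmx /\
    forall (f' : 'I_r -> 'I_n) (g' : 'I_r -> 'I_d),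
      `|\det (mxsub f' g' A)| <= `|\det (mxsub f g A)|.
Proof.
move=> /exists_unit_minor [f0 [g0 u0]].
pose F (x : {ffun 'I_r -> 'I_n} * {ffun 'I_r -> 'I_d}) := `|\det (mxsub x.1 x.2 A)|.
case: (@Order.TotalTheory.arg_maxP _ _ _ (finfun f0, finfun g0) predT F isT) => -[f g] _ Hmax.
exists f, g; split.
  rewrite unitmxE unitfE -normr_gt0; apply: lt_le_trans (Hmax (finfun f0, finfun g0) isT).
  by rewrite /F /= mxsub_ffun normr_gt0 -unitfE -unitmxE.
move=> f' g'; have := Hmax (finfun f', finfun g') isT.
by rewrite /F /= mxsub_ffun.
Qed.

(** Along row [l] the cofactors of [C] are those of [B]. *)
Lemma cramer_row r (B C : 'M[R]_r) (l : 'I_r) (h : 'rV[R]_r) :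
  (forall a b, a != l -> C a b = B a b) -> row l C = h *m B ->
  \det C = h ord0 l * \det B.
Proof.
move=> HC Hl; rewrite (expand_det_row C l).
have cof b : cofactor C l b = (\adj B) b l.
  rewrite mxE /cofactor; congr (_ * \det _).
  by apply/matrixP => x y; rewrite !mxE HC // eq_sym neq_lift.
under eq_bigr => b _ do rewrite cof.
have Crow b : C l b = (h *m B) ord0 b by rewrite -Hl mxE.
under eq_bigr => b _ do rewrite Crow.
have -> : \sum_b (h *m B) ord0 b * (\adj B) b l = (h *m B *m \adj B) ord0 l.
  by rewrite [RHS]mxE.
by rewrite -mulmxA mul_mx_adj mul_mx_scalar mxE mulrC.
Qed.

Lemma entry_le_l1norm n d (E : 'M[R]_(n, d)) i j : `|E i j| <= l1norm E.
Proof.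
rewrite /l1norm (bigD1 i) //= (bigD1 j) //= -addrA lerDl addr_ge0 //.
  by apply: sumr_ge0.
by apply: sumr_ge0 => a _; apply: sumr_ge0.
Qed.

Lemma l1norm_ge0 n d (E : 'M[R]_(n, d)) : 0 <= l1norm E.
Proof. by apply: sumr_ge0 => i _; apply: sumr_ge0. Qed.

(* If B has rank at most r, the (r+1) x (r+1) minor of A is at most
   (r+1)^2 |A - B| times the largest r x r minor: for x in the left kernel of the
   minor of B one has det C x = x (C - C_B) adj C, and adj C consists of r x r minors. *)
Lemma minor_perturbation n d r (A B : 'M[R]_(n, d)) (f : 'I_r.+1 -> 'I_n) (g : 'I_r.+1 -> 'I_d)
    (v : R) : (\rank B <= r)%N ->
  (forall (f' : 'I_r -> 'I_n) (g' : 'I_r -> 'I_d), `|\det (mxsub f' g' A)| <= v) ->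
  `|\det (mxsub f g A)| <= (r.+1 ^ 2)%:R * l1norm (B - A) * v.
Proof.
move=> rB Hv; set C := mxsub f g A; set CB := mxsub f g B.
have v0 : 0 <= v.
  by apply: le_trans (Hv (fun x => f (lift ord0 x)) (fun x => g (lift ord0 x))).
have rCB : (\rank CB <= r)%N.
  have -> : CB = rowsub f (col_base B) *m colsub g (row_base B).
    rewrite /CB -{1}(mulmx_base B) mxsub_mul //.
  by apply: leq_trans (mxrankM_maxr _ _) (leq_trans (rank_leq_row _) rB).
have /rowV0Pn [x /sub_kermxP xCB x0] : kermx CB != 0.
  by rewrite kermx_eq0 /row_free neq_ltn ltnS rCB.
case: (@Order.TotalTheory.arg_maxP _ _ _ ord0 predT (fun b => `|x ord0 b|) isT) => b0 _ Hmax.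
have xb0 : 0 < `|x ord0 b0|.
  rewrite normr_gt0; apply: contra x0 => /eqP E; apply/eqP/rowP => b; rewrite mxE.
  by apply/eqP; rewrite -normr_le0; apply: le_trans (Hmax b isT) _; rewrite E normr0.
have adj_le c : `|(\adj C) c b0| <= v.
  rewrite mxE /cofactor normrM normrX normrN1 expr1n mul1r.
  rewrite (_ : row' b0 (col' c C) = mxsub (f \o lift b0) (g \o lift c) A) //.
  by apply/matrixP => a b; rewrite !mxE.
have Ex : \det C * x ord0 b0 = \sum_c (\sum_b x ord0 b * (C - CB) b c) * (\adj C) c b0.
  have : (x *m (C - CB) *m \adj C) ord0 b0 = \det C * x ord0 b0.
    rewrite mulmxBr xCB subr0 -mulmxA mul_mx_adj mul_mx_scalar mxE //.
  by move=> <-; rewrite mxE; apply: eq_bigr => c _; rewrite mxE.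
rewrite -(ler_pM2r xb0) -normrM Ex.
apply: le_trans (ler_norm_sum _ _ _) _.
apply: (@le_trans _ _ (\sum_(c < r.+1) \sum_(b < r.+1) `|x ord0 b0| * l1norm (B - A) * v)).
  apply: ler_sum => c _; rewrite normrM.
  apply: (@le_trans _ _ ((\sum_b `|x ord0 b| * `|(C - CB) b c|) * v)).
    apply: ler_pM => //; apply: le_trans (ler_norm_sum _ _ _) _.
    by apply: ler_sum => b _; rewrite normrM.
  rewrite mulr_suml; apply: ler_sum => b _; apply: ler_wpM2r => //.
  apply: ler_pM => //; first exact: Hmax.
  have -> : `|(C - CB) b c| = `|(B - A) (f b) (g c)| by rewrite !mxE distrC.
  exact: entry_le_l1norm.
rewrite !sumr_const !card_ord -mulrnA -[_ *+ _]mulr_natr le_eqVlt; apply/orP; left.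
by apply/eqP; rewrite mulnn; ring.
Qed.

(** If the residual vanished on the whole submatrix after [s < r] steps, [elim_mx_decomp] would
    factor an invertible submatrix of size [r] through dimension [s]. *)
Lemma exists_pivots n d r (A : 'M[R]_(n, d)) (Af : nat -> nat -> R)
    (f : 'I_r -> 'I_n) (g : 'I_r -> 'I_d) :
  (forall i j, (d <= j)%N -> Af i j = 0) ->
  (forall (i : 'I_n) (j : 'I_d), Af i j = A i j) ->
  mxsub f g A \in unitmx ->
  exists p q : nat -> nat, forall l, (l < r)%N ->
    [/\ exists x, p l = f x, exists y, q l = g y & elim_mx d p q Af l (p l) (q l) != 0].
Proof.
move=> Af0 AfE unitA.
suff H s : (s <= r)%N -> exists p q : nat -> nat, forall l, (l < s)%N ->
    [/\ exists x, p l = f x, exists y, q l = g y & elim_mx d p q Af l (p l) (q l) != 0].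
  exact: H.
elim: s => [_|s IH sr]; first by exists id, id.
have [p [q Hpq]] := IH (ltnW sr).
have [x [y xy]] : exists x y, elim_mx d p q Af s (f x) (g y) != 0.
  apply: contrapT => Hno.
  have Z x y : elim_mx d p q Af s (f x) (g y) = 0.
    by apply/eqP; apply: contrapT => /negP h; apply: Hno; exists x, y.
  have E : mxsub f g A = (\matrix_(x < r, l < s) elim_mx d p q Af s (f x) (d + l)) *m
                         (\matrix_(l < s, y < r) Af (p l) (g y)).
    apply/matrixP => x y; rewrite !mxE.
    have := elim_mx_decomp Af p q s (f x) (ltn_ord (g y)).
    rewrite Z AfE => /esym/eqP; rewrite subr_eq0 => /eqP ->.
    by apply: eq_bigr => l _; rewrite !mxE.
  have : (\rank (mxsub f g A) <= s)%N.
    by rewrite E; apply: leq_trans (mxrankM_maxl _ _) (rank_leq_col _).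
  by rewrite mxrank_unit // leqNgt sr.
exists (fun l => if l == s then f x : nat else p l), (fun l => if l == s then g y : nat else q l).
move=> l; rewrite ltnS leq_eqVlt.
have ext l' : (l' <= s)%N -> elim_mx d (fun l => if l == s then f x : nat else p l)
    (fun l => if l == s then g y : nat else q l) Af l' = elim_mx d p q Af l'.
  by move=> l's; apply: elim_mx_ext => a al; rewrite ltn_eqF // (leq_trans al).
case: eqP => [->|_] /=.
  by move=> _; split; [exists x|exists y|rewrite ext].
move=> ls; have [h1 h2 h3] := Hpq l ls; split=> //.
by rewrite ext // ltnW.
Qed.

(** An entry of H is the pivot minor with one row exchanged, divided by the pivot minor. An entry of
    the residual is the Schur complement in the pivot minor bordered by one row and column, hence a
    quotient of minors of sizes r + 1 and r, to which [minor_perturbation] applies. *)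
Lemma good_pivots_rank n d r (A : 'M[R]_(n, d)) (Af : nat -> nat -> R) :
  (0 < n)%N -> (0 < d)%N ->
  (forall i j, (d <= j)%N -> Af i j = 0) ->
  (forall (i : 'I_n) (j : 'I_d), Af i j = A i j) ->
  (r <= \rank A)%N ->
  exists p q : nat -> nat, [/\ forall l, (p l < n)%N /\ (q l < d)%N,
    forall i l, (i < n)%N -> (l < r)%N -> `|elim_mx d p q Af r i (d + l)| <= 1 &
    forall i j (B : 'M[R]_(n, d)), (i < n)%N -> (j < d)%N -> (\rank B <= r)%N ->
       `|elim_mx d p q Af r i j| <= (r.+1 ^ 2)%:R * l1norm (B - A)].
Proof.
move=> n0 d0 Af0 AfE rA.
have [f [g [unitA Hmax]]] := exists_max_volume rA.
have [p0 [q0 Hpq0]] := exists_pivots Af0 AfE unitA.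
(* The value 0 beyond [r] keeps every pivot in range. *)
pose p l := if (l < r)%N then p0 l else 0%N.
pose q l := if (l < r)%N then q0 l else 0%N.
have Eelim l : (l <= r)%N -> elim_mx d p q Af l = elim_mx d p0 q0 Af l.
  by move=> lr; apply: elim_mx_ext => a al; rewrite /p /q (leq_trans al lr).
have Hpq l : (l < r)%N ->
    [/\ exists x, p l = f x, exists y, q l = g y & elim_mx d p q Af l (p l) (q l) != 0].
  by move=> lr; rewrite Eelim ?(ltnW lr) // /p /q lr; apply: Hpq0.
have pn l : (p l < n)%N.
  case: (ltnP l r) => lr; first by have [[x ->]] := Hpq l lr.
  by rewrite /p (leq_gtF lr).
have qd l : (q l < d)%N.
  case: (ltnP l r) => lr; first by have [_ [y ->]] := Hpq l lr.
  by rewrite /q (leq_gtF lr).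
have Hpiv l : (l < r)%N -> (q l < d)%N /\ elim_mx d p q Af l (p l) (q l) != 0.
  by move=> lr; split=> //; have [] := Hpq l lr.
have struct := elim_mx_pivots Hpiv.
have /choice [a Ha] : forall l : 'I_r, exists x : 'I_r, p l = f x.
  by move=> l; have [] := Hpq l (ltn_ord l).
have /choice [b Hb] : forall l : 'I_r, exists y : 'I_r, q l = g y.
  by move=> l; have [_ h _] := Hpq l (ltn_ord l).
(* A pivot is nonzero although the earlier pivot rows and columns are already cleared. So the pivots
   are distinct and merely permute the maximal submatrix. *)
have neq (l l' : 'I_r) : (l < l')%N -> p l <> p l' /\ q l <> q l'.
  move=> ll; have [_ _ piv] := Hpq l' (ltn_ord l').
  have [h1 h2 _] := elim_mx_pivots (fun x (xl : (x < l')%N) => Hpiv x (ltn_trans xl (ltn_ord l'))) ll.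
  split=> E.
    by move: piv; rewrite -E h1 ?eqxx.
  by move: piv; rewrite -E h2 eqxx.
have a_inj : injective a.
  move=> l l' E; apply/val_inj; case: (ltngtP l l') => // /neq [h _]; case: h;
    by rewrite !Ha E.
have b_inj : injective b.
  move=> l l' E; apply/val_inj; case: (ltngtP l l') => // /neq [_ h]; case: h;
    by rewrite !Hb E.
pose P (l : 'I_r) : 'I_n := Ordinal (pn l).
pose Q (l : 'I_r) : 'I_d := Ordinal (qd l).
have detPQ : `|\det (mxsub P Q A)| = `|\det (mxsub f g A)|.
  have -> : mxsub P Q A = row_perm (perm a_inj) (col_perm (perm b_inj) (mxsub f g A)).
    apply/matrixP => x y; rewrite !mxE !permE; congr (A _ _); apply/val_inj => /=.
      exact: Ha.
    exact: Hb.
  rewrite row_permE col_permE !det_mulmx !det_perm !normrM !normrX !normrN1 !expr1n.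
  by rewrite mul1r mulr1.
set V := `|\det (mxsub f g A)| in detPQ Hmax.
have V0 : 0 < V by rewrite normr_gt0 -unitfE -unitmxE.
have VPQ : 0 < `|\det (mxsub P Q A)| by rewrite detPQ.
have decomp i j := @elim_mx_decomp _ d Af p q r i j.
have rowE (i : 'I_n) : \row_y A i (Q y) = (\row_l elim_mx d p q Af r i (d + l)) *m mxsub P Q A.
  apply/rowP => y; rewrite !mxE.
  have := decomp i (q y) (qd y); have [_ -> _] := struct y (ltn_ord y).
  rewrite (_ : Af i (q y) = A i (Q y)); last by rewrite -AfE.
  move/esym/eqP; rewrite subr_eq0 => /eqP ->; apply: eq_bigr => l _; rewrite !mxE.
  by rewrite -AfE.
exists p, q; split=> [l|i l iN lr|i j B iN jd rB]; first by split.
- pose P' (x : 'I_r) : 'I_n := if x == Ordinal lr then Ordinal iN else P x.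
  have := @cramer_row r (mxsub P Q A) (mxsub P' Q A) (Ordinal lr)
     (\row_l elim_mx d p q Af r i (d + l)).
  rewrite mxE => /(_ _ _) E.
  have {}E : \det (mxsub P' Q A) = elim_mx d p q Af r i (d + l) * \det (mxsub P Q A).
    apply: E; first by move=> x y xl; rewrite !mxE /P' (negbTE xl).
    rewrite -(rowE (Ordinal iN)); apply/rowP => y; by rewrite !mxE /P' eqxx.
  have := Hmax P' Q; rewrite E normrM -detPQ -[leRHS]mul1r ler_pM2r //.
- pose I : 'I_n := Ordinal iN; pose J : 'I_d := Ordinal jd.
  pose F (x : 'I_(1 + r)) : 'I_n := match fintype.split x with inl _ => I | inr y => P y end.
  pose G (x : 'I_(1 + r)) : 'I_d := match fintype.split x with inl _ => J | inr y => Q y end.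
  have FG : mxsub F G A = block_mx (const_mx (A I J) : 'M[R]_1) (\row_y A I (Q y))
       (\col_x A (P x) J) (mxsub P Q A) :> 'M[R]_(1 + r).
    apply/matrixP => x y; rewrite mxE /F /G.
    case: (fintype.splitP x) => x' xE; case: (fintype.splitP y) => y' yE.
    + have -> : x = lshift r x' by apply: val_inj; exact: xE.
      have -> : y = lshift r y' by apply: val_inj; exact: yE.
      by rewrite block_mxEul mxE.
    + have -> : x = lshift r x' by apply: val_inj; exact: xE.
      have -> : y = rshift 1 y' by apply: val_inj; exact: yE.
      by rewrite block_mxEur mxE.
    + have -> : x = rshift 1 x' by apply: val_inj; exact: xE.
      have -> : y = lshift r y' by apply: val_inj; exact: yE.
      by rewrite block_mxEdl mxE.
    + have -> : x = rshift 1 x' by apply: val_inj; exact: xE.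
      have -> : y = rshift 1 y' by apply: val_inj; exact: yE.
      by rewrite block_mxEdr mxE.
  pose H : 'rV[R]_r := \row_l elim_mx d p q Af r i (d + l).
  have detFG : \det (mxsub F G A) = elim_mx d p q Af r i j * \det (mxsub P Q A).
    have : block_mx 1%:M (- H) 0 1%:M *m mxsub F G A =
       block_mx (const_mx (elim_mx d p q Af r i j) : 'M[R]_1) 0
         (\col_x A (P x) J) (mxsub P Q A) :> 'M[R]_(1 + r).
      rewrite FG mulmx_block !mul1mx !mul0mx !add0r (rowE I) !mulNmx -/H addrN.
      congr block_mx; apply/matrixP => x y; rewrite !mxE decomp // -AfE; congr (_ - _).
      by apply: eq_bigr => l _; rewrite !mxE -AfE.
    move/(congr1 determinant); rewrite det_mulmx det_ublock !det1 !mul1r det_lblock.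
    by rewrite det_mx11 mxE.
  have := @minor_perturbation n d r A B F G V rB Hmax.
  rewrite detFG normrM detPQ.
  by rewrite ler_pM2r.
Qed.

(** When the rank of A is below [k], the choice B = A shows that the residual is zero after
    [\rank A] steps, and the remaining steps change nothing. *)
Lemma good_pivots n d k (A : 'M[R]_(n, d)) (Af : nat -> nat -> R) :
  (0 < n)%N -> (0 < d)%N ->
  (forall i j, (d <= j)%N -> Af i j = 0) ->
  (forall (i : 'I_n) (j : 'I_d), Af i j = A i j) ->
  exists p q : nat -> nat, [/\ forall l, (p l < n)%N /\ (q l < d)%N,
    forall i l, (i < n)%N -> (l < k)%N -> `|elim_mx d p q Af k i (d + l)| <= 1 &
    forall i j (B : 'M[R]_(n, d)), (i < n)%N -> (j < d)%N -> (\rank B <= k)%N ->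
       `|elim_mx d p q Af k i j| <= (k.+1 ^ 2)%:R * l1norm (B - A)].
Proof.
move=> n0 d0 Af0 AfE.
have [kA|Ak] := leqP k (\rank A); first exact: good_pivots_rank.
have [p [q [h1 h2 h3]]] := good_pivots_rank n0 d0 Af0 AfE (leqnn (\rank A)).
exists p, q.
have Z i j : (i < n)%N -> (j < d)%N -> elim_mx d p q Af (\rank A) i j = 0.
  move=> iN jd; apply/eqP; rewrite -normr_le0.
  have := h3 i j A iN jd (leqnn _); rewrite subrr /l1norm big1 ?mulr0 // => a _.
  by rewrite big1 // => b _; rewrite mxE normr0.
have S := elim_mx_stop Af0 h1 Z (ltnW Ak).
split=> // [i l iN lk|i j B iN jd _].
  have [_ ->] := S i iN.
  have [lA|lA] := ltnP l (\rank A); first exact: h2.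
  by rewrite elim_mx_new // normr0.
have [-> // _] := S i iN.
by rewrite normr0 mulr_ge0 // l1norm_ge0.
Qed.

End MaxVolume.

(** * Quality of the best candidate *)

Section Analysis.
Variable R : realType.

Lemma bounded_coords n d k (M : 'M[R]_(n, d)) : (0 < d)%N -> (\rank M <= k)%N ->
  exists (J : nat -> 'I_d) (X : nat -> 'I_d -> R),
    (forall l j, `|X l j| <= 1) /\
    forall i j, M i j = \sum_(l < k) M i (J l) * X l j.
Proof.
move=> d0; move Er : (\rank M) => r rk.
have [f [g [unitW Hmax]]] : exists (f : 'I_r -> 'I_n) (g : 'I_r -> 'I_d),
    mxsub f g M \in unitmx /\ forall (f' : 'I_r -> 'I_n) (g' : 'I_r -> 'I_d),
      `|\det (mxsub f' g' M)| <= `|\det (mxsub f g M)|.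
  by apply: exists_max_volume; rewrite Er.
set W := mxsub f g M in unitW Hmax.
pose X0 : 'M[R]_(r, d) := invmx W *m rowsub f M.
have V0 : 0 < `|\det W| by rewrite normr_gt0 -unitfE -unitmxE.
have X01 l j : `|X0 l j| <= 1.
  pose g' y := if y == l then j else g y.
  have E : \det (mxsub f g' M)^T = X0 l j * \det W^T.
    rewrite (@cramer_row R r W^T (mxsub f g' M)^T l (row j X0^T)); first by rewrite !mxE.
      by move=> a b al; rewrite !mxE /g' (negbTE al).
    rewrite -row_mul -trmx_mul mulKVmx //; apply/rowP => a.
    by rewrite !mxE /g' eqxx.
  have := Hmax f g'; rewrite -(det_tr (mxsub f g' M)) E det_tr normrM.
  by rewrite -[leRHS]mul1r ler_pM2r.
have MX i j : M i j = \sum_(l < r) M i (g l) * X0 l j.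
  have sub := rowsub_sub f M.
  have rW : (r <= \rank (rowsub f M))%N.
    apply: (@leq_trans (\rank W)); first by rewrite mxrank_unit.
    have -> : W = rowsub f M *m colsub g 1%:M.
      by rewrite -[W]/(mxsub f g M) mulmx_colsub mulmx1; apply/matrixP => a b; rewrite !mxE.
    exact: mxrankM_maxl.
  have [_ /esym] := mxrank_leqif_sup sub; rewrite Er eqn_leq rW andbT.
  have -> : (\rank (rowsub f M) <= r)%N by apply: rank_leq_row.
  move=> /submxP [Y HY].
  have cg : colsub g M = Y *m W.
    by apply/matrixP => a b; rewrite mxE {1}HY !mxE; apply: eq_bigr => c _; rewrite !mxE.
  have : M = colsub g M *m X0 by rewrite cg -mulmxA mulKVmx // -HY.
  move=> /matrixP /(_ i j) ->; rewrite mxE; apply: eq_bigr => l _; by rewrite mxE.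
(* Indices from [r] to [k] get an arbitrary column with coefficient 0. *)
pose J l : 'I_d := if (insub l : option 'I_r) is Some l' then g l' else Ordinal d0.
pose X l j : R := if (insub l : option 'I_r) is Some l' then X0 l' j else 0.
exists J, X; split.
  by move=> l j; rewrite /X; case: insubP => // _; rewrite normr0.
move=> i j; rewrite MX.
transitivity (\sum_(l < r) M i (J l) * X l j).
  by apply: eq_bigr => l _; rewrite /J /X valK.
rewrite (big_ord_widen k (fun l : nat => M i (J l) * X l j) rk) big_mkcond /=.
apply: eq_bigr => l _; case: ifPn => // lr.
by rewrite /X insubN // mulr0.
Qed.

Lemma norm_sum_le k (a b : nat -> R) (ca cb : R) : 0 <= ca -> 0 <= cb ->
  (forall l, (l < k)%N -> `|a l| <= ca) -> (forall l, (l < k)%N -> `|b l| <= cb) ->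
  `|\sum_(l < k) a l * b l| <= k%:R * (ca * cb).
Proof.
move=> ca0 cb0 Ha Hb; apply: le_trans (ler_norm_sum _ _ _) _.
apply: (@le_trans _ _ (\sum_(l < k) ca * cb)).
  by apply: ler_sum => l _; rewrite normrM ler_pM // ?Ha ?Hb.
by rewrite sumr_const card_ord mulr_natl.
Qed.

(** * Error of the two fits at a good guess *)

Section FitBound.
(** [z] and [f] stand for Z and F divided by [mu], [Eps] for E, and [eta] for the mesh of the grid.
    The constants [4 k] and [6 k] bound the numbers to be rounded and the points of the grid. *)
Variables (n d k t N : nat) (gr : nat -> R) (eta mu : R).
Variables (A M : nat -> nat -> R) (G : nat -> nat -> nat) (U V X z f Eps : nat -> nat -> R).
Hypotheses (k0 : (0 < k)%N) (eta0 : 0 <= eta) (mu0 : 0 <= mu).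
Hypothesis gr_range : forall c, (c < N)%N -> `|gr c| <= 6 * k%:R.
Hypothesis gr_approx : forall y, `|y| <= 4 * k%:R ->
  exists2 c, (c < N)%N & `|gr c - y| <= eta.
Hypothesis M_decomp : forall i j, (i < n)%N -> (j < d)%N ->
  M i j = A i j - \sum_(l < k) M i (d + l)%N * A (G 0%N l) j.
Hypothesis residual_decomp : forall i j, (i < n)%N -> (j < d)%N ->
  M i j - Eps i j = \sum_(l < k) M i (d + l)%N * (mu * z l j) + \sum_(l < k) mu * f i l * X l j.
Hypothesis H_le : forall i l, (i < n)%N -> (l < k)%N -> `|M i (d + l)%N| <= 1.
Hypothesis X_le : forall l j, (l < k)%N -> (j < d)%N -> `|X l j| <= 1.
Hypothesis z_le : forall l j, (l < k)%N -> (j < d)%N -> `|z l j| <= 4 * k%:R.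
Hypothesis f_le : forall i l, (i < n)%N -> (l < k)%N -> `|f i l| <= 4 * k%:R.
Hypothesis S_lt : forall c, (c < t)%N -> (G 2 c < d)%N.
Hypothesis guess_z : forall l c, (l < k)%N -> (c < t)%N ->
  `|gr (G (4 + l)%N c) - z l (G 2 c)| <= eta.
Hypothesis guess_X : forall l c, (l < k)%N -> (c < t)%N ->
  `|gr (G (4 + k + l)%N c) - X l (G 2 c)| <= eta.
Hypothesis embedding : forall u : nat -> R,
  \sum_(j < d) `|\sum_(l < k) u l * X l j| <=
  2 * \sum_(c < t) (G 3 c)%:R * `|\sum_(l < k) u l * X l (G 2 c)|.
Hypothesis error_sample :
  \sum_(c < t) (G 3 c)%:R * \sum_(i < n) `|Eps i (G 2 c)| <=
  2 * \sum_(i < n) \sum_(j < d) `|Eps i j|.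
Hypothesis weight_sum : \sum_(c < t) (G 3 c)%:R <= d%:R ^+ 3 :> R.

Let k0r : 0 < k%:R :> R. Proof. by rewrite ltr0n. Qed.
Let k1r : 1 <= k%:R :> R. Proof. by rewrite ler1n. Qed.

(** With exact Z and X the residual of the row fit would be [mu (v - f) X - Eps]. Rounding X costs
    [k * 6 k] and rounding Z costs [k], in units of [mu * eta]. *)
Lemma row_residual i c (v : nat -> R) : (i < n)%N -> (c < t)%N ->
  (forall l, (l < k)%N -> `|v l| <= 6 * k%:R) ->
  `|(\sum_(l < k) mu * gr (G (4 + k + l)%N c) * v l -
     (M i (G 2 c) - \sum_(l < k) M i (d + l)%N * (mu * gr (G (4 + l)%N c)))) -
    (mu * \sum_(l < k) (v l - f i l) * X l (G 2 c) - Eps i (G 2 c))|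
  <= 7 * k%:R ^+ 2 * mu * eta.
Proof.
move=> iN ct vle; have Sd := S_lt ct.
have := residual_decomp iN Sd; set S := G 2 c in Sd * => HD.
have -> : (\sum_(l < k) mu * gr (G (4 + k + l)%N c) * v l -
     (M i S - \sum_(l < k) M i (d + l)%N * (mu * gr (G (4 + l)%N c)))) -
    (mu * \sum_(l < k) (v l - f i l) * X l S - Eps i S) =
    mu * (\sum_(l < k) v l * (gr (G (4 + k + l)%N c) - X l S) +
          \sum_(l < k) M i (d + l)%N * (gr (G (4 + l)%N c) - z l S)).
  have -> : M i S = Eps i S + (\sum_(l < k) M i (d + l)%N * (mu * z l S) +
      \sum_(l < k) mu * f i l * X l S) by rewrite -HD; ring.
  rewrite !mulrDr !mulr_sumr.
  set a := \sum_(l < k) mu * gr _ * v l.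
  set b := \sum_(l < k) M i (d + l)%N * (mu * gr _).
  set e := \sum_(l < k) M i (d + l)%N * (mu * z l S).
  set g := \sum_(l < k) mu * f i l * X l S.
  have -> : \sum_(l < k) mu * ((v l - f i l) * X l S) = \sum_(l < k) mu * (v l * X l S) - g.
    by rewrite -sumrB; apply: eq_bigr => l _; ring.
  have -> : \sum_(l < k) mu * (v l * (gr (G (4 + k + l)%N c) - X l S)) =
     a - \sum_(l < k) mu * (v l * X l S).
    by rewrite -sumrB; apply: eq_bigr => l _; ring.
  have -> : \sum_(l < k) mu * (M i (d + l)%N * (gr (G (4 + l)%N c) - z l S)) = b - e.
    by rewrite -sumrB; apply: eq_bigr => l _; ring.
  by ring.
rewrite normrM ger0_norm //.
have h1 : `|\sum_(l < k) v l * (gr (G (4 + k + l)%N c) - X l S)| <= k%:R * (6 * k%:R * eta).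
  apply: (norm_sum_le (a := v) (b := fun l => gr (G (4 + k + l)%N c) - X l S)) => //.
  by move=> l lk; apply: guess_X.
have h2 : `|\sum_(l < k) M i (d + l)%N * (gr (G (4 + l)%N c) - z l S)| <= k%:R * (1 * eta).
  apply: (norm_sum_le (a := fun l => M i (d + l)%N) (b := fun l => gr (G (4 + l)%N c) - z l S)) => //.
    by move=> l lk; apply: H_le.
  by move=> l lk; apply: guess_z.
rewrite mulrAC [leRHS]mulrC ler_wpM2l //.
apply: le_trans (ler_normD _ _) _; apply: (le_trans (lerD h1 h2)).
have : k%:R * eta <= k%:R ^+ 2 * eta by rewrite ler_wpM2r // expr2 ler_peMr // ltW.
by rewrite expr2; nra.
Qed.

Hypothesis rows : forall i, (i < n)%N -> row_ok d k t N M G mu gr U i.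
Hypothesis cols : forall j, (j < d)%N -> col_ok n k N A M U (G 0%N) mu gr V j.

Definition row_gap (i j : nat) : R := `|\sum_(l < k) (U i (k + l)%N - f i l) * X l j|.

(** The minimiser costs no more than the rounding of the true row [f], whose cost is the sampled
    error up to rounding. By the triangle inequality the sampled gap is at most twice the sampled
    error, and [embedding] adds another factor 2. *)
Lemma row_gap_bound i : (i < n)%N ->
  mu * \sum_(j < d) row_gap i j <=
  4 * \sum_(c < t) (G 3 c)%:R * `|Eps i (G 2 c)| + 44 * k%:R ^+ 2 * mu * eta * d%:R ^+ 3.
Proof.
move=> iN; have [fi [fiN U1 U2 fmin]] := rows iN.
set th := 7 * k%:R ^+ 2 * mu * eta.
have th0 : 0 <= th by rewrite !mulr_ge0 ?exprn_ge0.
set T := fun c => (G 3 c)%:R : R.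
have T0 c : 0 <= T c by [].
have [f' Hf'] : exists f', forall l, (f' l < N)%N /\ ((l < k)%N -> `|gr (f' l) - f i l| <= eta).
  have N0 : (0 < N)%N by apply: leq_ltn_trans (fiN 0%N).
  have /choice [f' Hf'] : forall l, exists c, (c < N)%N /\ ((l < k)%N -> `|gr c - f i l| <= eta).
    move=> l; have [lk|lk] := ltnP l k; last by exists 0%N.
    by have [c cN Hc] := gr_approx (f_le iN lk); exists c.
  by exists f'.
have := fmin f' (fun l => (Hf' l).1).
pose r v c := \sum_(l < k) mu * gr (G (4 + k + l)%N c) * v l -
     (M i (G 2 c) - \sum_(l < k) M i (d + l)%N * (mu * gr (G (4 + l)%N c))).
have costE v : row_cost d k t M G mu gr i v = \sum_(c < t) T c * `|r v c| by [].
rewrite !costE => Hmin.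
have up : \sum_(c < t) T c * `|r (gr \o f') c| <=
   \sum_(c < t) T c * `|Eps i (G 2 c)| + (th + mu * (k%:R * eta)) * \sum_(c < t) T c.
  rewrite mulr_sumr -big_split /=; apply: ler_sum => c _.
  rewrite [(_ + _) * _]mulrC -mulrDr ler_wpM2l //.
  have := @row_residual i c (gr \o f') iN (ltn_ord c) (fun l _ => gr_range (Hf' l).1).
  rewrite -/(r _ _) -/th; set q := \sum_(l < k) _ => Hr.
  have qb : `|q| <= k%:R * (eta * 1).
    apply: (norm_sum_le (a := fun l => gr (f' l) - f i l) (b := fun l => X l (G 2 c))) => //.
      by move=> l lk; apply: (Hf' l).2.
    by move=> l lk; apply: X_le => //; apply: S_lt.
  have mq : `|mu * q| <= mu * (k%:R * eta).
    by rewrite normrM ger0_norm // ler_wpM2l // -[eta]mulr1.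
  have -> : r (gr \o f') c = (r (gr \o f') c - (mu * q - Eps i (G 2 c))) + (mu * q - Eps i (G 2 c)).
    by ring.
  apply: le_trans (ler_normD _ _) _.
  have := ler_normB (mu * q) (Eps i (G 2 c)); lra.
have dn : \sum_(c < t) T c * (mu * `|\sum_(l < k) (U i (k + l)%N - f i l) * X l (G 2 c)|) <=
   \sum_(c < t) T c * `|r (gr \o fi) c| + \sum_(c < t) T c * `|Eps i (G 2 c)| +
   th * \sum_(c < t) T c.
  rewrite mulr_sumr -!big_split /=; apply: ler_sum => c _.
  rewrite [th * _]mulrC -!mulrDr ler_wpM2l //.
  have := @row_residual i c (gr \o fi) iN (ltn_ord c) (fun l _ => gr_range (fiN l)).
  rewrite -/(r _ _) -/th.
  have -> : \sum_(l < k) ((gr \o fi) l - f i l) * X l (G 2 c) =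
            \sum_(l < k) (U i (k + l)%N - f i l) * X l (G 2 c).
    by apply: eq_bigr => l _; rewrite U2.
  set q := \sum_(l < k) _ => Hr.
  rewrite -[mu in mu * _]ger0_norm // -normrM.
  have -> : mu * q = Eps i (G 2 c) + r (gr \o fi) c -
     (r (gr \o fi) c - (mu * q - Eps i (G 2 c))) by ring.
  apply: le_trans (ler_normB _ _) _.
  have := ler_normD (Eps i (G 2 c)) (r (gr \o fi) c); lra.
have emb := embedding (fun l => U i (k + l)%N - f i l).
have {}emb : mu * \sum_(j < d) row_gap i j <=
    2 * \sum_(c < t) T c * (mu * `|\sum_(l < k) (U i (k + l)%N - f i l) * X l (G 2 c)|).
  apply: (le_trans (ler_wpM2l mu0 emb)); rewrite le_eqVlt; apply/orP; left; apply/eqP.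
  by rewrite mulrCA mulr_sumr; congr (_ * _); apply: eq_bigr => c _; rewrite /T; ring.
have kk : mu * (k%:R * eta) <= k%:R ^+ 2 * mu * eta.
  have : k%:R * (mu * eta) <= k%:R ^+ 2 * (mu * eta).
    by rewrite ler_wpM2r ?mulr_ge0 // expr2 ler_peMr // ltW.
  by lra.
have km0 : 0 <= k%:R ^+ 2 * mu * eta by rewrite !mulr_ge0 ?exprn_ge0.
have sT0 : 0 <= \sum_(c < t) T c by apply: sumr_ge0.
have w1 : (th + mu * (k%:R * eta)) * \sum_(c < t) T c <= 8 * (k%:R ^+ 2 * mu * eta) * d%:R ^+ 3.
  apply: ler_pM => //; first by rewrite addr_ge0 // !mulr_ge0 // ltW.
  by rewrite /th; lra.
have w2 : th * \sum_(c < t) T c <= 7 * (k%:R ^+ 2 * mu * eta) * d%:R ^+ 3.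
  by apply: ler_pM => //; rewrite /th; lra.
have d30 : 0 <= (k%:R ^+ 2 * mu * eta) * d%:R ^+ 3 by rewrite mulr_ge0 ?exprn_ge0.
by lra.
Qed.

(** The competitor uses the rounded Z on the columns of H and the rounded X on the fitted columns;
    up to rounding its residual is [mu (U - f) X - Eps]. *)
Lemma col_bound j : (j < d)%N ->
  \sum_(i < n) `|\sum_(l < k + k) U i l * V l j - A i j| <=
  \sum_(i < n) (`|Eps i j| + mu * row_gap i j + 7 * k%:R ^+ 2 * mu * eta).
Proof.
move=> jd; have [fj [fjN Vj fmin]] := cols jd.
have UH i l : (i < n)%N -> (l < k)%N -> U i l = M i (d + l)%N.
  by move=> iN lk; have [fi [_ -> //]] := rows iN.
have U6 i l : (i < n)%N -> (l < k)%N -> `|U i (k + l)%N| <= 6 * k%:R.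
  by move=> iN lk; have [fi [fiN _ -> // _]] := rows iN; apply: gr_range.
have [g Hg] : exists g, forall l, (g l < N)%N /\
   ((l < k)%N -> `|gr (g l) - z l j| <= eta) /\
   ((k <= l < k + k)%N -> `|gr (g l) - X (l - k)%N j| <= eta).
  have N0 : (0 < N)%N by apply: leq_ltn_trans (fjN 0%N).
  have /choice [g Hg] : forall l, exists c, (c < N)%N /\
     ((l < k)%N -> `|gr c - z l j| <= eta) /\
     ((k <= l < k + k)%N -> `|gr c - X (l - k)%N j| <= eta).
    move=> l; have [lk|kl] := ltnP l k.
      by have [c cN Hc] := gr_approx (z_le lk jd); exists c.
    have [lkk|kkl] := ltnP l (k + k).
      have lkk' : (l - k < k)%N by rewrite ltn_subLR.
      have [|c cN Hc] := @gr_approx (X (l - k)%N j).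
        have k1 : 1 <= k%:R :> R by rewrite ler1n.
        by apply: le_trans (X_le lkk' jd) _; lra.
      by exists c.
    by exists 0%N; split=> //; split.
  by exists g.
have := fmin g (fun l => (Hg l).1).
have costE v : col_cost n k M U mu j v =
    \sum_(i < n) `|\sum_(l < k + k) U i l * mu * v l - M i j|.
  by apply: eq_bigr => i _; rewrite mul1r.
rewrite !costE => Hmin.
have -> : \sum_(i < n) `|\sum_(l < k + k) U i l * V l j - A i j| =
          \sum_(i < n) `|\sum_(l < k + k) U i l * mu * (gr \o fj) l - M i j|.
  apply: eq_bigr => -[i iN] _ /=; congr `|_|; rewrite M_decomp //.
  under eq_bigr => l _ do rewrite Vj // mulrDr.
  rewrite big_split /= [X in _ + X - _](_ : _ = \sum_(l < k) M i (d + l)%N * A (G 0%N l) j).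
    rewrite (eq_bigr (fun l : 'I_(k + k) => U i l * mu * gr (fj l))) => [|l _]; last by ring.
    by ring.
  rewrite big_split_ord /= [X in _ + X](_ : _ = 0) ?addr0.
    by apply: eq_bigr => l _; rewrite ltn_ord UH.
  by rewrite big1 // => l _; rewrite ltnNge leq_addr mulr0.
apply: (le_trans Hmin); apply: ler_sum => -[i iN] _ /=.
rewrite big_split_ord /=.
have HD := residual_decomp iN jd.
have -> : \sum_(l < k) U i l * mu * gr (g l) + \sum_(l < k) U i (k + l)%N * mu * gr (g (k + l)%N) - M i j =
   - Eps i j + mu * (\sum_(l < k) (U i (k + l)%N - f i l) * X l j) +
   mu * (\sum_(l < k) M i (d + l)%N * (gr (g l) - z l j) +
         \sum_(l < k) U i (k + l)%N * (gr (g (k + l)%N) - X l j)).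
  have -> : M i j = Eps i j + (\sum_(l < k) M i (d + l)%N * (mu * z l j) +
      \sum_(l < k) mu * f i l * X l j) by rewrite -HD; ring.
  rewrite mulrDr !mulr_sumr.
  rewrite (eq_bigr (fun l : 'I_k => M i (d + l)%N * mu * gr (g l))) => [|l _]; last by rewrite UH.
  set a := \sum_(l < k) M i (d + l)%N * mu * gr (g l).
  set b := \sum_(l < k) U i (k + l)%N * mu * gr _.
  set e := \sum_(l < k) M i (d + l)%N * (mu * z l j).
  set q := \sum_(l < k) mu * f i l * X l j.
  have -> : \sum_(l < k) mu * ((U i (k + l)%N - f i l) * X l j) =
     \sum_(l < k) mu * (U i (k + l)%N * X l j) - q.
    by rewrite -sumrB; apply: eq_bigr => l _; ring.
  have -> : \sum_(l < k) mu * (U i (k + l)%N * (gr (g (k + l)%N) - X l j)) =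
     b - \sum_(l < k) mu * (U i (k + l)%N * X l j).
    by rewrite -sumrB; apply: eq_bigr => l _; ring.
  have -> : \sum_(l < k) mu * (M i (d + l)%N * (gr (g l) - z l j)) = a - e.
    by rewrite -sumrB; apply: eq_bigr => l _; ring.
  by ring.
have h1 : `|\sum_(l < k) M i (d + l)%N * (gr (g l) - z l j)| <= k%:R * (1 * eta).
  apply: (norm_sum_le (a := fun l => M i (d + l)%N) (b := fun l => gr (g l) - z l j)) => //.
    by move=> l lk; apply: H_le.
  by move=> l lk; apply: (Hg l).2.1.
have h2 : `|\sum_(l < k) U i (k + l)%N * (gr (g (k + l)%N) - X l j)| <= k%:R * (6 * k%:R * eta).
  apply: (norm_sum_le (a := fun l => U i (k + l)%N) (b := fun l => gr (g (k + l)%N) - X l j)) => //.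
  - by move=> l lk; apply: U6.
  - move=> l lk; have := (Hg (k + l)%N).2.2; rewrite addKn; apply.
    by rewrite leq_addr ltn_add2l.
apply: le_trans (ler_normD _ _) _; apply: lerD.
  by apply: le_trans (ler_normD _ _) _; rewrite normrN normrM (ger0_norm mu0).
rewrite normrM (ger0_norm mu0) mulrAC [leRHS]mulrC ler_wpM2l //.
apply: le_trans (ler_normD _ _) _; apply: (le_trans (lerD h1 h2)).
have : k%:R * eta <= k%:R ^+ 2 * eta by rewrite ler_wpM2r // expr2 ler_peMr // ltW.
by rewrite expr2; nra.
Qed.

(** Here [9 = 1 + 4 * 2]: the column fits pay E once, and the row gaps pay four times the sampled
    error, which is at most twice E. The rounding terms add up to [51 = 44 + 7]. *)
Lemma fit_bound :
  fit_error n d k A U V <=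
  9 * \sum_(i < n) \sum_(j < d) `|Eps i j| +
  51 * (n%:R * d%:R ^+ 3 * k%:R ^+ 2) * (mu * eta).
Proof.
have d1 : (0 < d)%N -> d%:R <= d%:R ^+ 3 :> R.
  by move=> d0; rewrite -natrX ler_nat -{1}(expn1 d) leq_pexp2l.
have dd : d%:R <= d%:R ^+ 3 :> R.
  by case: (posnP d) => [->|/d1 //]; rewrite expr0n.
set e := k%:R ^+ 2 * mu * eta.
have e0 : 0 <= e by rewrite !mulr_ge0 ?exprn_ge0.
rewrite /fit_error exchange_big /=.
apply: (@le_trans _ _ (\sum_(j < d) \sum_(i < n) (`|Eps i j| + mu * row_gap i j + 7 * e))).
  apply: ler_sum => j _; apply: le_trans (col_bound (ltn_ord j)) _.
  by apply: ler_sum => i _; rewrite /e !mulrA.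
rewrite exchange_big /=.
have step i : (i < n)%N ->
    \sum_(j < d) (`|Eps i j| + mu * row_gap i j + 7 * e) <=
    \sum_(j < d) `|Eps i j| + 4 * \sum_(c < t) (G 3 c)%:R * `|Eps i (G 2 c)| + 51 * e * d%:R ^+ 3.
  move=> iN; rewrite !big_split /= -mulr_sumr sumr_const card_ord -[_ *+ d]mulr_natr.
  have := row_gap_bound iN.
  have -> : 44 * k%:R ^+ 2 * mu * eta = 44 * e by rewrite /e !mulrA.
  have : e * d%:R <= e * d%:R ^+ 3 by rewrite ler_wpM2l.
  lra.
apply: le_trans (ler_sum _ (fun (i : 'I_n) _ => step i (ltn_ord i))) _.
rewrite !big_split /= -mulr_sumr sumr_const card_ord -[_ *+ n]mulr_natr.
have -> : \sum_(i < n) \sum_(c < t) (G 3 c)%:R * `|Eps i (G 2 c)| =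
          \sum_(c < t) (G 3 c)%:R * \sum_(i < n) `|Eps i (G 2 c)|.
  by rewrite exchange_big /=; apply: eq_bigr => c _; rewrite mulr_sumr.
have -> : 51 * (n%:R * d%:R ^+ 3 * k%:R ^+ 2) * (mu * eta) = 51 * e * d%:R ^+ 3 * n%:R.
  by rewrite /e; ring.
by have := error_sample; lra.
Qed.

End FitBound.
End Analysis.

(** * A guess that yields a constant factor approximation *)

Section GoodCandidate.
Variable R : realType.

Lemma opt_rank_le n d k (A B : 'M[R]_(n, d)) : (\rank B <= k)%N -> opt_rank A k <= l1norm (B - A).
Proof.
move=> rB; apply: ge_inf; last by exists B.
by exists 0 => _ [C _ <-]; apply: l1norm_ge0.
Qed.

Lemma le_opt_rank n d k (A : 'M[R]_(n, d)) (y : R) :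
  (forall B : 'M[R]_(n, d), (\rank B <= k)%N -> y <= l1norm (B - A)) -> y <= opt_rank A k.
Proof.
move=> H; apply: lb_le_inf.
  by exists (l1norm (0 - A)); exists 0 => //=; rewrite mxrank0.
by move=> _ [B rB <-]; apply: H.
Qed.

Lemma opt_rank_ge0 n d k (A : 'M[R]_(n, d)) : 0 <= opt_rank A k.
Proof. by apply: le_opt_rank => B _; apply: l1norm_ge0. Qed.

Lemma opt_rank_approx n d k (A : 'M[R]_(n, d)) : 0 < opt_rank A k ->
  exists2 B : 'M[R]_(n, d), (\rank B <= k)%N & l1norm (B - A) <= 2 * opt_rank A k.
Proof.
move=> o0; apply: contrapT => Hno.
have : 2 * opt_rank A k <= opt_rank A k.
  apply: le_opt_rank => B rB; rewrite leNgt; apply/negP => lt.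
  by apply: Hno; exists B => //; apply: ltW.
lra.
Qed.

Lemma grid_approx (nu k N : nat) : (0 < nu)%N -> (9 * (k * nu) < N)%N ->
  exists a : R -> nat, forall y, (a y < N)%N /\
    (`|y| <= 4 * k%:R -> `|grid nu%:R (4 * k%:R) (a y) - y| <= nu%:R^-1).
Proof.
move=> nu0 HN; have nu0r : 0 < nu%:R :> R by rewrite ltr0n.
exists (fun y => if (Num.truncn ((y + 4 * k%:R) * nu%:R) < N)%N
                 then Num.truncn ((y + 4 * k%:R) * nu%:R) else 0%N) => y.
split; first by case: ifP => // _; apply: leq_ltn_trans HN.
move=> Hy; have /andP[y1 y2] : - (4 * k%:R) <= y <= 4 * k%:R by rewrite -ler_norml.
have x0 : 0 <= (y + 4 * k%:R) * nu%:R by rewrite mulr_ge0 // -lerBlDr sub0r.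
have /andP[t1 t2] := truncn_itv x0.
set c := Num.truncn _ in t1 t2 *.
have cN : (c < N)%N.
  apply: leq_ltn_trans HN; rewrite -(@ler_nat R) !natrM; apply: le_trans t1 _.
  by rewrite mulrA ler_wpM2r //; have := ler0n R k; lra.
rewrite cN /grid.
have -> : c%:R / nu%:R - 4 * k%:R - y = - (((y + 4 * k%:R) * nu%:R - c%:R) / nu%:R).
  by field; rewrite gt_eqF.
rewrite normrN ger0_norm; last by rewrite divr_ge0 // subr_ge0.
rewrite ler_pdivrMr // mulVf ?gt_eqF //.
by move: t2; rewrite -natr1; lra.
Qed.

Lemma grid_range (nu k t N c : nat) : (0 < k)%N -> (100 * t <= nu)%N -> (100 <= nu)%N ->
  N = (t + (9 * (k * nu) + 10))%N -> (c < N)%N ->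
  `|grid nu%:R (4 * k%:R) c| <= 6 * k%:R :> R.
Proof.
move=> k0 tnu nu100 -> cN; rewrite /grid.
have nu0r : 0 < nu%:R :> R by rewrite ltr0n (leq_trans _ nu100).
have k1 : 1 <= k%:R :> R by rewrite ler1n.
have c0 : 0 <= c%:R / nu%:R :> R by rewrite divr_ge0.
have c1 : c%:R / nu%:R <= 9 * k%:R + 1 :> R.
  rewrite ler_pdivrMr // mulrDl mul1r.
  have : (c%:R : R) <= (t + (9 * (k * nu) + 10))%:R by rewrite ler_nat ltnW.
  have h1 : 100 * t%:R <= nu%:R :> R by rewrite -natrM ler_nat.
  have h2 : 100 <= nu%:R :> R by rewrite ler_nat.
  rewrite natrD natrD (natrM _ 9) natrM; lra.
by rewrite ler_norml; apply/andP; split; lra.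
Qed.

(** Padding with weight 0 gives the sample a length prescribed in advance. *)
Lemma sum_support d (tau : 'I_d -> nat) (d0 : (0 < d)%N) t :
  (#|[set j | tau j != 0%N]%SET| <= t)%N ->
  exists (S : nat -> 'I_d) (T : nat -> nat),
    (forall c, exists j, T c <= tau j)%N /\
    forall F : 'I_d -> R, \sum_(c < t) (T c)%:R * F (S c) = \sum_j (tau j)%:R * F j.
Proof.
move=> st; set supp := [set j | tau j != 0%N]%SET in st.
pose S c := nth (Ordinal d0) (enum supp) c.
pose T c := if (c < size (enum supp))%N then tau (S c) else 0%N.
exists S, T; split.
  by move=> c; exists (S c); rewrite /T; case: ifP.
move=> F; rewrite -cardE in T *.
transitivity (\sum_(c < #|supp|) (tau (S c))%:R * F (S c)).
  rewrite (big_ord_widen t (fun c : nat => (tau (S c))%:R * F (S c)) st) [RHS]big_mkcond /=.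
  by apply: eq_bigr => c _; rewrite /T; case: ifP => // _; rewrite mul0r.
transitivity (\sum_(j in supp) (tau j)%:R * F j).
  rewrite (big_enum_val (op := +%R) (A := mem supp) (fun j => (tau j)%:R * F j)) /=.
  by apply: eq_bigr => c _; rewrite (enum_val_nth (Ordinal d0)).
rewrite big_mkcond /=; apply: eq_bigr => j _; rewrite inE.
by case: eqP => //= ->; rewrite mul0r.
Qed.

Definition ext1 d (F : 'I_d -> R) (j : nat) : R := if insub j is Some j' then F j' else 0.

Lemma ext1E d (F : 'I_d -> R) (j : 'I_d) : ext1 F j = F j.
Proof. by rewrite /ext1 valK. Qed.

Lemma input_entry n d (A : 'M[R]_(n, d)) k (i : 'I_n) (j : 'I_d) :
  reals (input A k) 0 i j = A i j.
Proof. by rewrite /= !valK. Qed.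

Lemma input_entry0 n d (A : 'M[R]_(n, d)) k i j : (d <= j)%N -> reals (input A k) 0 i j = 0.
Proof. by move=> dj /=; case: insubP => // i' _ _; rewrite insubN // -leqNgt. Qed.

(** For [mu = 0] the bound forces [y = 0], and the convention for division by 0 gives both
    claims. *)
Lemma rescale (mu c y : R) : 0 <= mu -> 0 <= c -> `|y| <= c * mu ->
  mu * (y / mu) = y /\ `|y / mu| <= c.
Proof.
move=> mu0 c0; have [->|mun0] := eqVneq mu 0.
  by rewrite mulr0 normr_le0 => /eqP ->; rewrite !mul0r normr0.
have mup : 0 < mu by rewrite lt_neqAle eq_sym mun0.
move=> H; split; first by rewrite mulrC divfK.
by rewrite normrM normfV (ger0_norm mu0) ler_pdivrMr.
Qed.

(** The constant is [21 = 9 * 2 + 3]: [B] is optimal up to a factor 2, and the rounding term is at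
    most three times the optimum. *)
Lemma good_candidate (C0 : nat) n d k (A : 'M[R]_(n, d)) : C0 = (2 ^ 30)%N ->
  (0 < n)%N -> (0 < d)%N -> (0 < k)%N ->
  let N := num_values C0 n d k in
  let t := num_samples C0 k in
  let gr := grid (resolution C0 n d k)%:R (4 * k%:R) in
  let Af := reals (input A k) 0 in
  exists f : nat -> nat -> nat, (forall r c, (f r c < N)%N) /\
    forall G U V, (forall r c, (r < k + k + 4)%N -> (c < t)%N -> G r c = f r c) ->
      candidate_ok n d k t N Af gr G U V ->
      fit_error n d k Af U V <= 21 * opt_rank A k.
Proof.
move=> HC0 n0 d0 k0 N t gr Af.
have C0p : (0 < C0)%N by rewrite HC0 expn_gt0.
have t0 : (0 < t)%N by apply: num_samples_gt0.
have AfE (i : 'I_n) (j : 'I_d) : Af i j = A i j by apply: input_entry.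
have Af0 i j : (d <= j)%N -> Af i j = 0 by apply: input_entry0.
(* The pivots are stored in rows of length [t], which must have room for [k] of them. *)
have kt : (k <= t)%N.
  rewrite /t /num_samples /bit_size; apply: leq_trans (leq_pmull _ C0p).
  by apply: leq_trans (leq_addr 1 k) (leq_pmulr _ _).
have [p [q [pq_lt H_le1 M_opt]]] := good_pivots k n0 d0 Af0 AfE.
clearbody Af.
pose M := elim_mx d p q Af k.
have decomp i j : (j < d)%N -> M i j = Af i j - \sum_(l < k) M i (d + l)%N * Af (p l) j.
  by apply: elim_mx_decomp.
pose mu := \sum_(i < n) \sum_(j < d) `|M i j|.
have mu0 : 0 <= mu by apply: sumr_ge0 => i _; apply: sumr_ge0.
set opt := opt_rank A k.
have opt0 : 0 <= opt := opt_rank_ge0 k A.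
have M_le i j : (i < n)%N -> (j < d)%N -> `|M i j| <= (k.+1 ^ 2)%:R * opt.
  move=> iN jd; rewrite mulrC -ler_pdivrMr; last by rewrite ltr0n expn_gt0.
  apply: le_opt_rank => B rB; rewrite ler_pdivrMr; last by rewrite ltr0n expn_gt0.
  by rewrite mulrC; apply: M_opt.
have mu_le : mu <= n%:R * (d%:R * (4 * k%:R ^+ 2 * opt)).
  have k1 : (k.+1 ^ 2 <= 4 * k ^ 2)%N.
    by rewrite -!mulnn; move: k0; clear; nia.
  apply: (@le_trans _ _ (\sum_(i < n) \sum_(j < d) (4 * k%:R ^+ 2 * opt))).
    apply: ler_sum => i _; apply: ler_sum => j _.
    apply: le_trans (M_le i j (ltn_ord i) (ltn_ord j)) _.
    by rewrite ler_wpM2r // -natrX -natrM ler_nat.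
  by rewrite !sumr_const !card_ord !mulr_natl.
have M_mu i j : (i < n)%N -> (j < d)%N -> `|M i j| <= mu.
  move=> iN jd; rewrite /mu (bigD1 (Ordinal iN)) //= (bigD1 (Ordinal jd)) //= -addrA lerDl.
  by rewrite addr_ge0 // sumr_ge0 // => a _; apply: sumr_ge0.
pose B1 : 'M[R]_(n, d) := \matrix_(i, j) (A i j - M i j).
have rB1 : (\rank B1 <= k)%N.
  have -> : B1 = (\matrix_(i < n, l < k) M i (d + l)%N) *m (\matrix_(l < k, j < d) Af (p l) j).
    apply/matrixP => i j; rewrite !mxE decomp // AfE opprB addrC subrK.
    by apply: eq_bigr => l _; rewrite !mxE.
  exact: leq_trans (mxrankM_maxl _ _) (rank_leq_col _).
have B1E : l1norm (B1 - A) = mu.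
  apply: eq_bigr => i _; apply: eq_bigr => j _; rewrite !mxE.
  by rewrite addrAC subrr sub0r normrN.
have opt_mu : opt <= mu by rewrite -B1E; apply: opt_rank_le.
(* If the infimum is 0, [mu_le] forces [mu = 0] and [B1] is exact; a positive infimum is approached
   within a factor 2. *)
have [B rB BA] : exists2 B : 'M[R]_(n, d), (\rank B <= k)%N & l1norm (B - A) <= 2 * opt.
  have [ogt|ole] := ltP 0 opt; first exact: opt_rank_approx.
  have E : opt = 0 by apply/eqP; rewrite eq_le ole.
  exists B1 => //; rewrite B1E E mulr0; apply: le_trans mu_le _.
  by rewrite E !mulr0.
set om := l1norm (B - A) in BA.
have om0 : 0 <= om by apply: l1norm_ge0.
have [J [X [X1 BX]]] := bounded_coords d0 rB.
pose E : 'M[R]_(n, d) := A - B.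
have E_le i j : `|E i j| <= om.
  rewrite /om; have := entry_le_l1norm (B - A) i j.
  by rewrite /E !mxE distrC.
pose Xn l := ext1 (X l).
have XnE l (j : 'I_d) : Xn l j = X l j by apply: ext1E.
pose En i j : R := if insub i is Some i' then ext1 (E i') j else 0.
have EnE (i : 'I_n) (j : 'I_d) : En i j = E i j by rewrite /En valK ext1E.
(* Since B = B_J X, this is also E_J X - E on the pivot rows, hence of size O(k mu) although A
   itself may be huge. *)
pose Zn l j := \sum_(m < k) Af (p l) (J m) * Xn m j - Af (p l) j.
pose Fn i l := M i (J l) - En i (J l).
have Zn_le l j : (j < d)%N -> `|Zn l j| <= (4 * k%:R) * mu.
  move=> jd; pose j' : 'I_d := Ordinal jd; pose i' : 'I_n := Ordinal (pq_lt l).1.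
  have -> : Zn l j = \sum_(m < k) E i' (J m) * X m j' - E i' j'.
    rewrite /Zn (AfE i' j') (_ : A i' j' = B i' j' + E i' j'); last by rewrite !mxE; ring.
    rewrite {1}BX opprD addrA -sumrB; congr (_ - _); apply: eq_bigr => m _.
    by rewrite (XnE m j') (AfE i' (J m)) !mxE; ring.
  apply: le_trans (ler_normB _ _) _.
  have h1 : `|\sum_(m < k) E i' (J m) * X m j'| <= k%:R * (om * 1).
    exact: (norm_sum_le (a := fun m => E i' (J m)) (b := fun m => X m j')).
  have h2 := E_le i' j'.
  have k1 : 1 <= k%:R :> R by rewrite ler1n.
  have kom : om <= k%:R * om by rewrite ler_peMl.
  have kom2 : k%:R * om <= k%:R * (2 * mu) by rewrite ler_wpM2l //; move: BA opt_mu; clear; lra.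
  by move: h1 h2 kom kom2; clear; lra.
have Fn_le i l : (i < n)%N -> `|Fn i l| <= (4 * k%:R) * mu.
  move=> iN; apply: le_trans (ler_normB _ _) _.
  have h1 := M_mu i (J l) iN (ltn_ord _).
  have h2 : `|En i (J l)| <= om by rewrite (EnE (Ordinal iN)).
  have k1 : 1 <= k%:R :> R by rewrite ler1n.
  have : mu <= k%:R * mu by rewrite ler_peMl.
  by move: h1 h2 BA opt_mu mu0; clear; lra.
pose z l j := Zn l j / mu; pose fc i l := Fn i l / mu.
have k40 : 0 <= 4 * k%:R :> R by rewrite mulr_ge0.
have zE l j : (j < d)%N -> mu * z l j = Zn l j /\ `|z l j| <= 4 * k%:R.
  by move=> jd; apply: rescale => //; apply: Zn_le.
have fE i l : (i < n)%N -> mu * fc i l = Fn i l /\ `|fc i l| <= 4 * k%:R.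
  by move=> iN; apply: rescale => //; apply: Fn_le.
have res_decomp i j : (i < n)%N -> (j < d)%N ->
    M i j - En i j = \sum_(l < k) M i (d + l)%N * Zn l j + \sum_(l < k) Fn i l * Xn l j.
  move=> iN jd; pose i' : 'I_n := Ordinal iN; pose j' : 'I_d := Ordinal jd.
  have FX : \sum_(l < k) Fn i l * Xn l j = B i' j' -
      \sum_(l < k) M i (d + l)%N * \sum_(m < k) Af (p l) (J m) * Xn m j.
    under [X in _ - X]eq_bigr do rewrite mulr_sumr.
    rewrite exchange_big /= BX -sumrB; apply: eq_bigr => m _.
    rewrite /Fn decomp // (EnE i') (AfE i' (J m)) (XnE m j') !mxE.
    under [X in _ = _ - X]eq_bigr do rewrite mulrA.
    by rewrite -mulr_suml; ring.
  rewrite FX (EnE i' j') decomp // (AfE i' j') !mxE /Zn.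
  under [X in _ = X + _]eq_bigr do rewrite mulrBr.
  by rewrite sumrB; ring.
(* The column masses of E form one more row. The test vectors (u, 0) and (0, 1) then yield the
   embedding and the error estimate from the same sample, of dimension [k + 1]. *)
pose e : 'rV[R]_d := \row_j \sum_i `|E i j|.
pose Vm : 'M[R]_(k + 1, d) := col_mx (\matrix_(l, j) X l j) e.
have D0 : (0 < k + 1)%N by rewrite addn1.
have [tau [tau_card tau_le tau_emb]] := sparsify HC0 Vm D0.
have [S [T [T_le T_sum]]] := @sum_support d tau d0 t tau_card.
have mass_u (u : nat -> R) j :
    col_mass Vm (row_mx (\row_l u l) 0) j = `|\sum_(l < k) u l * X l j|.
  rewrite /col_mass mul_row_col mul0mx addr0 mxE; congr `|_|.
  by apply: eq_bigr => l _; rewrite !mxE.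
have mass_e j : col_mass Vm (row_mx 0 1%:M) j = \sum_i `|E i j|.
  rewrite /col_mass mul_row_col mul0mx add0r mul1mx mxE ger0_norm //.
  by apply: sumr_ge0.
have x0 : (0 < n * (d * k))%N by rewrite !muln_gt0 n0 d0.
have x40 : (0 < (n * (d * k)) ^ 4)%N by rewrite expn_gt0 x0.
have res0 : (0 < resolution C0 n d k)%N.
  by rewrite /resolution muln_gt0 t0 muln_gt0 x40.
have res_t : (100 * t <= resolution C0 n d k)%N.
  by rewrite /resolution leq_mul2r (leq_pmulr 100 x40) orbT.
have res_x : (100 * (n * (d * k)) ^ 4 <= resolution C0 n d k)%N.
  by rewrite /resolution leq_pmulr.
have NE : N = (t + (9 * (k * resolution C0 n d k) + 10))%N by [].
have kN : (9 * (k * resolution C0 n d k) < N)%N by rewrite NE; clear; lia.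
have [ap Hap] := grid_approx res0 kN.
have big_N : (resolution C0 n d k < N)%N.
  rewrite NE; have : (resolution C0 n d k <= k * resolution C0 n d k)%N by rewrite leq_pmull.
  by clear; lia.
have nx : (n <= n * (d * k))%N by rewrite leq_pmulr // muln_gt0 d0.
have dx : (d <= n * (d * k))%N by rewrite mulnCA leq_pmulr // muln_gt0 n0.
have x4 m : (m <= 4)%N -> ((n * (d * k)) ^ m <= (n * (d * k)) ^ 4)%N by move=> m4; rewrite leq_pexp2l.
have pow_N m y : (0 < m <= 4)%N -> (y <= n * (d * k))%N -> (y ^ m < N)%N.
  move=> /andP[m0 m4] yx; apply: leq_ltn_trans big_N; apply: leq_trans res_x.
  apply: (@leq_trans ((n * (d * k)) ^ m)); first by rewrite leq_exp2r.
  by apply: leq_trans (x4 m m4) _; rewrite leq_pmull.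
pose f r c := if r == 0%N then p c else if r == 1%N then q c
  else if r == 2%N then S c : nat else if r == 3%N then T c
  else if (r < 4 + k)%N then ap (z (r - 4)%N (S c)) else ap (Xn (r - (4 + k))%N (S c)).
exists f; split.
  move=> r c; rewrite /f; case: ifP => _.
    by apply: leq_trans (pq_lt c).1 (ltnW (pow_N 1%N n isT nx)).
  case: ifP => _; first by apply: leq_trans (pq_lt c).2 (ltnW (pow_N 1%N d isT dx)).
  case: ifP => _; first by apply: leq_trans (ltn_ord _) (ltnW (pow_N 1%N d isT dx)).
  case: ifP => _.
    by have [j Tj] := T_le c; apply: leq_ltn_trans Tj (leq_ltn_trans (tau_le j) (pow_N 2%N d isT dx)).
  by case: ifP => _; have [] := Hap (z (r - 4)%N (S c)); have [] := Hap (Xn (r - (4 + k))%N (S c)).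
move=> G U V HG [M' [mu' [HM' Hmu' rows cols]]].
have lk4 l : (l < k)%N -> (4 + l < k + k + 4)%N by clear; lia.
have lkk4 l : (l < k)%N -> (4 + k + l < k + k + 4)%N by clear; lia.
have G0 l : (l < k)%N -> G 0%N l = p l.
  by move=> lk; rewrite HG //; [clear; lia|exact: leq_trans kt].
have G1 l : (l < k)%N -> G 1%N l = q l.
  by move=> lk; rewrite HG //; [clear; lia|exact: leq_trans kt].
have G2 c : (c < t)%N -> G 2 c = S c by move=> ct; rewrite HG //; clear; lia.
have G3 c : (c < t)%N -> G 3 c = T c by move=> ct; rewrite HG //; clear; lia.
have Gz l c : (l < k)%N -> (c < t)%N -> G (4 + l)%N c = ap (z l (S c)).
  by move=> lk ct; rewrite HG // ?lk4 // /f /= addKn ltn_add2l lk.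
have GX l c : (l < k)%N -> (c < t)%N -> G (4 + k + l)%N c = ap (Xn l (S c)).
  by move=> lk ct; rewrite HG // ?lkk4 // /f /= addKn ltnNge leq_addr.
have ME i j : (i < n)%N -> (j < d + k)%N -> M' i j = M i j.
  move=> iN jN; rewrite HM' //.
    congr (_ i j); apply: elim_mx_ext => l lk; by rewrite G0 ?G1.
  by move=> r rk; rewrite G0 ?G1 //; apply: pq_lt.
have MEd i j : (i < n)%N -> (j < d)%N -> M' i j = M i j.
  by move=> iN jd; apply: ME => //; apply: leq_trans jd (leq_addr _ _).
have MEh i l : (i < n)%N -> (l < k)%N -> M' i (d + l)%N = M i (d + l)%N.
  by move=> iN lk; apply: ME => //; rewrite ltn_add2l.
have mu'E : mu' = mu.
  by rewrite Hmu'; apply: eq_bigr => i _; apply: eq_bigr => j _; rewrite MEd.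
rewrite mu'E in rows cols.
have eta0 : 0 <= (resolution C0 n d k)%:R^-1 :> R by rewrite invr_ge0.
have sumE : \sum_(i < n) \sum_(j < d) `|En i j| = om.
  apply: eq_bigr => i _; apply: eq_bigr => j _; rewrite EnE !mxE distrC //.
have bound := @fit_bound R n d k t N gr (resolution C0 n d k)%:R^-1 mu Af M' G U V Xn z fc En k0 eta0 mu0.
have {}bound : fit_error n d k Af U V <=
  9 * \sum_(i < n) \sum_(j < d) `|En i j| +
  51 * (n%:R * d%:R ^+ 3 * k%:R ^+ 2) * (mu * (resolution C0 n d k)%:R^-1).
  apply: bound => //.
  - move=> c cN; apply: (@grid_range _ _ t N) => //.
    by apply: leq_trans res_t; rewrite -{1}[100%N]muln1 leq_mul2l t0 orbT.
  - by move=> y Hy; exists (ap y); [have [] := Hap y|have [_ ] := Hap y; apply].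
  - move=> i j iN jd; rewrite MEd // decomp //; congr (_ - _).
    by apply: eq_bigr => l _; rewrite MEh // G0.
  - move=> i j iN jd; rewrite MEd // res_decomp //; congr (_ + _); apply: eq_bigr => l _.
      by rewrite MEh // (zE l j jd).1.
    by rewrite (fE i l iN).1.
  - by move=> i l iN lk; rewrite MEh //; apply: H_le1.
  - by move=> l j lk jd; rewrite (XnE l (Ordinal jd)).
  - by move=> l j lk jd; apply: (zE l j jd).2.
  - by move=> i l iN lk; apply: (fE i l iN).2.
  - by move=> c ct; rewrite G2.
  - by move=> l c lk ct; rewrite Gz // G2 //; apply: (Hap _).2; apply: (zE _ _ _).2.
  - move=> l c lk ct; rewrite GX // G2 //; apply: (Hap _).2.
    rewrite XnE; apply: le_trans (X1 _ _) _.
    have k1 : 1 <= k%:R :> R by rewrite ler1n.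
    by move: k1; clear; lra.
  - move=> u; have /andP[lo _] := tau_emb (row_mx (\row_l u l) 0).
    have -> : \sum_(j < d) `|\sum_(l < k) u l * Xn l j| =
       \sum_j col_mass Vm (row_mx (\row_l u l) 0) j.
      by apply: eq_bigr => j _; rewrite mass_u; congr `|_|; apply: eq_bigr => l _; rewrite XnE.
    have -> : \sum_(c < t) (G 3 c)%:R * `|\sum_(l < k) u l * Xn l (G 2 c)| =
       \sum_j (tau j)%:R * col_mass Vm (row_mx (\row_l u l) 0) j.
      rewrite -T_sum; apply: eq_bigr => c _; rewrite G3 // G2 // mass_u.
      by congr (_ * `|_|); apply: eq_bigr => l _; rewrite XnE.
    by move: lo; clear; lra.
  - have /andP[_ hi] := tau_emb (row_mx 0 1%:M).
    have -> : \sum_(c < t) (G 3 c)%:R * \sum_(i < n) `|En i (G 2 c)| =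
       \sum_j (tau j)%:R * col_mass Vm (row_mx 0 1%:M) j.
      rewrite -T_sum; apply: eq_bigr => c _; rewrite G3 // G2 // mass_e.
      by congr (_ * _); apply: eq_bigr => i _; rewrite EnE.
    apply: (le_trans hi); rewrite ler_wpM2l // exchange_big /=.
    by apply: ler_sum => j _; rewrite mass_e; apply: ler_sum => i _; rewrite EnE.
  - rewrite (eq_bigr (fun c : 'I_t => (T c)%:R * 1)) => [|c _]; last by rewrite G3 // mulr1.
    rewrite (T_sum (fun=> 1)).
    apply: (@le_trans _ _ (\sum_(j < d) (d ^ 2)%:R)).
      by apply: ler_sum => j _; rewrite mulr1 ler_nat.
    by rewrite sumr_const card_ord -[_ *+ d]mulr_natr -natrM -expnSr natrX.
apply: (le_trans bound); rewrite sumE.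
have res_r : 100 * (n%:R * (d%:R * k%:R)) ^+ 4 <= (resolution C0 n d k)%:R :> R.
  by rewrite -!natrM -natrX -natrM ler_nat.
have rr0 : 0 < (resolution C0 n d k)%:R :> R by rewrite ltr0n.
have last : 51 * (n%:R * d%:R ^+ 3 * k%:R ^+ 2) * (mu * (resolution C0 n d k)%:R^-1) <= 3 * opt.
  rewrite mulrA ler_pdivrMr //.
  apply: (@le_trans _ _ (3 * opt * (100 * (n%:R * (d%:R * k%:R)) ^+ 4))); last first.
    by rewrite ler_wpM2l // mulr_ge0.
  apply: (@le_trans _ _ (51 * (n%:R * d%:R ^+ 3 * k%:R ^+ 2) * (n%:R * (d%:R * (4 * k%:R ^+ 2 * opt))))).
    by rewrite ler_wpM2l // !mulr_ge0 ?exprn_ge0.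
  have nn : (n%:R : R) ^+ 2 <= n%:R ^+ 4 by rewrite -!natrX ler_nat leq_pexp2l.
  have dk0 : 0 <= opt * (d%:R ^+ 4 * k%:R ^+ 4) by rewrite !mulr_ge0 ?exprn_ge0.
  have h : opt * (d%:R ^+ 4 * k%:R ^+ 4) * n%:R ^+ 2 <= opt * (d%:R ^+ 4 * k%:R ^+ 4) * n%:R ^+ 4.
    by rewrite ler_wpM2l.
  rewrite [leLHS](_ : _ = 204 * (opt * (d%:R ^+ 4 * k%:R ^+ 4) * n%:R ^+ 2)); last by ring.
  rewrite [leRHS](_ : _ = 300 * (opt * (d%:R ^+ 4 * k%:R ^+ 4) * n%:R ^+ 4)); last by ring.
  have : 0 <= opt * (d%:R ^+ 4 * k%:R ^+ 4) * n%:R ^+ 2 by rewrite mulr_ge0 ?exprn_ge0.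
  by move: (opt * (d%:R ^+ 4 * k%:R ^+ 4) * n%:R ^+ 2) (opt * (d%:R ^+ 4 * k%:R ^+ 4) * n%:R ^+ 4) h => a b h a0; clear -h a0; lra.
by move: last BA; clear; lra.
Qed.

End GoodCandidate.

(** * Running time *)

Section RunningTime.
Local Open Scope nat_scope.

Lemma bit_size_gt (k : nat) : k + 1 < 2 ^ bit_size k.
Proof. exact: trunc_log_ltn. Qed.

(** As [k] is not bounded by [n d], its powers are charged to [2 ^ bit_size k]. The exponents add up
    to [44 + 7 l <= 60 l]. *)
Lemma num_values_le (C0 n d k b : nat) : C0 = 2 ^ 30 ->
  0 < n -> 0 < d -> 0 < k -> 2 <= b -> n * d <= b ->
  num_values C0 n d k <= b ^ (60 * bit_size k).
Proof.
move=> HC0 n0 d0 k0 b2 ndb; set l := bit_size k.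
have l0 : 0 < l by [].
have kl : k + 1 <= 2 ^ l by apply/ltnW/bit_size_gt.
have ll : l <= 2 ^ l by apply/ltnW/ltn_expl.
have k2 : k <= 2 ^ l by apply: leq_trans (leq_addr 1 k) kl.
set t := num_samples C0 k.
have tle : t <= 2 ^ (30 + 2 * l).
  by rewrite /t /num_samples HC0 expnD leq_mul2l mul2n -addnn expnD leq_mul // orbT.
have t1 : 0 < t by apply: num_samples_gt0; rewrite HC0 expn_gt0.
have x4 : (n * (d * k)) ^ 4 <= b ^ 4 * 2 ^ (4 * l).
  rewrite mulnA expnMn; apply: leq_mul; first by rewrite leq_exp2r.
  by rewrite mulnC expnM leq_exp2r.
have x40 : 0 < b ^ 4 * 2 ^ (4 * l) by rewrite muln_gt0 !expn_gt0 (leq_trans _ b2).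
set y := b ^ 4 * 2 ^ (4 * l) in x4 x40.
have Nle : num_values C0 n d k <= 2 ^ 10 * (2 ^ l * y * 2 ^ (30 + 2 * l)).
  rewrite /num_values -/t /resolution -/t.
  set u := 2 ^ (30 + 2 * l) in tle *.
  have h1 : k * (100 * (n * (d * k)) ^ 4 * t) <= 100 * (2 ^ l * y * u).
    rewrite (_ : k * _ = 100 * (k * (n * (d * k)) ^ 4 * t)); last by ring.
    by rewrite leq_mul2l /=; apply: leq_mul => //; apply: leq_mul.
  have h2 : t <= 2 ^ l * y * u.
    by apply: leq_trans tle _; rewrite leq_pmull // muln_gt0 x40 expn_gt0.
  have h3 : 0 < 2 ^ l * y * u.
    by rewrite muln_gt0 muln_gt0 x40 !expn_gt0.
  set v := 2 ^ l * y * u in h1 h2 h3 *; set w := k * _ in h1 *.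
  by rewrite (_ : 2 ^ 10 = 1024) //; clearbody v w; clear - h1 h2 h3; lia.
apply: leq_trans Nle _.
have e2 m : 2 ^ m <= b ^ m by case: m => // m; rewrite leq_exp2r.
apply: (@leq_trans (b ^ 10 * (b ^ l * (b ^ 4 * b ^ (4 * l)) * b ^ (30 + 2 * l)))).
  apply: leq_mul; first exact: e2.
  apply: leq_mul; last exact: e2.
  apply: leq_mul; first exact: e2.
  by apply: leq_mul; last exact: e2.
by rewrite -!expnD leq_exp2l //; lia.
Qed.

(** The number of digits is of order k^2 log k, and the base [N] contributes one more logarithm. The
    [12] is attained at [k = 1], where [(2 k + 4) (k + 1) = 12]. *)
Lemma exponent_le (C0 k : nat) : 0 < k ->
  60 * bit_size k * (3 * k + (2 * k + 4) * num_samples C0 k + 900) <=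
  60 * (12 * C0 + 903) * (k ^ 2 * bit_size k ^ 2).
Proof.
move=> k0; rewrite /num_samples; set l := bit_size k; have l0 : 0 < l by [].
have -> : 60 * (12 * C0 + 903) * (k ^ 2 * l ^ 2) = 60 * l * ((12 * C0 + 903) * (k ^ 2 * l)) by ring.
rewrite leq_mul2l; apply/orP; right.
have kk : k <= k ^ 2 by rewrite -{1}(expn1 k) leq_pexp2l.
have k20 : 0 < k ^ 2 by rewrite expn_gt0 k0.
have kl : k ^ 2 <= k ^ 2 * l by rewrite leq_pmulr.
have h : (2 * k + 4) * (C0 * ((k + 1) * l)) <= 12 * C0 * (k ^ 2 * l).
  have h1 : (2 * k + 4) * (k + 1) <= 12 * k ^ 2 by rewrite -mulnn; nia.
  rewrite (_ : (2 * k + 4) * (C0 * ((k + 1) * l)) = C0 * l * ((2 * k + 4) * (k + 1))); last by ring.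
  rewrite (_ : 12 * C0 * (k ^ 2 * l) = C0 * l * (12 * k ^ 2)); last by ring.
  by rewrite leq_mul2l h1 orbT.
rewrite [leqRHS]mulnDl.
move: (k ^ 2) kk k20 kl h => a kk k20 kl h.
clear - kk k20 kl h; lia.
Qed.

End RunningTime.

(** * Comparison of binary and natural logarithms *)

Section SoftO.
Variable R : realType.

Lemma bit_size_le_ln (k : nat) : (0 < k)%N ->
  (bit_size k)%:R <= 2 * (1 + ln ((k ^ 2)%:R)) :> R.
Proof.
move=> k0; have k0r : 0 < k%:R :> R by rewrite ltr0n.
have k1r : 1 <= k%:R :> R by rewrite ler1n.
have lnk0 : 0 <= ln k%:R :> R by apply: ln_ge0.
(* From [ln y <= y - 1] at [y = 1 / 2]. *)
have half : 1 / 2 <= ln 2 :> R.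
  have := @le_ln1Dx R (- (1 / 2)); rewrite (_ : 1 + - (1 / 2) = 2^-1); last by field.
  rewrite lnV ?posrE // => H.
  have : - ln 2 <= - (1 / 2) :> R by apply: H; lra.
  by lra.
rewrite natrX lnXn // -[_ *+ 2]mulr_natl.
rewrite /bit_size; set m := trunc_log 2 (k + 1).
have mk : (2 ^ m <= 2 * k)%N.
  have k1 : (0 < k + 1)%N by rewrite addn1.
  by apply: leq_trans (trunc_logP (isT : (1 < 2)%N) k1) _; rewrite mul2n -addnn leq_add2l.
have : ln (2 ^+ m) <= ln (2 * k%:R) :> R.
  by rewrite ler_ln ?posrE ?exprn_gt0 ?mulr_gt0 // -natrX -natrM ler_nat.
rewrite lnXn // lnM ?posrE // -[_ *+ m]mulr_natl -natr1.
case: m {mk} => [|m]; first by lra.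
have m0 : 0 <= m%:R :> R by [].
by rewrite -natr1; nra.
Qed.

End SoftO.

Theorem theoremC9 (R : realType) :
  exists (alg : cmd) (g : nat -> R) (K : R),
    is_softO (fun k => (k ^ 2)%:R) g /\
    forall (n d : nat) (A : 'M[R]_(n, d)) (k : nat),
      (0 < n)%N -> (0 < d)%N -> (1 <= k)%N ->
      (forall w : nat -> R, unit_tape w ->
         halts_within alg w (input A k) ((maxn 2 (n * d))%:R `^ g k)) /\
      (forall (dT : measure_display) (T : measurableType dT)
              (P : probability T R) (u : nat -> {RV P >-> R}),
         iid_uniform u ->
         holds_with_prob P
           [set x : T | exists (t : nat) (s : state R),
              exec (fun i => u i x) alg (input A k) t s /\
              let U := output n (2 * k) 1 s in
              let V := output (2 * k) d 2 s in
              l1norm (U *m V - A) <= K * opt_rank A k]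
           (9 / 10)).
Proof.
(* Named through an equation, so that [2 ^ 30] is never unfolded as a unary number. *)
have [C0 HC0] : exists C0, C0 = (2 ^ 30)%N by eexists.
have C0p : (0 < C0)%N by rewrite HC0 expn_gt0.
(* The factor 4 comes from [bit_size k ^ 2 <= 4 (1 + ln (k ^ 2)) ^ 2]. The same [C] serves as the
   exponent in [is_softO], which only has to be at least 2. *)
have [C HC] : exists C, C = (4 * (60 * (12 * C0 + 903)))%N by eexists.
pose g (k : nat) : R := C%:R * (k ^ 2)%:R * (1 + ln (k ^ 2)%:R) ^+ C.
exists (algorithm C0), g, 21; split; first by exists C.
move=> n d A k n0 d0 k0.
have run w : exists t s, [/\ exec w (algorithm C0) (input A k) t s,
    t%:R <= (maxn 2 (n * d))%:R `^ g k &
    fit_error n d k (reals (input A k) 0) (reals s 1) (reals s 2) <= 21 * opt_rank A k].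
  have [f [fN Hf]] := good_candidate A HC0 n0 d0 k0.
  have dims : has_dims n d k (input A k) by [].
  have [t [s [ex tle Q]]] := runs_algorithm w C0p n0 d0 k0 dims (fun s H => H).
  exists t, s; split=> //; last first.
    by have [G [U [V [HG ok le_err]]]] := Q f fN; apply: le_trans le_err (Hf G U V HG ok).
  set b := maxn 2 (n * d).
  have b2 : (2 <= b)%N by rewrite leq_maxl.
  have ndb : (n * d <= b)%N by rewrite leq_maxr.
  have {}tle : (t <= b ^ (60 * (12 * C0 + 903) * (k ^ 2 * bit_size k ^ 2)))%N.
    apply: leq_trans tle _; set x := (_ + 900)%N.
    apply: (@leq_trans ((b ^ (60 * bit_size k)) ^ x)%N).
      by rewrite leq_exp2r //; [exact: num_values_le|rewrite /x addnS].
    by rewrite -expnM leq_exp2l //; apply: exponent_le.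
  apply: (@le_trans _ _ (b ^ (60 * (12 * C0 + 903) * (k ^ 2 * bit_size k ^ 2)))%:R).
    by rewrite ler_nat.
  rewrite natrX -powR_mulrn //; apply: ler_powR; first by rewrite ler1n (leq_trans _ b2).
  have ln0 : 0 <= ln (k ^ 2)%:R :> R by apply: ln_ge0; rewrite ler1n expn_gt0 k0.
  have C2 : (2 <= C)%N by rewrite HC; lia.
  have C40 : 4 * (60 * (12 * C0 + 903))%:R = C%:R :> R by rewrite HC [RHS]natrM.
  have lk : (bit_size k ^ 2)%:R <= 4 * (1 + ln (k ^ 2)%:R) ^+ 2 :> R.
    rewrite natrX (_ : 4 * _ = (2 * (1 + ln (k ^ 2)%:R)) ^+ 2); last by ring.
    by rewrite ler_pXn2r ?nnegrE // ?bit_size_le_ln // mulr_ge0 // addr_ge0.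
  have pw : (1 + ln (k ^ 2)%:R) ^+ 2 <= (1 + ln (k ^ 2)%:R) ^+ C :> R.
    by rewrite ler_weXn2l // lerDl.
  rewrite /g -C40 natrM (natrM _ (k ^ 2)) [leRHS](_ : _ = (60 * (12 * C0 + 903))%:R *
     ((k ^ 2)%:R * (4 * (1 + ln (k ^ 2)%:R) ^+ C))); last by ring.
  apply: ler_wpM2l; first exact: ler0n.
  apply: ler_wpM2l; first exact: ler0n.
  by apply: le_trans lk _; apply: ler_wpM2l pw.
split.
  by move=> w _; have [t [s [ex tle _]]] := run w; exists t, s.
(* The guarantee holds for every tape, so the event is the whole space. *)
move=> dT T P u _; exists setT; split; first exact: measurableT.
  move=> x _ /=; have [t [s [ex _ err]]] := run (fun i => u i x).
  exists t, s; split=> //; apply: le_trans err.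
  rewrite le_eqVlt; apply/orP; left; apply/eqP.
  apply: eq_bigr => i _; apply: eq_bigr => j _.
  rewrite !mxE input_entry mul2n -addnn; congr `|_ - _|.
  by apply: eq_bigr => l _; rewrite !mxE.
by rewrite probability_setT lee_fin; lra.
Qed.
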